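(* Let $L>0$, let $\rho,EI:[0,L]\to\mathbb R$ be uniformly positive with $\rho,\rho^{-1},EI,(EI)^{-1}\in L^\infty([0,L];\mathbb R)$, and let $m=\int_0^L\rho(\xi)\,d\xi$. Let $\mathcal D_{\rm r}=(\mathcal D_{{\rm r},x_{\rm r}})_{x_{\rm r}\in\mathcal X_{\rm r}}$, $\mathcal D_{\rm f}=(\mathcal D_{{\rm f},x_{\rm f}})_{x_{\rm f}\in\mathcal X_{\rm f}}$, $\mathcal L_{\rm r}$, $\mathcal L_{\rm f}$ and $\mathcal Z_{\rm c}=\mathbb R^4$ be as defined in the context. For $(x_{\rm r},x_{\rm f})\in\mathcal X_{\rm r}\times\mathcal X_{\rm f}$ let $$\Gamma_{x_{\rm r},x_{\rm f}}:\mathcal D_{{\rm r},x_{\rm r}}\times\mathcal D_{{\rm f},x_{\rm f}}\to\mathcal Z_{\rm c}\times\mathcal Z_{\rm c},\qquad (d_{\rm r},d_{\rm f})\mapsto\begin{pmatrix} f_{\rm c}^{\rm r}-f_{\rm c}^{\rm f}\\ e_{\rm c}^{\rm r}+e_{\rm c}^{\rm f}\end{pmatrix}.$$ Then: 1. $\Gamma_{x_{\rm r},x_{\rm f}}$ is surjective for every $(x_{\rm r},x_{\rm f})\in\mathcal X_{\rm r}\times\mathcal X_{\rm f}$. 2. Consequently, $\mathcal D_{\rm b}:=\Pi(\mathcal D_{\rm r}\circ_{\mathcal Z_{\rm c}}\mathcal D_{\rm f})$ is a modulated Dirac structure, where $\Pi$ is the fixed permutation of components (applied simultaneously to flows and efforts)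 that groups the rigid and flexible storage variables and the remaining external ports. 3. Together with $\mathcal L_{\rm b}:=\mathcal L_{\rm r}\times\mathcal L_{\rm f}$ and the trivial resistive relation (on the zero space), $\mathcal D_{\rm b}$ defines a port-Hamiltonian system on $\mathcal X_{\rm r}\times\mathcal X_{\rm f}$. 4. On the invariant subset $\ell_{\rm r}(\boldsymbol\zeta_{\rm r})=L$, this system, with external variables $e_{\rm ext}^{\rm r}=-(\boldsymbol F_0,\boldsymbol F_f)$, $e_{\rm M}^{\rm f}=-(M_0,M_f)$, $f_{\rm ext}^{\rm r}=(\boldsymbol v_0,\boldsymbol v_f)$, $f_{\rm M}^{\rm f}=(\omega_0,\omega_f)$, is precisely the following moving-beam model for $(\boldsymbol\zeta_{\rm r},p_{\mathtt t},\kappa,p_{\rm b})$, with $EI\kappa(t),\rho^{-1}p_{\rm b}(t)\in H^2([0,L];\mathbb R)$: $$\dot{\boldsymbol\zeta}_{\rm r}=Z(\boldsymbol\zeta_{\rm r})\begin{pmatrix}p_{\mathtt t}/m\\(\rho^{-1}p_{\rm b})(0)\\(\rho^{-1}p_{\rm b})(L)\end{pmatrix},\qquad \dot p_{\mathtt t}=\omega\int_0^Lp_{\rm b}(\xi)\,d\xi+\mathtt t^\top\boldsymbol F_0+\mathtt t^\top\boldsymbol F_f,$$ $$\tfrac{\partial\kappa}{\partial t}=\tfrac{\partial^2}{\partial\xi^2}(\rho^{-1}p_{\rm b}),\qquad \tfrac{\partial p_{\rm b}}{\partial t}=-\tfrac{\partial^2}{\partial\xi^2}(EI\kappa)-\rho\,\omega\,\tfrac{p_{\mathtt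 t}}m,\qquad \omega=\tfrac{(\rho^{-1}p_{\rm b})(L)-(\rho^{-1}p_{\rm b})(0)}{L},$$ with boundary conditions $$\tfrac{\partial}{\partial\xi}(EI\kappa)(0)=\mathtt n^\top\boldsymbol F_0,\quad -\tfrac{\partial}{\partial\xi}(EI\kappa)(L)=\mathtt n^\top\boldsymbol F_f,\quad -(EI\kappa)(0)=M_0,\quad (EI\kappa)(L)=M_f,$$ and outputs $$\boldsymbol v_0=\tfrac{p_{\mathtt t}}m\mathtt t+(\rho^{-1}p_{\rm b})(0)\mathtt n,\quad \boldsymbol v_f=\tfrac{p_{\mathtt t}}m\mathtt t+(\rho^{-1}p_{\rm b})(L)\mathtt n,\quad \omega_0=\tfrac{\partial}{\partial\xi}(\rho^{-1}p_{\rm b})(0),\quad \omega_f=\tfrac{\partial}{\partial\xi}(\rho^{-1}p_{\rm b})(L),$$ where $\mathtt t=\mathtt t(\boldsymbol\zeta_{\rm r})$, $\mathtt n=\mathtt n(\boldsymbol\zeta_{\rm r})$. Its storage function is $$\mathcal H_{\rm b}=\tfrac{p_{\mathtt t}^2}{2m}+\tfrac12\int_0^L\bigl(\rho(\xi)^{-1}p_{\rm b}(\xi)^2+EI(\xi)\kappa(\xi)^2\bigr)\,d\xi.$$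
   Context: All Hilbert spaces are real. $L(\mathcal W,\mathcal Y)$ denotes bounded linear operators with the operator norm. Power pairing: for a Hilbert space $\mathcal Z$, $\langle\!\langle (f_1,e_1),(f_2,e_2)\rangle\!\rangle:=\langle f_1,e_2\rangle_{\mathcal Z}+\langle f_2,e_1\rangle_{\mathcal Z}$ on $\mathcal Z\times\mathcal Z$ (flow first, effort second). $\mathcal M^{\perp\!\!\!\perp}$ is the set of $z\in\mathcal Z\times\mathcal Z$ with $\langle\!\langle z,m\rangle\!\rangle=0$ for all $m\in\mathcal M$. A subspace $\mathcal D\subset\mathcal Z\times\mathcal Z$ is a Dirac structure if $\mathcal D=\mathcal D^{\perp\!\!\!\perp}$. Modulated Dirac structure: a family $(\mathcal D_x)_{x\in\mathcal X}$, $\mathcal X$ a topological space, $\mathcal D_x\subset\mathcal Z\times\mathcal Z$, such that (a) every $\mathcal D_x$ is a Dirac structure, and (b) there is a Hilbert space $\mathcal W$ such that for every $x\in\mathcal X$ there are an open neighborhood $U_x$ of $x$ and operators $T_y\in L(\mathcal W,\mathcal Z\times\mathcal Z)$, $y\in U_x$, each a bijection onto $\mathcal D_y$, with $y\mapsto T_y$ operator-norm continuous. Interconnection: for families with $\mathcal D_{i,x_i}\subset(\mathcal Z_i\times\mathcal Z_{\rm c})^2$, $\mathcal D_{1,x_1}\circ_{\mathcal Z_{\rm c}}\mathcal D_{2,x_2}\subset(\mathcal Z_1\times\mathcal Z_2)^2$ is the set of all $((f_1,f_2),(e_1,e_2))$ for which there exist $f_{\rm c},e_{\rm c}\in\mathcal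 Z_{\rm c}$ with $((f_1,f_{\rm c}),(e_1,e_{\rm c}))\in\mathcal D_{1,x_1}$ and $((f_2,f_{\rm c}),(e_2,-e_{\rm c}))\in\mathcal D_{2,x_2}$; $\mathcal D_1\circ_{\mathcal Z_{\rm c}}\mathcal D_2$ is the resulting family over $\mathcal X_1\times\mathcal X_2$. Lagrangian submanifold: a ($C^1$ Hilbert) submanifold $\mathcal L\subset\mathcal Z\times\mathcal Z$ such that for every $z\in\mathcal L$: $(v_1,v_2)\in T_z\mathcal L$ iff $\langle v_1,w_2\rangle-\langle w_1,v_2\rangle=0$ for all $(w_1,w_2)\in T_z\mathcal L$. Products of relations are formed by grouping flows and efforts: $\mathcal M_1\times\mathcal M_2=\{((f_1,f_2),(e_1,e_2)):(f_i,e_i)\in\mathcal M_i\}$. Resistive relation: $\mathcal R\subset\mathcal Z\times\mathcal Z$ with $\langle f,e\rangle\ge0$ for all $(f,e)\in\mathcal R$; a modulated resistive relation is a family of such. Port-Hamiltonian system on an open set $\mathcal X\subset\mathcal Z_{\mathcal L}$: the differential inclusion $((\dot x,f_{\mathcal R},f_{\mathcal P}),(e_{\mathcal L},e_{\mathcal R},e_{\mathcal P}))\in\mathcal D_{x}$, $(x,e_{\mathcal L})\in\mathcal L$, $(f_{\mathcal R},e_{\mathcal R})\in\mathcal R_{x}$ (at each time $t$), where $(\mathcal D_x)_{x\in\mathcal X}$ is a modulated Dirac structure in $(\mathcal Z_{\mathcal L}\times\mathcal Z_{\mathcal R}\times\mathcal Z_{\mathcal P})^2$, $\mathcal L\subset\mathcal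 Z_{\mathcal L}\times\mathcal Z_{\mathcal L}$ a Lagrangian submanifold, and $(\mathcal R_x)_{x\in\mathcal X}$ a modulated resistive relation in $\mathcal Z_{\mathcal R}\times\mathcal Z_{\mathcal R}$. Here $\mathcal Z_{\mathcal R}=\{0\}$. Geometry: $U_{\rm pos}=\{(\boldsymbol q_0,\boldsymbol q_f)\in\mathbb R^2\times\mathbb R^2:\boldsymbol q_0\ne\boldsymbol q_f\}$, $\boldsymbol\zeta_{\rm r}=(\boldsymbol q_0,\boldsymbol q_f)$, $\ell_{\rm r}(\boldsymbol\zeta_{\rm r})=\|\boldsymbol q_f-\boldsymbol q_0\|_2$, $\mathtt t(\boldsymbol\zeta_{\rm r})=(\boldsymbol q_f-\boldsymbol q_0)/\ell_{\rm r}(\boldsymbol\zeta_{\rm r})$, $\mathtt n(\boldsymbol\zeta_{\rm r})=J\mathtt t(\boldsymbol\zeta_{\rm r})$ with $J=\begin{bmatrix}0&-1\\1&0\end{bmatrix}$, and $$Z(\boldsymbol\zeta_{\rm r})=\begin{bmatrix}\mathtt t&\mathtt n&0_{2\times1}\\ \mathtt t&0_{2\times1}&\mathtt n\end{bmatrix}\in\mathbb R^{4\times3},\qquad B_{\rm ext}^{\rm r}(\boldsymbol\zeta_{\rm r})=\begin{bmatrix}\mathtt t^\top&\mathtt t^\top\\ \mathtt n^\top&0_{1\times2}\\0_{1\times2}&\mathtt n^\top\end{bmatrix}\in\mathbb R^{3\times4}.$$ States: $x_{\rm r}=(\boldsymbol\zeta_{\rm r},p_{\mathtt t})\in\mathcal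 X_{\rm r}=U_{\rm pos}\times\mathbb R$, $x_{\rm f}=(\kappa,p_{\rm b})\in\mathcal X_{\rm f}=L^2([0,L];\mathbb R^2)$. Storage relations: $\mathcal L_{\rm r}=\{((\boldsymbol\zeta_{\rm r},p_{\mathtt t}),(0,p_{\mathtt t}/m)):\boldsymbol\zeta_{\rm r}\in U_{\rm pos},p_{\mathtt t}\in\mathbb R\}\subset(\mathbb R^5)^2$ and $\mathcal L_{\rm f}=\{((\kappa,p_{\rm b}),(EI\kappa,\rho^{-1}p_{\rm b})):(\kappa,p_{\rm b})\in L^2([0,L];\mathbb R^2)\}$. Coupling space: $\mathcal Z_{\rm c}=\mathbb R^4$, with coupling flows $f_{\rm c}=(f_{\rm d},f_{\mathtt t},f_{{\mathtt n}0},f_{{\mathtt n}f})$ and efforts $e_{\rm c}=(e_{\rm d},e_{\mathtt t},e_{{\mathtt n}0},e_{{\mathtt n}f})$; superscripts r, f refer to the rigid and flexible subsystem. Rigid Dirac structure: $\mathcal Z_{\rm r}=\mathbb R^5\times\mathbb R^4$ (storage variables, with flows $(f_q^{\rm r},f_p^{\rm r})\in\mathbb R^4\times\mathbb R$ and efforts $(e_q^{\rm r},e_p^{\rm r})\in\mathbb R^4\times\mathbb R$, and external port $f_{\rm ext}^{\rm r},e_{\rm ext}^{\rm r}\in\mathbb R^4$). Set $v_{\rm r}=(e_p^{\rm r},f_{{\mathtt n}0}^{\rm r},f_{{\mathtt n}f}^{\rm r})^\top$ and $$K_{\rm r}(p_{\mathtt t})=\frac{p_{\mathtt t}}{mL}\begin{bmatrix}0&0&1&-1\\0&0&0&0\\-1&0&0&0\\1&0&0&0\end{bmatrix}.$$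 $\mathcal D_{{\rm r},x_{\rm r}}\subset(\mathcal Z_{\rm r}\times\mathcal Z_{\rm c})^2$ is the set of all flow and effort variables for which there is $\overline e_{\rm r}\in\mathbb R^3$ with $$f_q^{\rm r}=Z(\boldsymbol\zeta_{\rm r})v_{\rm r},\quad f_{\rm ext}^{\rm r}=B_{\rm ext}^{\rm r}(\boldsymbol\zeta_{\rm r})^\top v_{\rm r},\quad f_{\mathtt t}^{\rm r}=e_p^{\rm r},$$ $$0=Z(\boldsymbol\zeta_{\rm r})^\top e_q^{\rm r}+(f_p^{\rm r},0,0)^\top+B_{\rm ext}^{\rm r}(\boldsymbol\zeta_{\rm r})e_{\rm ext}^{\rm r}+\overline e_{\rm r},\qquad e_{\rm c}^{\rm r}=\begin{pmatrix}0\\ \overline e_{\rm r}\end{pmatrix}+K_{\rm r}(p_{\mathtt t})f_{\rm c}^{\rm r}.$$ Flexible Dirac structure: $\mathcal Z_{\rm f}=L^2([0,L];\mathbb R^2)\times\mathbb R^2$ (storage flows $(f_\kappa,f_p)$ and efforts $(e_\kappa,e_p)$; moment ports $f_{\rm M}^{\rm f}=(f_{{\rm M}0}^{\rm f},f_{{\rm M}f}^{\rm f})$, $e_{\rm M}^{\rm f}=(e_{{\rm M}0}^{\rm f},e_{{\rm M}f}^{\rm f})$). $\mathcal D_{\rm f}^0\subset(\mathcal Z_{\rm f}\times\mathcal Z_{\rm c})^2$ is the set of all flow and effort variables with $e_\kappa,e_p\in H^2([0,L];\mathbb R)$, $e_{\rm d}^{\rm f},f_{\mathtt t}^{\rm f}\in\mathbb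 R$ free, and (primes denoting $\partial/\partial\xi$) $$f_\kappa=e_p'',\quad f_p=-e_\kappa''-\rho e_{\rm d}^{\rm f},\quad f_{\rm d}^{\rm f}=\int_0^L\rho(\xi)e_p(\xi)\,d\xi,\quad e_{\mathtt t}^{\rm f}=0,$$ $$f_{{\mathtt n}0}^{\rm f}=e_p(0),\ e_{{\mathtt n}0}^{\rm f}=-e_\kappa'(0),\ f_{{\mathtt n}f}^{\rm f}=e_p(L),\ e_{{\mathtt n}f}^{\rm f}=e_\kappa'(L),$$ $$f_{{\rm M}0}^{\rm f}=e_p'(0),\ e_{{\rm M}0}^{\rm f}=e_\kappa(0),\ f_{{\rm M}f}^{\rm f}=e_p'(L),\ e_{{\rm M}f}^{\rm f}=-e_\kappa(L).$$ With $P_{\rm b}(x_{\rm f})=\int_0^Lp_{\rm b}(\xi)\,d\xi$ and, in the ordering $({\rm d},\mathtt t,{\mathtt n}0,{\mathtt n}f)$, $$\widetilde K_{\rm f}(x_{\rm f})=\frac{P_{\rm b}(x_{\rm f})}{L}\begin{bmatrix}0&0&0&0\\0&0&-1&1\\0&1&0&0\\0&-1&0&0\end{bmatrix},$$ let $U^{\rm f}_{x_{\rm f}}$ be the linear map on $(\mathcal Z_{\rm f}\times\mathcal Z_{\rm c})^2$ that leaves all flows and all non-coupling efforts unchanged and replaces $e_{\rm c}^{\rm f}$ by $e_{\rm c}^{\rm f}+\widetilde K_{\rm f}(x_{\rm f})f_{\rm c}^{\rm f}$. Then $\mathcal D_{{\rm f},x_{\rm f}}:=U^{\rm f}_{x_{\rm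 f}}\mathcal D_{\rm f}^0$. *)

(* Defs.v *)
From HB Require Import structures.
From mathcomp Require Import all_boot all_order all_algebra.
From mathcomp Require Import all_classical all_reals all_analysis.
From mathcomp Require Import measurable_realfun ess_sup_inf.
From mathcomp Require Import ring lra.

Set Implicit Arguments.
Unset Strict Implicit.
Unset Printing Implicit Defensive.
Import Order.TTheory GRing.Theory Num.Theory.
Import numFieldNormedType.Exports.
Local Open Scope classical_set_scope.
Local Open Scope ring_scope.

HB.mixin Record isHilbert (R : realType) V & CompleteNormedModule R V := {
  hdot : V -> V -> R ;
  hdotC : forall x y, hdot x y = hdot y x ;
  hdotDl : forall x y z, hdot (x + y) z = hdot x z + hdot y z ;
  hdotZl : forall (a : R) x y, hdot (a *: x) y = a * hdot x y ;
  hdotxx : forall x, hdot x x = `|x| ^+ 2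
}.

#[short(type="hilbertType")]
HB.structure Definition Hilbert (R : realType) :=
  {V of isHilbert R V & CompleteNormedModule R V}.

(** The norm and the topology are those of the inner product [dot];
    completeness is asked for Cauchy sequences only. *)
HB.factory Record Lmodule_isHilbert (R : realType) V & GRing.Lmodule R V := {
  dot : V -> V -> R ;
  dotC : forall x y, dot x y = dot y x ;
  dotDl : forall x y z, dot (x + y) z = dot x z + dot y z ;
  dotZl : forall (a : R) x y, dot (a *: x) y = a * dot x y ;
  dot_ge0 : forall x, 0 <= dot x x ;
  dot_eq0 : forall x, dot x x = 0 -> x = 0 ;
  dot_complete : forall u : nat -> V,
    (forall e, 0 < e -> exists N, forall i j, (N <= i)%N -> (N <= j)%N ->
       dot (u i - u j) (u i - u j) < e) ->
    exists l, forall e, 0 < e -> exists N, forall i, (N <= i)%N ->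
       dot (u i - l) (u i - l) < e
}.

HB.builders Context R V & Lmodule_isHilbert R V.

Let dotDr x y z : dot x (y + z) = dot x y + dot x z.
Proof. by rewrite dotC dotDl !(dotC _ x). Qed.

Let dotZr a x y : dot x (a *: y) = a * dot x y.
Proof. by rewrite dotC dotZl dotC. Qed.

Let dot0l x : dot 0 x = 0.
Proof. by rewrite -(scale0r 0) dotZl mul0r. Qed.

Let norm x := Num.sqrt (dot x x).

Let norm_sqr x : norm x ^+ 2 = dot x x.
Proof. by rewrite /norm sqr_sqrtr// dot_ge0. Qed.

Let norm_ge0 x : 0 <= norm x. Proof. exact: sqrtr_ge0. Qed.

Let dot_le x y : dot x y <= norm x * norm y.
Proof.
have [y0|y0] := eqVneq (dot y y) 0.
  by rewrite (dot_eq0 y0) dotC dot0l mulr_ge0.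
have yp : 0 < dot y y by rewrite lt_neqAle eq_sym y0 dot_ge0.
have := dot_ge0 (dot y y *: x + (- dot x y) *: y).
rewrite !(dotDl, dotDr, dotZl, dotZr) (dotC y x) => h.
have h2 : dot x y ^+ 2 <= (norm x * norm y) ^+ 2.
  rewrite exprMn !norm_sqr -subr_ge0.
  rewrite -(pmulr_rge0 _ yp); move: h; set a := dot x y.
  by rewrite -/a => h; nra.
rewrite (le_trans (ler_norm _))//.
by rewrite -(@ler_pXn2r _ 2)// ?nnegrE ?mulr_ge0// real_normK// num_real.
Qed.

Let ler_normD x y : norm (x + y) <= norm x + norm y.
Proof.
rewrite -(@ler_pXn2r _ 2)// ?nnegrE ?addr_ge0// sqrrD !norm_sqr.
rewrite dotDl !dotDr (dotC y x).
by have := dot_le x y; lra.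
Qed.

Let normrZ (a : R) x : norm (a *: x) = `|a| * norm x.
Proof.
by rewrite /norm dotZl dotZr mulrA -expr2 sqrtrM ?sqr_ge0// sqrtr_sqr.
Qed.

Let normr0_eq0 x : norm x = 0 -> x = 0.
Proof. by move=> x0; apply: dot_eq0; rewrite -norm_sqr x0 expr0n. Qed.

HB.instance Definition _ :=
  Lmodule_isNormed.Build R V ler_normD normrZ normr0_eq0.

Let norm_lt x e : 0 < e -> (norm x < e) = (dot x x < e ^+ 2).
Proof.
by move=> e0; rewrite -norm_sqr ltr_pXn2r// nnegrE ?norm_ge0// ltW.
Qed.

Let complete (F : set_system V) : ProperFilter F -> cauchy F -> cvg F.
Proof.
move=> FF /cauchyP Fc.
have n0 (n : nat) : (0 : R) < n.+1%:R^-1 by rewrite invr_gt0 ltr0n.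
pose u n := projT1 (cid (Fc _ (n0 n))).
have Fu n : F (ball (u n) n.+1%:R^-1) by rewrite /u; case: cid.
have small (e : R) : 0 < e -> exists N, forall i, (N <= i)%N -> i.+1%:R^-1 < e.
  move=> e0; exists (Num.truncn e^-1) => i Ni.
  rewrite invf_plt ?posrE// ?ltr0n//.
  by rewrite (lt_le_trans (truncnS_gt _))// ler_nat.
have ucau e : 0 < e -> exists N, forall i j, (N <= i)%N -> (N <= j)%N ->
    dot (u i - u j) (u i - u j) < e.
  move=> e0; have s0 : 0 < Num.sqrt e by rewrite sqrtr_gt0.
  have [N Nh] := small (Num.sqrt e / 2) (divr_gt0 s0 (ltr0Sn _ _)).
  exists N => i j Ni Nj.
  rewrite -(sqr_sqrtr (ltW e0)) -norm_lt//.
  have /filter_ex[z [/= zi zj]] : F (ball (u i) i.+1%:R^-1 `&` ball (u j) j.+1%:R^-1).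
    exact: filterI.
  move: zi zj; rewrite -!ball_normE /ball_/= => zi zj.
  have -> : norm (u i - u j) = `|u i - u j| by [].
  rewrite (le_lt_trans (ler_distD z _ _))//.
  rewrite (splitr (Num.sqrt e)) ltrD//.
    by rewrite (lt_trans zi)// Nh.
  by rewrite distrC (lt_trans zj)// Nh.
have [l hl] := dot_complete ucau.
apply/cvg_ex; exists l; apply/cvgrPdist_lt => e e0.
have e20 : 0 < e / 2 by rewrite divr_gt0.
have [N1 h1] := small _ e20.
have [N2 h2] := hl _ (exprn_gt0 2 e20).
have {}h1 := h1 (maxn N1 N2) (leq_maxl _ _).
have {}h2 := h2 (maxn N1 N2) (leq_maxr _ _).
move: h2; rewrite -norm_lt// => h2.
apply: filterS (Fu (maxn N1 N2)) => z; rewrite -ball_normE /ball_/= => hz.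
rewrite (le_lt_trans (ler_distD (u (maxn N1 N2)) _ _))//.
rewrite (splitr e) ltrD//; last exact: lt_trans hz h1.
by rewrite distrC.
Qed.

HB.instance Definition _ := Uniform_isComplete.Build V complete.

Let dotxx (x : V) : dot x x = `|x| ^+ 2.
Proof. by rewrite -norm_sqr. Qed.

HB.instance Definition _ := isHilbert.Build R V dotC dotDl dotZl dotxx.

HB.end.

Section real_line.
Context {R : realType}.
Let dot (x y : R^o) : R := x * y.
Let dotC x y : dot x y = dot y x. Proof. exact: mulrC. Qed.
Let dotDl x y z : dot (x + y) z = dot x z + dot y z. Proof. exact: mulrDl. Qed.
Let dotZl (a : R) x y : dot (a *: x) y = a * dot x y.
Proof. by rewrite /dot /GRing.scale/= mulrA. Qed.
Let dotxx x : dot x x = `|x| ^+ 2. Proof. by rewrite real_normK ?num_real. Qed.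
HB.instance Definition _ := isHilbert.Build R R^o dotC dotDl dotZl dotxx.
End real_line.

(** The product of Hilbert spaces is [prod] with the componentwise inner
    product.  [prod] itself carries the max norm in MathComp-Analysis, hence
    the alias. *)
Definition hprod (U V : Type) : Type := (U * V)%type.

Reserved Notation "U \oplus V" (at level 50, left associativity).
Notation "U \oplus V" := (hprod U V) : type_scope.

Section hprod.
Context {R : realType} {U V : hilbertType R}.

HB.instance Definition _ := GRing.Lmodule.copy (U \oplus V) (U * V)%type.

Let dot (x y : U \oplus V) : R := hdot x.1 y.1 + hdot x.2 y.2.
Let dotC x y : dot x y = dot y x.
Proof. by congr (_ + _); exact: hdotC. Qed.
Let dotDl x y z : dot (x + y) z = dot x z + dot y z.
Proof. by rewrite /dot !hdotDl addrACA. Qed.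
Let dotZl (a : R) x y : dot (a *: x) y = a * dot x y.
Proof. by rewrite /dot !hdotZl mulrDr. Qed.
Let dot_ge0 x : 0 <= dot x x.
Proof. by rewrite /dot !hdotxx addr_ge0 ?sqr_ge0. Qed.
Let dot_eq0 x : dot x x = 0 -> x = 0.
Proof.
rewrite /dot !hdotxx => /eqP; rewrite paddr_eq0 ?sqr_ge0// !sqrf_eq0 !normr_eq0.
by case: x => a b /= /andP[/eqP -> /eqP ->].
Qed.

Let cvg_of_cauchy (W : hilbertType R) (u : nat -> W) :
  (forall e, 0 < e -> exists N, forall i j, (N <= i)%N -> (N <= j)%N ->
     hdot (u i - u j) (u i - u j) < e) ->
  exists l, forall e, 0 < e -> exists N, forall i, (N <= i)%N ->
     hdot (u i - l) (u i - l) < e.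
Proof.
move=> uc.
have /cvg_ex[l ul] : cvgn u.
  apply: cauchy_cvg; apply/cauchyP => e e0.
  have [N hN] := uc _ (exprn_gt0 2 e0).
  exists (u N); exists N => // i /= Ni.
  rewrite -ball_normE /ball_/=.
  rewrite -(@ltr_pXn2r _ 2)// ?nnegrE ?(ltW e0)//.
  by rewrite -hdotxx hN/=.
exists l => e e0.
have s0 : 0 < Num.sqrt e by rewrite sqrtr_gt0.
move/cvgrPdist_lt : ul => /(_ _ s0)[N _ hN].
exists N => i Ni; rewrite hdotxx -(sqr_sqrtr (ltW e0)).
by rewrite ltr_pXn2r// ?nnegrE ?(ltW s0)// distrC hN.
Qed.

Let dot_complete (u : nat -> U \oplus V) :
  (forall e, 0 < e -> exists N, forall i j, (N <= i)%N -> (N <= j)%N ->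
     dot (u i - u j) (u i - u j) < e) ->
  exists l, forall e, 0 < e -> exists N, forall i, (N <= i)%N ->
     dot (u i - l) (u i - l) < e.
Proof.
move=> uc.
have [|l1 h1] := @cvg_of_cauchy U (fun n => (u n).1).
  move=> e /uc[N hN]; exists N => i j Ni Nj.
  apply: le_lt_trans (hN _ _ Ni Nj).
  by rewrite /dot lerDl hdotxx sqr_ge0.
have [|l2 h2] := @cvg_of_cauchy V (fun n => (u n).2).
  move=> e /uc[N hN]; exists N => i j Ni Nj.
  apply: le_lt_trans (hN _ _ Ni Nj).
  by rewrite /dot lerDr hdotxx sqr_ge0.
exists (l1, l2) => e e0.
have e20 : 0 < e / 2 by rewrite divr_gt0.
have [N1 hN1] := h1 _ e20; have [N2 hN2] := h2 _ e20.
exists (maxn N1 N2) => i; rewrite geq_max => /andP[i1 i2].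
by rewrite (splitr e) ltrD//; [exact: hN1|exact: hN2].
Qed.

HB.instance Definition _ := Lmodule_isHilbert.Build R (U \oplus V)
  dotC dotDl dotZl dot_ge0 dot_eq0 dot_complete.

End hprod.

(** [euc R n] is the Euclidean space of column vectors; the alias avoids the
    max norm that ['cV[R]_n] carries in MathComp-Analysis. *)
Definition euc (R : Type) (n : nat) : Type := 'cV[R]_n.

Section euc.
Context {R : realType} {n : nat}.

HB.instance Definition _ := GRing.Lmodule.copy (euc R n) 'cV[R]_n.

Let dot (x y : euc R n) : R := \sum_i x i 0 * y i 0.
Let dotC x y : dot x y = dot y x.
Proof. by apply: eq_bigr => i _; rewrite mulrC. Qed.
Let dotDl x y z : dot (x + y) z = dot x z + dot y z.
Proof. by rewrite -big_split; apply: eq_bigr => i _; rewrite mxE mulrDl. Qed.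
Let dotZl (a : R) x y : dot (a *: x) y = a * dot x y.
Proof. by rewrite mulr_sumr; apply: eq_bigr => i _; rewrite mxE mulrA. Qed.
Let dot_ge0 x : 0 <= dot x x.
Proof. by apply: sumr_ge0 => i _; rewrite -expr2 sqr_ge0. Qed.
Let dot_coord (x : euc R n) i : x i 0 ^+ 2 <= dot x x.
Proof.
rewrite /dot (bigD1 i)//= -expr2 lerDl; apply: sumr_ge0 => j _.
by rewrite -expr2 sqr_ge0.
Qed.
Let dot_eq0 x : dot x x = 0 -> x = 0.
Proof.
move=> x0; apply/matrixP => i j; rewrite (ord1 j) !mxE; apply/eqP.
by rewrite -sqrf_eq0 eq_le sqr_ge0 andbT -x0 dot_coord.
Qed.

Let dot_complete (u : nat -> euc R n) :
  (forall e, 0 < e -> exists N, forall i j, (N <= i)%N -> (N <= j)%N ->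
     dot (u i - u j) (u i - u j) < e) ->
  exists l, forall e, 0 < e -> exists N, forall i, (N <= i)%N ->
     dot (u i - l) (u i - l) < e.
Proof.
move=> uc.
have cv k : cvgn (fun i => u i k 0).
  apply: cauchy_cvg; apply/cauchyP => e e0.
  have [N hN] := uc _ (exprn_gt0 2 e0).
  exists (u N k 0); exists N => // i /= Ni.
  rewrite -ball_normE /ball_/=.
  rewrite -(@ltr_pXn2r _ 2)// ?nnegrE ?(ltW e0)// real_normK ?num_real//.
  apply: le_lt_trans (hN _ _ (leqnn N) Ni).
  have := dot_coord (u N - u i) k; by rewrite !mxE.
pose l : euc R n := \col_k limn (fun i => u i k 0).
exists l => e e0.
have d0 : 0 < e / n.+1%:R by rewrite divr_gt0// ltr0n.
have : \forall i \near \oo, forall k, (u i k 0 - l k 0) ^+ 2 < e / n.+1%:R.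
  apply: filter_forall => k.
  have s0 : 0 < Num.sqrt (e / n.+1%:R) by rewrite sqrtr_gt0.
  have /cvgrPdist_lt/(_ _ s0) := cv k.
  apply: filterS => i; rewrite -(@ltr_pXn2r _ 2)// ?nnegrE ?(ltW s0)//.
  by rewrite real_normK ?num_real// sqr_sqrtr ?(ltW d0)// mxE -sqrrN opprB.
move=> [N _ hN]; exists N => i /hN {}hN.
apply: (@le_lt_trans _ _ (\sum_(k < n) (e / n.+1%:R))).
  by apply: ler_sum => k _; have := ltW (hN k); rewrite !mxE -expr2.
rewrite sumr_const card_ord -[_ *+ n]mulr_natr -mulrA gtr_pMr//.
by rewrite mulrC ltr_pdivrMr ?ltr0n// mul1r ltr_nat.
Qed.

HB.instance Definition _ := Lmodule_isHilbert.Build R (euc R n)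
  dotC dotDl dotZl dot_ge0 dot_eq0 dot_complete.

End euc.

(** [L2 mu] is the space of square-integrable functions modulo equality
    almost everywhere. *)
Section L2_quotient.
Context {d} {T : measurableType d} {R : realType}.
Variable mu : {measure set T -> \bar R}.

Definition L2_pre : Type := LfunType mu (lee1n 2).
HB.instance Definition _ := GRing.Lmodule.on L2_pre.
Definition L2_pre_fun (f : L2_pre) : T -> R := f : LfunType mu (lee1n 2).

Definition L2_equiv (f g : L2_pre) : bool :=
  `[< L2_pre_fun f = L2_pre_fun g %[ae mu] >].

Let L2_equiv_refl : reflexive L2_equiv.
Proof. by move=> f; apply/asboolP; exact: ae_eq_refl. Qed.

Let L2_equiv_sym : symmetric L2_equiv.
Proof. by move=> f g; apply/asboolP/asboolP => h; exact: ae_eq_sym. Qed.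

Let L2_equiv_trans : transitive L2_equiv.
Proof.
by move=> f g h /asboolP gf /asboolP fh; apply/asboolP; exact: ae_eq_trans fh.
Qed.

Canonical L2_equiv_canonical :=
  EquivRel L2_equiv L2_equiv_refl L2_equiv_sym L2_equiv_trans.

Local Open Scope quotient_scope.

Definition L2 : Type := {eq_quot L2_equiv}.
HB.instance Definition _ := Choice.on L2.
HB.instance Definition _ := EqQuotient.on L2.

Definition L2_fun (u : L2) : T -> R := L2_pre_fun (repr u).
Coercion L2_fun : L2 >-> Funclass.

(** The class of [f], or [0] when [f] is not square-integrable. *)
Definition L2_class (f : T -> R) : L2 :=
  match pselect (f \in Lfun mu 2%:E) with
  | left fP => \pi_L2 (Lfun_Sub (lee1n 2) fP)
  | right _ => \pi_L2 0
  end.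

Lemma L2_Lfun (u : L2) : L2_fun u \in Lfun mu 2%:E.
Proof. exact: (LfunP (repr u : LfunType mu (lee1n 2))). Qed.

Lemma L2_eqP (u v : L2) : u = v <-> L2_fun u = L2_fun v %[ae mu].
Proof.
split=> [->|uv]; first exact: ae_eq_refl.
by rewrite -[u]reprK -[v]reprK; apply/eqmodP/asboolP.
Qed.

Lemma L2_classE (f : T -> R) : f \in Lfun mu 2%:E ->
  L2_fun (L2_class f) = f %[ae mu].
Proof.
move=> fP; rewrite /L2_class; case: pselect => [fP'|//].
pose g : L2_pre := Lfun_Sub (lee1n 2) fP'.
have /eqmodP/asboolP : \pi_L2 (repr (\pi_L2 g)) = \pi_L2 g by rewrite reprK.
apply: ae_eq_trans.
exact: ae_eq_refl.
Qed.

End L2_quotient.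

Section L2_lmodule.
Context {d} {T : measurableType d} {R : realType}.
Variable mu : {measure set T -> \bar R}.
Implicit Types (u v w : L2 mu) (a b : R).

Let LfunD (f g : T -> R) : f \in Lfun mu 2%:E -> g \in Lfun mu 2%:E ->
  (fun x => f x + g x) \in Lfun mu 2%:E.
Proof. by have [_ h] := Lfun_addr_closed mu (lee1n 2); exact: h. Qed.

Let LfunZ a (f : T -> R) : f \in Lfun mu 2%:E ->
  (fun x => a * f x) \in Lfun mu 2%:E.
Proof.
move=> fP; rewrite (_ : (fun _ => _) = a \o* f).
  by apply: Lfun_scale fP; rewrite ler1n.
by apply/funext => x /=; rewrite mulrC.
Qed.

Let Lfun0 : (fun=> 0) \in Lfun mu 2%:E.
Proof. by have [h _] := Lfun_addr_closed mu (lee1n 2); exact: h. Qed.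

Definition L2_zero : L2 mu := L2_class mu (fun=> 0).
Definition L2_add u v : L2 mu := L2_class mu (fun x => u x + v x).
Definition L2_opp u : L2 mu := L2_class mu (fun x => - u x).
Definition L2_scale a u : L2 mu := L2_class mu (fun x => a * u x).

Let zeroE : {ae mu, forall x, L2_zero x = 0}.
Proof. by apply: filterS (L2_classE Lfun0) => x /(_ I). Qed.
Let addE u v : {ae mu, forall x, L2_add u v x = u x + v x}.
Proof.
by apply: filterS (L2_classE (LfunD (L2_Lfun u) (L2_Lfun v))) => x /(_ I).
Qed.
Let scaleE a u : {ae mu, forall x, L2_scale a u x = a * u x}.
Proof. by apply: filterS (L2_classE (LfunZ a (L2_Lfun u))) => x /(_ I). Qed.
Let oppE u : {ae mu, forall x, L2_opp u x = - u x}.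
Proof.
have -> : L2_opp u = L2_scale (-1) u.
  by congr L2_class; apply/funext => x; rewrite mulN1r.
by apply: filterS (scaleE (-1) u) => x ->; rewrite mulN1r.
Qed.

Let ext u v : {ae mu, forall x, u x = v x} -> u = v.
Proof. by move=> h; apply/L2_eqP; apply: filterS h => x. Qed.

Let addA : associative L2_add.
Proof.
move=> u v w; apply: ext.
near=> x.
have -> : L2_add u (L2_add v w) x = u x + (L2_add v w) x by near: x; exact: addE.
have -> : L2_add v w x = v x + w x by near: x; exact: addE.
have -> : L2_add (L2_add u v) w x = L2_add u v x + w x by near: x; exact: addE.
have -> : L2_add u v x = u x + v x by near: x; exact: addE.
exact: addrA.
Unshelve. all: by end_near. Qed.

Let addC : commutative L2_add.
Proof. by move=> u v; congr L2_class; apply/funext => x; exact: addrC. Qed.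

Let add0 : left_id L2_zero L2_add.
Proof.
move=> u; apply: ext; near=> x.
have -> : L2_add L2_zero u x = L2_zero x + u x by near: x; exact: addE.
have -> : L2_zero x = 0 by near: x; exact: zeroE.
exact: add0r.
Unshelve. all: by end_near. Qed.

Let addN : left_inverse L2_zero L2_opp L2_add.
Proof.
move=> u; apply: ext; near=> x.
have -> : L2_add (L2_opp u) u x = L2_opp u x + u x by near: x; exact: addE.
have -> : L2_opp u x = - u x by near: x; exact: oppE.
have -> : L2_zero x = 0 by near: x; exact: zeroE.
exact: addNr.
Unshelve. all: by end_near. Qed.

HB.instance Definition _ := GRing.isZmodule.Build (L2 mu) addA addC add0 addN.

Let scaleA a b u : L2_scale a (L2_scale b u) = L2_scale (a * b) u.
Proof.
apply: ext; near=> x.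
have -> : L2_scale a (L2_scale b u) x = a * L2_scale b u x.
  by near: x; exact: scaleE.
have -> : L2_scale b u x = b * u x by near: x; exact: scaleE.
have -> : L2_scale (a * b) u x = a * b * u x by near: x; exact: scaleE.
exact: mulrA.
Unshelve. all: by end_near. Qed.

Let scale1 : left_id 1 L2_scale.
Proof.
move=> u; apply: ext; near=> x.
have -> : L2_scale 1 u x = 1 * u x by near: x; exact: scaleE.
exact: mul1r.
Unshelve. all: by end_near. Qed.

Let scaleDr : right_distributive L2_scale +%R.
Proof.
move=> a u v; apply: ext; near=> x.
have -> : L2_scale a (u + v) x = a * L2_fun (u + v) x by near: x; exact: scaleE.
have -> : L2_fun (u + v) x = u x + v x by near: x; exact: addE.
have -> : L2_fun (L2_scale a u + L2_scale a v) x = L2_scale a u x + L2_scale a v x.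
  by near: x; exact: addE.
have -> : L2_scale a u x = a * u x by near: x; exact: scaleE.
have -> : L2_scale a v x = a * v x by near: x; exact: scaleE.
exact: mulrDr.
Unshelve. all: by end_near. Qed.

Let scaleDl u : {morph L2_scale^~ u : a b / a + b}.
Proof.
move=> a b; apply: ext; near=> x.
have -> : L2_scale (a + b) u x = (a + b) * u x by near: x; exact: scaleE.
have -> : L2_fun (L2_scale a u + L2_scale b u) x = L2_scale a u x + L2_scale b u x.
  by near: x; exact: addE.
have -> : L2_scale a u x = a * u x by near: x; exact: scaleE.
have -> : L2_scale b u x = b * u x by near: x; exact: scaleE.
exact: mulrDl.
Unshelve. all: by end_near. Qed.

HB.instance Definition _ := GRing.Zmodule_isLmodule.Build R (L2 mu)
  scaleA scale1 scaleDr scaleDl.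

Lemma L2_0E : {ae mu, forall x, L2_fun (0 : L2 mu) x = 0}.
Proof. exact: zeroE. Qed.
Lemma L2_addE u v : {ae mu, forall x, L2_fun (u + v) x = u x + v x}.
Proof. exact: addE. Qed.
Lemma L2_scaleE a u : {ae mu, forall x, L2_fun (a *: u) x = a * u x}.
Proof. exact: scaleE. Qed.
Lemma L2_oppE u : {ae mu, forall x, L2_fun (- u) x = - u x}.
Proof. exact: oppE. Qed.
Lemma L2_subE u v : {ae mu, forall x, L2_fun (u - v) x = u x - v x}.
Proof.
near=> x.
have -> : L2_fun (u - v) x = u x + L2_fun (- v) x by near: x; exact: addE.
by congr (_ + _); near: x; exact: oppE.
Unshelve. all: by end_near. Qed.
Lemma L2_ext u v : {ae mu, forall x, u x = v x} -> u = v.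
Proof. exact: ext. Qed.

Definition L2_dot u v : R := (\int[mu]_x (u x * v x))%R.

Lemma L2_mul_integrable u v : mu.-integrable setT (fun x => (u x * v x)%:E).
Proof.
have := Lfun2_mul_Lfun1 (L2_Lfun u) (L2_Lfun v).
by move/Lfun1_integrable.
Qed.

Lemma L2_mfun u : measurable_fun setT u.
Proof. by have /andP[/[!inE]] := L2_Lfun u. Qed.

Let Rint_ae (f g : T -> R) : measurable_fun setT f -> measurable_fun setT g ->
  {ae mu, forall x, f x = g x} -> (\int[mu]_x f x)%R = (\int[mu]_x g x)%R.
Proof.
move=> mf mg fg; congr fine; apply: ae_eq_integral => //.
- by apply/measurable_EFinP.
- by apply/measurable_EFinP.
- by apply: filterS fg => x ->.
Qed.

Lemma L2_dotC u v : L2_dot u v = L2_dot v u.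
Proof. by congr Rintegral; apply/funext => x; rewrite mulrC. Qed.

Lemma L2_dotDl u v w : L2_dot (u + v) w = L2_dot u w + L2_dot v w.
Proof.
rewrite /L2_dot -RintegralD//; [|exact: L2_mul_integrable..].
apply: Rint_ae.
- by apply: measurable_funM; exact: L2_mfun.
- by apply: measurable_funD; apply: measurable_funM; exact: L2_mfun.
- by apply: filterS (L2_addE u v) => x ->; rewrite mulrDl.
Qed.

Lemma L2_dotZl a u v : L2_dot (a *: u) v = a * L2_dot u v.
Proof.
rewrite /L2_dot -RintegralZl//; [|exact: L2_mul_integrable].
apply: Rint_ae.
- by apply: measurable_funM; exact: L2_mfun.
- by apply: measurable_funM => //; apply: measurable_funM; exact: L2_mfun.
- by apply: filterS (L2_scaleE a u) => x ->; rewrite mulrA.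
Qed.

Lemma L2_dot_ge0 u : 0 <= L2_dot u u.
Proof. by apply: Rintegral_ge0 => x _; rewrite -expr2 sqr_ge0. Qed.

Lemma L2_dotE u : (L2_dot u u)%:E = (\int[mu]_x ((u x) ^+ 2)%:E)%E.
Proof.
rewrite /L2_dot /Rintegral fineK//.
exact: integrable_fin_num (L2_mul_integrable u u).
Qed.

Lemma L2_dot_eq0 u : L2_dot u u = 0 -> u = 0.
Proof.
move=> u0; apply: L2_ext.
have mu2 : measurable_fun setT (fun x => ((u x) ^+ 2)%:E).
  by apply/measurable_EFinP; apply: measurable_funX; exact: L2_mfun.
have /(ae_eq_integral_abs mu measurableT mu2) : (\int[mu]_x `|((u x) ^+ 2)%:E| = 0)%E.
  under eq_integral do rewrite gee0_abs ?lee_fin ?sqr_ge0//.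
  by rewrite -L2_dotE u0.
move=> h; near=> x.
have -> : L2_fun (0 : L2 mu) x = 0 by near: x; exact: L2_0E.
apply/eqP; rewrite -sqrf_eq0 -eqe; apply/eqP.
by near: x; apply: filterS h => x /(_ I).
Unshelve. all: by end_near. Qed.

End L2_lmodule.

Section L2_complete.
Context {d} {T : measurableType d} {R : realType}.
Variable mu : {measure set T -> \bar R}.
Implicit Types (u v w : L2 mu).

Lemma Lfun2_of_sqr (f : T -> R) : measurable_fun setT f ->
  (\int[mu]_x ((f x) ^+ 2)%:E < +oo)%E -> f \in Lfun mu 2%:E.
Proof.
move=> mf fi; apply/andP; split; rewrite inE//= /finite_norm unlock.
rewrite poweR_lty// (le_lt_trans _ fi)//.
under eq_integral => x _.
  rewrite /= powR_mulrn// real_normK ?num_real//. over.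
exact: lexx.
Qed.

Lemma L2_dot_class (f : T -> R) w : f \in Lfun mu 2%:E ->
  (L2_dot (w - L2_class mu f) (w - L2_class mu f))%:E
  = (\int[mu]_x ((f x - w x) ^+ 2)%:E)%E.
Proof.
move=> fP; rewrite L2_dotE.
have /andP[/[!inE]/= mf _] := fP.
apply: ae_eq_integral => //.
- by apply/measurable_EFinP; apply: measurable_funX; exact: L2_mfun.
- apply/measurable_EFinP; apply: measurable_funX.
  by apply: measurable_funB => //; exact: L2_mfun.
near=> x => _.
have -> : L2_fun (w - L2_class mu f) x = w x - L2_class mu f x.
  by near: x; exact: L2_subE.
have -> : L2_class mu f x = f x.
  by near: x; apply: filterS (L2_classE fP) => x /(_ I).
by rewrite -sqrrN opprB.
Unshelve. all: by end_near. Qed.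

Let cvg_geo (a : R^nat) (C : R) :
  (forall k, `|a k.+1 - a k| <= C * (1 / 2) ^+ k) -> cvgn a.
Proof.
move=> h.
have ct : cvgn (series (telescope a)).
  apply: normed_cvg.
  apply: (@series_le_cvg _ _ (geometric C (1 / 2))) => [k|k|k|].
  - exact: normr_ge0.
  - exact: le_trans (h k).
  - exact: h.
  - by apply: is_cvg_geometric_series; rewrite ger0_norm ?divr_ge0// ltr_pdivrMr// mul1r ltr1n.
have -> : a = (fun n => a 0%N + series (telescope a) n).
  by apply/funext => n; rewrite -eq_sum_telescope.
by apply: is_cvgD => //; exact: is_cvg_cst.
Qed.

Lemma L2_complete (u : nat -> L2 mu) :
  (forall e, 0 < e -> exists N, forall i j, (N <= i)%N -> (N <= j)%N ->
     L2_dot (u i - u j) (u i - u j) < e) ->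
  exists l, forall e, 0 < e -> exists N, forall i, (N <= i)%N ->
     L2_dot (u i - l) (u i - l) < e.
Proof.
move=> uc.
have q0 k : 0 < (1 / 16 : R) ^+ k by rewrite exprn_gt0// divr_gt0.
pose N k := projT1 (cid (uc _ (q0 k))).
have hN k i j : (N k <= i)%N -> (N k <= j)%N ->
    L2_dot (u i - u j) (u i - u j) < (1 / 16) ^+ k.
  by rewrite /N; case: cid => /= M; apply.
pose n k := (\sum_(i < k.+1) N i)%N.
have nN k : (N k <= n k)%N by rewrite /n big_ord_recr leq_addl.
have nS k : (n k <= n k.+1)%N by rewrite /n [leqRHS]big_ord_recr leq_addr.
have nle j k : (k <= j)%N -> (n k <= n j)%N.
  by apply: (homo_leq leqnn leq_trans nS).
pose v k := u (n k).
pose F k (x : T) : \bar R := (4 ^+ k * (v k.+1 x - v k x) ^+ 2)%:E.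
have F0 k x : (0 <= F k x)%E by rewrite lee_fin mulr_ge0 ?sqr_ge0// exprn_ge0.
have mF k : measurable_fun setT (F k).
  apply/measurable_EFinP; apply: measurable_funM => //.
  by apply: measurable_funX; apply: measurable_funB; exact: L2_mfun.
have subsq (w1 w2 : L2 mu) :
    (\int[mu]_x ((w1 x - w2 x) ^+ 2)%:E = (L2_dot (w1 - w2) (w1 - w2))%:E)%E.
  rewrite L2_dotE; apply: ae_eq_integral => //.
  - by apply/measurable_EFinP; apply: measurable_funX;
      apply: measurable_funB; exact: L2_mfun.
  - by apply/measurable_EFinP; apply: measurable_funX; exact: L2_mfun.
  - by apply: filterS (L2_subE w1 w2) => x ->.
have intF k : (\int[mu]_x F k x <= ((1 / 4) ^+ k)%:E)%E.
  rewrite /F; under eq_integral do rewrite EFinM.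
  have -> : (\int[mu]_x ((4 ^+ k)%:E * ((v k.+1 x - v k x) ^+ 2)%:E)
      = (4 ^+ k)%:E * \int[mu]_x ((v k.+1 x - v k x) ^+ 2)%:E)%E.
    apply: ge0_integralZl => //.
      by apply/measurable_EFinP; apply: measurable_funX;
        apply: measurable_funB; exact: L2_mfun.
    by move=> x _; rewrite lee_fin sqr_ge0.
  rewrite subsq -EFinM lee_fin.
  rewrite (_ : (1 / 4) ^+ k = 4 ^+ k * (1 / 16) ^+ k).
    by rewrite ler_wpM2l ?exprn_ge0// ltW// hN// (leq_trans (nN k)).
  by rewrite -exprMn; congr (_ ^+ _); field.
pose G x := (\sum_(k <oo) F k x)%E.
have mG : measurable_fun setT G by exact: ge0_emeasurable_sum.
have G0 x : (0 <= G x)%E by exact: nneseries_ge0.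
have intG : mu.-integrable setT G.
  apply/integrableP; split => //.
  under eq_integral do rewrite gee0_abs//.
  rewrite /G integral_nneseries//.
  apply: (@le_lt_trans _ _ (\sum_(k <oo) ((1 / 4 : R) ^+ k)%:E)%E).
    apply: lee_nneseries => [k _ _|k _]; [exact: integral_ge0|exact: intF].
  rewrite (_ : (\sum_(k <oo) _)%E = (limn (series (geometric 1 (1 / 4 : R))))%:E).
    exact: ltry.
  rewrite -EFin_lim.
    congr (limn _); apply/funext => j /=; rewrite /series /= sumEFin.
    by congr (_%:E); apply: eq_bigr => i _; exact: esym (mul1r _).
  apply: is_cvg_geometric_series.
  by rewrite ger0_norm ?divr_ge0// ltr_pdivrMr// mul1r ltr1n.
have Gae : {ae mu, forall x, (G x < +oo)%E}.
  have := integrable_ae measurableT intG; apply: filterS => x /(_ I).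
  by rewrite ge0_fin_numE.
have dG x k : (G x < +oo)%E ->
    `|v k.+1 x - v k x| <= Num.sqrt (fine (G x)) * (1 / 2) ^+ k.
  move=> Gx.
  have FG : (F k x <= G x)%E.
    rewrite /G (@nneseriesD1 _ _ k xpredT)//.
    by rewrite leeDl// nneseries_ge0.
  have gf : fine (G x) = fine (G x) by [].
  have {}FG : 4 ^+ k * (v k.+1 x - v k x) ^+ 2 <= fine (G x).
    by rewrite -lee_fin fineK// ge0_fin_numE.
  have g0 : 0 <= fine (G x) by exact: fine_ge0.
  rewrite -(@ler_pXn2r _ 2)// ?nnegrE ?mulr_ge0 ?sqrtr_ge0 ?exprn_ge0// ?divr_ge0//.
  rewrite real_normK ?num_real// exprMn sqr_sqrtr// -exprM mulnC exprM.
  rewrite -(@ler_pM2l _ (4 ^+ k)) ?exprn_gt0//.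
  rewrite [leRHS]mulrCA -exprMn (_ : 4 * (1 / 2) ^+ 2 = 1 :> R); last by field.
  by rewrite expr1n mulr1.
pose A := [set x | (G x < +oo)%E].
have mA : measurable A.
  rewrite (_ : A = setT `&` G @^-1` `]-oo, +oo%E[%classic).
    by apply: mG => //; exact: emeasurable_itv.
  by apply/seteqP; split => x /=; rewrite in_itv/=; [split|case].
pose h k x : R := v k x * \1_A x.
have hcvg x : cvgn (h ^~ x).
  apply: (@cvg_geo _ (Num.sqrt (fine (G x)))) => k; rewrite /h.
  rewrite -mulrBl indicE; case: (boolP (x \in A)) => xA.
    by rewrite mulr1 dG//; move: xA; rewrite inE.
  rewrite mulr0 normr0 mulr_ge0 ?sqrtr_ge0// exprn_ge0//.
have mh k : measurable_fun setT (h k).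
  by apply: measurable_funM; [exact: L2_mfun|exact: measurable_indic].
pose f x := limn (h ^~ x).
have mf : measurable_fun setT f.
  by apply: (measurable_fun_cvg mh) => x _; exact: hcvg.
have fatou_f (w : L2 mu) k c :
    (forall j, (k <= j)%N -> L2_dot (v j - w) (v j - w) <= c) ->
    (\int[mu]_x ((f x - w x) ^+ 2)%:E <= c%:E)%E.
  move=> hc.
  pose g j x := ((h (j + k)%N x - w x) ^+ 2)%:E.
  have mg j : measurable_fun setT (g j).
    apply/measurable_EFinP; apply: measurable_funX.
    by apply: measurable_funB; [exact: mh|exact: L2_mfun].
  have gE j : (\int[mu]_x g j x <= c%:E)%E.
    have := hc (j + k)%N (leq_addl _ _); rewrite -lee_fin; apply: le_trans.
    rewrite -subsq le_eqVlt; apply/orP; left; apply/eqP.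
    apply: ae_eq_integral => //.
      by apply/measurable_EFinP; apply: measurable_funX;
        apply: measurable_funB; exact: L2_mfun.
    by apply: filterS Gae => x Gx _; rewrite /g /h indicE mem_set// mulr1.
  have glim x : limn_einf (g ^~ x) = ((f x - w x) ^+ 2)%:E.
    have gc : g ^~ x @ \oo --> ((f x - w x) ^+ 2)%:E.
      apply: cvg_EFin; first by near=> j.
      have hx : (fun j => h (j + k)%N x) @ \oo --> f x.
        have := hcvg x; rewrite -/(cvgn _) => /cvg_ex[l hl].
        have -> : f x = l by apply/cvg_lim.
        by move: hl; rewrite -(cvg_shiftn k).
      rewrite /comp /=.
      under eq_fun do rewrite expr2.
      rewrite expr2.
      by apply: cvgM; apply: cvgB => //; exact: cvg_cst.
    rewrite is_cvg_limn_einfE; first exact/cvg_lim.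
    by apply/cvg_ex; eexists; exact: gc.
  under eq_integral do rewrite -glim.
  apply: le_trans (fatou mu measurableT mg _) _.
    by move=> j x _; rewrite lee_fin sqr_ge0.
  rewrite limn_einf_lim; apply: lime_le; first exact: is_cvg_einfs.
  near=> j; apply: le_trans (gE j).
  by apply: ereal_inf_lbound; exists j => //=.
have fP : f \in Lfun mu 2%:E.
  pose w := v 0%N.
  have h1 : (\int[mu]_x ((f x - w x) ^+ 2)%:E <= 1%:E)%E.
    apply: (fatou_f w 0%N) => j _; apply: ltW.
    by rewrite -(expr0 (1 / 16)) hN// (leq_trans (nN 0%N))// nle.
  have fwP : (fun x => f x - w x) \in Lfun mu 2%:E.
    apply: Lfun2_of_sqr; first by apply: measurable_funB => //; exact: L2_mfun.
    exact: le_lt_trans h1 (ltry _).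
  have [_ lD] := Lfun_addr_closed mu (lee1n 2).
  rewrite (_ : f = (fun x => f x - w x) + L2_fun w).
    exact: lD fwP (L2_Lfun w).
  by apply/funext => x; rewrite /GRing.add/= subrK.
exists (L2_class mu f) => e e0.
have [k hk] : exists k, (1 / 16 : R) ^+ k < e.
  have /cvgrPdist_lt/(_ _ e0)[k _ hk] : (geometric 1 (1 / 16 : R)) @ \oo --> (0 : R).
    by apply: cvg_geometric; rewrite ger0_norm ?divr_ge0// ltr_pdivrMr// mul1r ltr1n.
  exists k; have := hk k (leqnn k).
  by rewrite /= mul1r sub0r normrN ger0_norm// ltW.
exists (n k) => i ki; apply: le_lt_trans hk.
rewrite -lee_fin L2_dot_class//.
apply: (fatou_f (u i) k) => j kj; apply: ltW; apply: hN.
  exact: leq_trans (nN k) (nle _ _ kj).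
exact: leq_trans (nN k) ki.
Unshelve. all: by end_near. Qed.

HB.instance Definition _ := Lmodule_isHilbert.Build R (L2 mu)
  (@L2_dotC _ _ _ mu) (@L2_dotDl _ _ _ mu) (@L2_dotZl _ _ _ mu)
  (@L2_dot_ge0 _ _ _ mu) (@L2_dot_eq0 _ _ _ mu) L2_complete.

End L2_complete.

Section differential_geometry.
Context {R : realType}.

(** Meaningful for bounded linear [A] only ([sup] is [0] on unbounded sets). *)
Definition opnorm {V W : normedModType R} (A : V -> W) : R :=
  sup [set `|A v| | v in [set v | `|v| <= 1]].

Definition opnorm_continuous_on {X : topologicalType} {V W : normedModType R}
    (S : set X) (A : X -> V -> W) : Prop :=
  forall x, S x ->
    opnorm (fun v => A y v - A x v) @[y --> within S (nbhs x)] --> (0 : R).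

Definition C1_on {V W : normedModType R} (U : set V) (f : V -> W) : Prop :=
  (forall x, U x -> differentiable f x) /\
  opnorm_continuous_on U (fun x => 'd f x : V -> W).

Definition C1_diffeo {V : normedModType R} (U U' : set V) (phi psi : V -> V) :
    Prop :=
  [/\ open U, open U', phi @` U = U' & forall x, U x -> psi (phi x) = x] /\
  C1_on U phi /\ C1_on U' psi.

Definition closed_subspace {V : normedModType R} (E : set V) : Prop :=
  [/\ closed E, E 0 & forall (a : R) x y, E x -> E y -> E (a *: x + y)].

(** Slice charts: [M] is locally carried onto a closed subspace (which splits,
    as the ambient space is a Hilbert space). *)
Definition C1_submanifold {V : hilbertType R} (M : set V) : Prop :=
  forall z, M z -> exists U U' : set V, exists phi psi : V -> V,
    exists E : set V,
    [/\ C1_diffeo U U' phi psi, U z, closed_subspace E &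
        phi @` (U `&` M) = U' `&` E].

(** Velocities at [z] of the curves in [M] through [z]. *)
Definition tangent_space {V : hilbertType R} (M : set V) (z : V) : set V :=
  [set v | exists gamma : R -> V,
     [/\ gamma 0 = z, \forall s \near (0 : R), M (gamma s) &
         is_derive (0 : R) (1 : R) gamma v]].

End differential_geometry.

Section port_hamiltonian.
Context {R : realType}.
Implicit Types Z : hilbertType R.

Definition power_pairing {Z} (z w : Z \oplus Z) : R :=
  hdot z.1 w.2 + hdot w.1 z.2.

Definition power_orth {Z} (M : set (Z \oplus Z)) : set (Z \oplus Z) :=
  [set z | forall m, M m -> power_pairing z m = 0].

Definition dirac_structure {Z} (D : set (Z \oplus Z)) : Prop :=
  D = power_orth D.

(** The modulation space is the subset [S] of [X] with the subspace topology;
    the values of [D] outside [S] are irrelevant. *)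
Definition modulated_dirac_structure {X : topologicalType} {Z} (S : set X)
    (D : X -> set (Z \oplus Z)) : Prop :=
  (forall x, S x -> dirac_structure (D x)) /\
  exists W : hilbertType R, forall x, S x ->
    exists U : set X, exists T : X -> {linear W -> Z \oplus Z},
    [/\ open_nbhs x U,
        forall y, (U `&` S) y -> continuous (T y),
        forall y, (U `&` S) y -> set_bij setT (D y) (T y) &
        opnorm_continuous_on (U `&` S) (fun y => T y : W -> Z \oplus Z)].

Definition interconnection {X1 X2 : Type} {Z1 Z2 Zc : hilbertType R}
    (D1 : X1 -> set ((Z1 \oplus Zc) \oplus (Z1 \oplus Zc)))
    (D2 : X2 -> set ((Z2 \oplus Zc) \oplus (Z2 \oplus Zc)))
    (x : X1 * X2) : set ((Z1 \oplus Z2) \oplus (Z1 \oplus Z2)) :=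
  [set d | let: ((f1, f2), (e1, e2)) := d in exists fc ec : Zc,
     D1 x.1 ((f1, fc), (e1, ec)) /\ D2 x.2 ((f2, fc), (e2, - ec))].

Definition relation_product {Z1 Z2 : hilbertType R} (M1 : set (Z1 \oplus Z1))
    (M2 : set (Z2 \oplus Z2)) : set ((Z1 \oplus Z2) \oplus (Z1 \oplus Z2)) :=
  [set z | let: ((f1, f2), (e1, e2)) := z in M1 (f1, e1) /\ M2 (f2, e2)].

Definition lagrangian_submanifold {Z} (L : set (Z \oplus Z)) : Prop :=
  C1_submanifold L /\
  forall z, L z -> forall v, tangent_space L z v <->
    forall w, tangent_space L z w -> hdot v.1 w.2 - hdot w.1 v.2 = 0.

Definition resistive_relation {Z} (Rr : set (Z \oplus Z)) : Prop :=
  forall f e, Rr (f, e) -> 0 <= hdot f e.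

Definition port_hamiltonian_system {ZL ZR ZP : hilbertType R} (X : set ZL)
    (D : ZL -> set ((ZL \oplus ZR \oplus ZP) \oplus (ZL \oplus ZR \oplus ZP)))
    (L : set (ZL \oplus ZL)) (Rr : ZL -> set (ZR \oplus ZR)) : Prop :=
  [/\ open X, modulated_dirac_structure X D, lagrangian_submanifold L &
      forall x, X x -> resistive_relation (Rr x)].

Definition time_interval (I : set R) : Prop :=
  is_interval I /\ exists s t, [/\ I s, I t & s < t].

(** Derivative at [t] relative to [I]: one-sided at an end point of [I] that
    belongs to [I], the usual one at an interior point. *)
Definition time_derivative {V : normedModType R} (I : set R) (x : R -> V)
    (t : R) (v : V) : Prop :=
  (s - t)^-1 *: (x s - x t) @[s --> within I t^'] --> v.

(** External behaviour: the efforts [eL] and the resistive variables are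
    existentially quantified at each time. *)
Definition ph_trajectory {ZL ZR ZP : hilbertType R} (X : set ZL)
    (D : ZL -> set ((ZL \oplus ZR \oplus ZP) \oplus (ZL \oplus ZR \oplus ZP)))
    (L : set (ZL \oplus ZL)) (Rr : ZL -> set (ZR \oplus ZR))
    (I : set R) (x : R -> ZL) (fP eP : R -> ZP) : Prop :=
  forall t, I t -> X (x t) /\
    exists (xdot eL : ZL) (fR eR : ZR),
      [/\ time_derivative I x t xdot,
          D (x t) (((xdot, fR), fP t), ((eL, eR), eP t)),
          L (x t, eL) & Rr (x t) (fR, eR)].

(** [H] generates the Lagrangian submanifold over [X], i.e. [L] is the graph of
    the Hilbert space gradient of [H]. *)
Definition storage_function {Z} (X : set Z) (L : set (Z \oplus Z))
    (H : Z -> R) : Prop :=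
  forall x e, L (x, e) <->
    [/\ X x, differentiable H x & forall h, 'd H x h = hdot e h].

End port_hamiltonian.

Section interval_functions.
Context {R : realType}.
Context (L : R).

Definition interval_measure : {measure set (measurableTypeR R) -> \bar R} :=
  mrestr (@lebesgue_measure R) (measurable_itv `[0, L]).

Definition L2I : hilbertType R := L2 interval_measure.

Definition classI (f : R -> R) : L2I :=
  L2_class interval_measure (f \_ `[0, L]).

Definition integralI (f : R -> R) : R :=
  (\int[@lebesgue_measure R]_(x in `[0, L]) f x)%R.

Definition LinftyI (a : R -> R) : Prop :=
  (a \_ `[0, L] : R -> R) \in Lfun interval_measure +oo%E.

Definition uniformly_positive (a : R -> R) : Prop :=
  exists2 c, 0 < c & {ae interval_measure, forall xi, xi \in `[0, L] -> c <= a xi}.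

(** The product of [u] with an essentially bounded [a]. *)
Definition mulI (a : R -> R) (u : L2I) : L2I :=
  classI (fun xi => a xi * L2_fun u xi).

(** [u] is in H^2([0, L]): its class has a C^1 representative [h2], whose
    derivative [h2'] is the indefinite integral of the square-integrable
    second derivative [h2'']. *)
Record H2 (u : L2I) : Type := {
  h2 : R -> R ;
  h2' : R -> R ;
  h2'' : L2I ;
  h2_rep : {ae interval_measure, forall xi, L2_fun u xi = h2 xi} ;
  h2_prim : forall xi, 0 <= xi <= L ->
    h2 xi = h2 0 + (\int[@lebesgue_measure R]_(s in `[0%R, xi]) h2' s)%R ;
  h2'_prim : forall xi, 0 <= xi <= L -> h2' xi =
    h2' 0 + (\int[@lebesgue_measure R]_(s in `[0%R, xi]) L2_fun h2'' s)%R
}.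

End interval_functions.

Section geometry.
Context {R : realType}.

Definition vec n (s : seq R) : 'cV[R]_n := \col_i s`_i.
Definition mx_rows m n (s : seq (seq R)) : 'M[R]_(m, n) :=
  \matrix_(i, j) nth 0 (nth [::] s i) j.

Definition q0 (zeta : euc R 4) : euc R 2 := usubmx (zeta : 'cV[R]_(2 + 2)).
Definition qf (zeta : euc R 4) : euc R 2 := dsubmx (zeta : 'cV[R]_(2 + 2)).

Definition U_pos : set (euc R 4) := [set zeta | q0 zeta <> qf zeta].

(** [qf zeta - q0 zeta] is taken in [euc R 2]: this is the Euclidean norm. *)
Definition len (zeta : euc R 4) : R := `|qf zeta - q0 zeta|.

Definition J : 'M[R]_2 := mx_rows 2 2 [:: [:: 0; -1]; [:: 1; 0]].

Definition tvec (zeta : euc R 4) : 'cV[R]_2 :=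
  (len zeta)^-1 *: (qf zeta - q0 zeta).
Definition nvec (zeta : euc R 4) : 'cV[R]_2 := J *m tvec zeta.

Definition Zmx (zeta : euc R 4) : 'M[R]_(4, 3) :=
  let t := tvec zeta in let n := nvec zeta in
  col_mx (row_mx t (row_mx n 0) : 'M[R]_(2, 1 + (1 + 1)))
         (row_mx t (row_mx 0 n) : 'M[R]_(2, 1 + (1 + 1))).

Definition Bext (zeta : euc R 4) : 'M[R]_(3, 4) :=
  let t := tvec zeta in let n := nvec zeta in
  col_mx (row_mx t^T t^T : 'M[R]_(1, 2 + 2))
    (col_mx (row_mx n^T 0 : 'M[R]_(1, 2 + 2)) (row_mx 0 n^T : 'M[R]_(1, 2 + 2))).

End geometry.

(** Components of a coupling variable, in the order (d, t, n0, nf). *)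
Section coupling.
Context {R : realType}.
Implicit Types z : euc R 4.

Definition cd z : R := z (@Ordinal 4 0 isT) 0.
Definition ct z : R := z (@Ordinal 4 1 isT) 0.
Definition cn0 z : R := z (@Ordinal 4 2 isT) 0.
Definition cnf z : R := z (@Ordinal 4 3 isT) 0.

End coupling.

(** Coupling space, storage spaces, and spaces of the two subsystems: storage
    variables first, then external ports. *)
Section spaces.
Context (R : realType).

Definition Zc : hilbertType R := euc R 4.
Definition Zr_store : hilbertType R := euc R 4 \oplus R^o.
Definition Zr : hilbertType R := Zr_store \oplus euc R 4.
Definition Z0 : hilbertType R := euc R 0.
Definition Zb_ext : hilbertType R := euc R 4 \oplus euc R 2.
Definition Zf_store (L : R) : hilbertType R := L2I L \oplus L2I L.
Definition Zf (L : R) : hilbertType R := Zf_store L \oplus euc R 2.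
Definition Zb_store (L : R) : hilbertType R := Zr_store \oplus Zf_store L.

End spaces.

Section beam.
Context {R : realType} (L : R) (rho EI : R -> R).

Definition mass : R := integralI L rho.

Definition X_r : set (Zr_store R) := [set x | U_pos x.1].
Definition X_f : set (Zf_store L) := setT.
Definition X_b : set (Zb_store L) := [set x | X_r x.1 /\ X_f x.2].

Definition K_r (p : R) : 'M[R]_4 := (p / (mass * L)) *: mx_rows 4 4
  [:: [::  0; 0; 1; -1];
      [::  0; 0; 0;  0];
      [:: -1; 0; 0;  0];
      [::  1; 0; 0;  0]].

Definition D_r (x : Zr_store R) : set ((Zr R \oplus Zc R) \oplus (Zr R \oplus Zc R)) :=
  [set d | let: ((((fq, fp), fext), fc), (((eq, ep), eext), ec)) := d in
    let Z := Zmx x.1 in let B := Bext x.1 in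
    let v : 'cV[R]_3 := vec 3 [:: ep; cn0 fc; cnf fc] in
    exists ebar : 'cV[R]_3,
    [/\ fq = Z *m v, fext = B^T *m v, ct fc = ep,
        0 = Z^T *m eq + vec 3 [:: fp; 0; 0] + B *m eext + ebar &
        ec = (col_mx 0 ebar : 'cV[R]_(1 + 3)) + K_r x.2 *m fc]].

Definition D_f0 : set ((Zf L \oplus Zc R) \oplus (Zf L \oplus Zc R)) :=
  [set d | let: ((((fk, fp), fM), fc), (((ek, ep), eM), ec)) := d in
    exists (hk : H2 ek) (hp : H2 ep),
    [/\ fk = h2'' hp,
        fp = - h2'' hk - cd ec *: classI L rho,
        cd fc = integralI L (fun xi => rho xi * L2_fun ep xi) &
        ct ec = 0] /\
    [/\ cn0 fc = h2 hp 0, cn0 ec = - h2' hk 0,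
        cnf fc = h2 hp L & cnf ec = h2' hk L] /\
    [/\ fM = vec 2 [:: h2' hp 0; h2' hp L] &
        eM = vec 2 [:: h2 hk 0; - h2 hk L]]].

Definition K_f (x : Zf_store L) : 'M[R]_4 :=
  (integralI L (L2_fun x.2) / L) *: mx_rows 4 4
  [:: [:: 0;  0;  0; 0];
      [:: 0;  0; -1; 1];
      [:: 0;  1;  0; 0];
      [:: 0; -1;  0; 0]].

Definition U_f (x : Zf_store L) (d : (Zf L \oplus Zc R) \oplus (Zf L \oplus Zc R)) :
    (Zf L \oplus Zc R) \oplus (Zf L \oplus Zc R) :=
  let: ((f, fc), (e, ec)) := d in ((f, fc), (e, ec + K_f x *m fc)).

Definition D_f (x : Zf_store L) : set ((Zf L \oplus Zc R) \oplus (Zf L \oplus Zc R)) :=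
  U_f x @` D_f0.

Definition Gamma (d : ((Zr R \oplus Zc R) \oplus (Zr R \oplus Zc R)) *
                      ((Zf L \oplus Zc R) \oplus (Zf L \oplus Zc R))) : Zc R \oplus Zc R :=
  let: (((_, frc), (_, erc)), ((_, ffc), (_, efc))) := d in
  (frc - ffc, erc + efc).

(** Besides permuting the components, [Pi] inserts the component in the zero
    space of the resistive port. *)
Definition Pi (z : Zr R \oplus Zf L) : Zb_store L \oplus Z0 R \oplus Zb_ext R :=
  let: ((sr, pr), (sf, pf)) := z in (((sr, sf), 0), (pr, pf)).

Definition D_b (x : Zb_store L) :
    set ((Zb_store L \oplus Z0 R \oplus Zb_ext R) \oplus
         (Zb_store L \oplus Z0 R \oplus Zb_ext R)) :=
  [set (Pi d.1, Pi d.2) | d in interconnection D_r D_f x].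

Definition L_r : set (Zr_store R \oplus Zr_store R) :=
  [set z | let: ((zeta, p), e) := z in U_pos zeta /\ e = (0, p / mass)].

Definition L_f : set (Zf_store L \oplus Zf_store L) :=
  [set z | let: ((kappa, p), e) := z in
    e = (mulI EI kappa, mulI (fun xi => (rho xi)^-1) p)].

Definition L_b : set (Zb_store L \oplus Zb_store L) := relation_product L_r L_f.

(** [Z0 R] is the zero space: this is the whole of [Z0 R \oplus Z0 R]. *)
Definition R_b (x : Zb_store L) : set (Z0 R \oplus Z0 R) := [set 0].

Definition H_b (x : Zb_store L) : R :=
  let: ((_, pt), (kappa, pb)) := x in
  pt ^+ 2 / (2 * mass) + 2^-1 * integralI L (fun xi =>
    (rho xi)^-1 * L2_fun pb xi ^+ 2 + EI xi * L2_fun kappa xi ^+ 2).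

(** The fields [h2 hk], [h2' hk], [h2'' hk] are the continuous representatives
    of [EI * kappa t] and its derivatives; likewise [hp] for [pb t / rho]. *)
Definition moving_beam (I : set R) (zeta : R -> euc R 4) (pt : R -> R^o)
    (kappa pb : R -> L2I L) (F0 Ff : R -> euc R 2) (M0 Mf : R -> R)
    (v0 vf : R -> euc R 2) (omega0 omegaf : R -> R) : Prop :=
  forall t, I t ->
  exists (hk : H2 (mulI EI (kappa t)))
         (hp : H2 (mulI (fun xi => (rho xi)^-1) (pb t))),
  let tt : euc R 2 := tvec (zeta t) in
  let nn : euc R 2 := nvec (zeta t) in
  let omega := (h2 hp L - h2 hp 0) / L in
  [/\ time_derivative I zeta t
        (Zmx (zeta t) *m vec 3 [:: pt t / mass; h2 hp 0; h2 hp L]),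
      time_derivative I pt t
        (omega * integralI L (L2_fun (pb t)) + hdot tt (F0 t) + hdot tt (Ff t)),
      time_derivative I kappa t (h2'' hp) &
      time_derivative I pb t
        (- h2'' hk - (omega * (pt t / mass)) *: classI L rho)] /\
  [/\ h2' hk 0 = hdot nn (F0 t), - h2' hk L = hdot nn (Ff t),
      - h2 hk 0 = M0 t & h2 hk L = Mf t] /\
  [/\ v0 t = (pt t / mass) *: tt + h2 hp 0 *: nn,
      vf t = (pt t / mass) *: tt + h2 hp L *: nn,
      omega0 t = h2' hp 0 & omegaf t = h2' hp L].

End beam.

Arguments D_r {R} L rho x.
Arguments D_f0 {R} L rho.
Arguments D_f {R} L rho x.
Arguments D_b {R} L rho x.
Arguments R_b {R} L x.
Arguments H_b {R} L rho EI x.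
Arguments L_r {R} L rho.
Arguments L_f {R} L rho EI.
Arguments L_b {R} L rho EI.
Arguments mass {R} L rho.
Arguments Gamma {R} L d.
Arguments X_r {R}.
Arguments X_f {R} L.
Arguments X_b {R} L.
Arguments moving_beam {R} L rho EI.

(* Main.v *)
Require Import Defs.
From HB Require Import structures.
From mathcomp Require Import all_boot all_order all_algebra.
From mathcomp Require Import all_classical all_reals all_analysis.
From mathcomp Require Import measurable_realfun ess_sup_inf.
From mathcomp Require Import ring lra.

(* Two Dirac structures whose coupling map is onto a finite-dimensional space have
   a Dirac interconnection, since a functional on pairs vanishing on the kernel of
   the coupling map is represented by coupling variables (Riesz). The rigid part is
   Dirac because it is the graph of a skew relation, the flexible part by Green's
   formula together with its converse: an L^2 function satisfying Green's formula
   weakly against all of H^2 lies in H^2, with the boundary values read off the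
   formula. Eliminating the coupling variables, and using Zmx = Bext^T and the
   orthonormality of (t, n), the interconnection is parametrized linearly by a fixed
   Hilbert space, with coefficients continuous in the state. L_b is the graph of a
   bounded symmetric operator, hence Lagrangian and generated by its quadratic form
   H_b. Finally qf - q0 has a velocity along n, so its length is constant, and the
   beam equations are the explicit form of the interconnection. *)

Set Implicit Arguments.
Unset Strict Implicit.
Unset Printing Implicit Defensive.
Import Order.TTheory GRing.Theory Num.Theory.
Import numFieldNormedType.Exports.
Local Open Scope classical_set_scope.
Local Open Scope ring_scope.

(** The differential operators do not depend on the state: it enters only through the frame (t, n),
    the number p_t and the integral of p_b. Encoding an H^2 function by its initial data and its
    second derivative gives a parameter space that does not move, on which the boundary values are
    bounded functionals, so norm continuity reduces to continuity of finitely many scalars and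
    vectors. Integration by parts rests on Fubini, because the functions involved are primitives of
    merely square-integrable ones. The gyroscopic matrices are skew, hence harmless for the Dirac
    property; once the storage relation is inserted, their contributions cancel in the normal force
    balances and survive in the two momentum equations as the terms with omega. *)

(** * Inner product calculus *)

Section hilbert.
Context {R : realType} {V : hilbertType R}.
Implicit Types x y z : V.

Lemma hdotDr x y z : hdot x (y + z) = hdot x y + hdot x z.
Proof. by rewrite hdotC hdotDl !(hdotC x). Qed.
Lemma hdotZr (a : R) x y : hdot x (a *: y) = a * hdot x y.
Proof. by rewrite hdotC hdotZl hdotC. Qed.
Lemma hdot0l x : hdot 0 x = 0.
Proof. by rewrite -(scale0r 0) hdotZl mul0r. Qed.
Lemma hdot0r x : hdot x 0 = 0.
Proof. by rewrite hdotC hdot0l. Qed.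
Lemma hdotNl x y : hdot (- x) y = - hdot x y.
Proof. by rewrite -scaleN1r hdotZl mulN1r. Qed.
Lemma hdotNr x y : hdot x (- y) = - hdot x y.
Proof. by rewrite hdotC hdotNl hdotC. Qed.
Lemma hdotBl x y z : hdot (x - y) z = hdot x z - hdot y z.
Proof. by rewrite hdotDl hdotNl. Qed.
Lemma hdotBr x y z : hdot x (y - z) = hdot x y - hdot x z.
Proof. by rewrite hdotDr hdotNr. Qed.

Lemma hdotxx_eq0 x : hdot x x = 0 -> x = 0.
Proof. by rewrite hdotxx => /eqP; rewrite sqrf_eq0 normr_eq0 => /eqP. Qed.

Lemma hdot_le x y : hdot x y <= `|x| * `|y|.
Proof.
have [->|y0] := eqVneq y 0; first by rewrite hdot0r mulr_ge0.
have [->|x0] := eqVneq x 0; first by rewrite hdot0l mulr_ge0.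
have yp : 0 < `|y| by rewrite normr_gt0.
have xp : 0 < `|x| by rewrite normr_gt0.
have : 0 <= hdot (`|y| *: x - `|x| *: y) (`|y| *: x - `|x| *: y) by rewrite hdotxx sqr_ge0.
rewrite !(hdotBl, hdotBr, hdotZl, hdotZr) (hdotC y x) !hdotxx => h.
by have := mulr_gt0 xp yp; nra.
Qed.

Lemma norm_hdot_le x y : `|hdot x y| <= `|x| * `|y|.
Proof. by rewrite ler_norml hdot_le andbT lerNl -hdotNl -(normrN x) hdot_le. Qed.

Lemma hdot_inj x y : (forall z, hdot x z = hdot y z) -> x = y.
Proof. by move=> h; apply/eqP; rewrite -subr_eq0; apply/eqP/hdotxx_eq0; rewrite hdotBl h subrr. Qed.
End hilbert.

Lemma L2_lin_ae d (T : measurableType d) (R : realType) (mu : {measure set T -> \bar R})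
    (c : R) (u v : L2 mu) :
  {ae mu, forall x, L2_fun (c *: u + v) x = c * L2_fun u x + L2_fun v x}.
Proof.
by apply: filterS2 (L2_addE (c *: u) v) (L2_scaleE c u) => x /= -> ->.
Qed.

(** * Integration on [0, L] *)

Section interval.
Context {R : realType} (L : R).
Local Notation TR := (measurableTypeR R).
Local Notation mu := (@lebesgue_measure R).
Local Notation nu := (interval_measure L).
Implicit Types u v : L2I L.

Lemma nuC_eq0 : nu (~` `[0, L]%classic) = 0%E.
Proof. by rewrite /interval_measure /= /mrestr setICl measure0. Qed.

Lemma ae_interval (P : TR -> Prop) : (forall x : R, 0 <= x <= L -> P x) ->
  {ae nu, forall x, P x}.
Proof.
move=> h; exists (~` `[0, L]%classic); split.
- by apply: measurableC; exact: measurable_itv.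
- exact: nuC_eq0.
- by move=> x /= Px; rewrite in_itv/= => hx; apply: Px; exact: h.
Qed.

(** The complement of [0, L] is null for the restricted measure, which agrees with Lebesgue measure
    on measurable subsets of [0, L]. *)
Lemma ge0_integral_nu (f : TR -> \bar R) : measurable_fun setT f -> (forall x, 0 <= f x)%E ->
  (\int[nu]_x f x = \int[mu]_(x in `[0%R, L]) f x)%E.
Proof.
move=> mf f0.
transitivity (\int[nu]_(x in `[0%R, L]) f x)%E; last first.
  by apply: eq_measure_integral => A mA AD /=; rewrite /interval_measure /= /mrestr setIidl.
rewrite (@ge0_negligible_integral _ _ _ nu setT (~` `[0, L]%classic))//.
- by rewrite setTD setCK.
- by apply: measurableC; exact: measurable_itv.
- exact: nuC_eq0.
Qed.

Lemma integral_nu (f : TR -> \bar R) : measurable_fun setT f ->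
  (\int[nu]_x f x = \int[mu]_(x in `[0%R, L]) f x)%E.
Proof.
move=> mf; rewrite integralE [RHS]integralE; congr (_ - _)%E; apply: ge0_integral_nu => //.
- exact: measurable_funepos.
- exact: measurable_funeneg.
Qed.

Lemma hdotE u v : hdot u v = integralI L (fun x => L2_fun u x * L2_fun v x).
Proof.
rewrite /hdot /= /L2_dot /integralI /Rintegral; congr fine; apply: integral_nu.
by apply/measurable_EFinP; apply: measurable_funM; exact: (L2_mfun (mu := nu)).
Qed.

Lemma integrable_nu (f : TR -> \bar R) : measurable_fun setT f -> nu.-integrable setT f <-> mu.-integrable `[0, L] f.
Proof.
move=> mf; split => /integrableP[_ h]; apply/integrableP; split => //.
- exact: measurable_funS mf.
- by move: h; rewrite ge0_integral_nu//; apply: measurableT_comp.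
- by rewrite ge0_integral_nu//; apply: measurableT_comp.
Qed.

Lemma L2_mul_integrableI u v : mu.-integrable `[0, L] (fun x => (L2_fun u x * L2_fun v x)%:E).
Proof.
apply/integrable_nu; last exact: L2_mul_integrable.
by apply/measurable_EFinP; apply: measurable_funM; exact: (L2_mfun (mu := nu)).
Qed.

Lemma mu_itv0 (y : R) : (mu `[0%R, y] < +oo)%E.
Proof. by rewrite lebesgue_measure_itv; case: ifP => // _; rewrite -EFinD ltry. Qed.

Lemma bounded_Lfun (f : TR -> R) (M : R) : measurable_fun `[0, L] f ->
  (forall x : R, 0 <= x <= L -> `|f x| <= M) -> f \_ `[0, L] \in Lfun nu 2%:E.
Proof.
move=> mf fM.
have mg : measurable_fun setT (f \_ `[0, L]) by apply/(measurable_restrictT _ _).1 => //; exact: measurable_itv.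
apply: Lfun2_of_sqr => //.
rewrite ge0_integral_nu; last 2 first.
- by apply/measurable_EFinP; exact: measurable_funX.
- by move=> x; rewrite lee_fin sqr_ge0.
apply: (@le_lt_trans _ _ (\int[mu]_(x in `[0%R, L]) (M ^+ 2)%:E)%E).
  apply: ge0_le_integral => //.
  - by move=> x _; rewrite lee_fin sqr_ge0.
  - by apply/measurable_EFinP; apply: measurable_funX; exact: measurable_funS mg.
  - move=> x xD; rewrite lee_fin patchE mem_set//.
    have := fM x; move: xD; rewrite /= in_itv /= => -> /(_ isT) h.
    by rewrite -(real_normK (num_real _)) lerXn2r// nnegrE// (le_trans _ h).
rewrite integral_cst/= ?lte_mul_pinfty ?mu_itv0// lee_fin sqr_ge0//.
Qed.

Lemma classIE (f : TR -> R) : f \_ `[0, L] \in Lfun nu 2%:E ->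
  {ae nu, forall x, L2_fun (classI L f) x = (f \_ `[0, L]) x}.
Proof. by move=> /L2_classE; apply: filterS => x /(_ I). Qed.

Lemma classIE' (f : TR -> R) : f \_ `[0, L] \in Lfun nu 2%:E ->
  {ae nu, forall x, L2_fun (classI L f) x = f x}.
Proof.
move=> fP; have := ae_interval (P := fun x => (f \_ `[0, L]) x = f x).
move=> /(_ _)/filterS2; apply; last exact: classIE fP.
- by move=> x h1 h2; exact: (etrans h2 h1).
- by move=> x xD; rewrite patchE mem_set//= in_itv.
Qed.

Lemma integralI_ae (f g : TR -> R) : measurable_fun `[0, L] f -> measurable_fun `[0, L] g ->
  {ae nu, forall x, 0 <= x <= L -> f x = g x} -> integralI L f = integralI L g.
Proof.
move=> mf mg [N [mN N0 fg]]; rewrite /integralI /Rintegral; congr fine.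
apply: ae_eq_integral => //.
- exact/measurable_EFinP.
- exact/measurable_EFinP.
(* [N] is null for the restricted measure only, that is, its trace on [0, L] is Lebesgue null. *)
exists (N `&` `[0, L]); split => //.
- by apply: measurableI => //; exact: measurable_itv.
move=> x /=; rewrite in_itv/= => h; split.
  by apply: fg => /= h1; apply: h => h2; rewrite h1.
by apply: contrapT => h1; apply: h.
Qed.

Lemma itv_sub (x : R) : x <= L -> `[0, x]%classic `<=` `[0, L]%classic.
Proof. by move=> xL y /=; rewrite !in_itv/= => /andP[-> /= /le_trans]; apply. Qed.

Lemma integrable_itv_sub (f : TR -> R) (x : R) : x <= L ->
  mu.-integrable `[0, L] (EFin \o f) -> mu.-integrable `[0, x] (EFin \o f).
Proof. by move=> xL; apply: integrableS => //; exact: itv_sub. Qed.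

Lemma primitive_measurable (f : TR -> R) : 0 <= L ->
  mu.-integrable `[0, L] (EFin \o f) ->
  measurable_fun `[0, L] (fun x : TR => \int[mu]_(s in `[0%R, x : R]) f s)%R.
Proof.
move=> L0 fi; apply: subspace_continuous_measurable_fun; first exact: measurable_itv.
exact: parameterized_integral_continuous.
Qed.

Lemma primitive_bound (f : TR -> R) (x : R) : x <= L ->
  mu.-integrable `[0, L] (EFin \o f) ->
  `|(\int[mu]_(s in `[0%R, x]) f s)%R| <= integralI L (fun s => `|f s|).
Proof.
move=> xL fi; have fix_ := integrable_itv_sub xL fi.
apply: le_trans; first by apply: le_normr_Rintegral => //; exact: measurable_itv.
have fni : mu.-integrable `[0, L] (EFin \o (fun s => `|f s|)) by exact: integrable_norm.
rewrite /integralI /Rintegral fine_le//.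
- by apply: integrable_fin_num => //; exact: (integrable_norm fix_).
- exact: integrable_fin_num.
apply: ge0_subset_integral => //; try exact: measurable_itv.
- exact: measurable_int fni.
- exact: itv_sub.
Qed.

Lemma integrable_mul_bounded (f g : TR -> R) (M : R) :
  mu.-integrable `[0, L] (EFin \o f) -> measurable_fun `[0, L] g ->
  (forall x : R, 0 <= x <= L -> `|g x| <= M) ->
  mu.-integrable `[0, L] (EFin \o (fun x => f x * g x)).
Proof.
move=> fi mg gM.
have mf : measurable_fun `[0, L] f by apply/measurable_EFinP; exact: measurable_int fi.
apply: (le_integrable _ _ _ (integrableZl _ M fi)) => //.
- by apply/measurable_EFinP; exact: measurable_funM.
- move=> x /= xD; rewrite lee_fin !normrM mulrC ler_wpM2r//.
  by rewrite (le_trans (gM _ _))// ?ler_norm//; move: xD; rewrite in_itv.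
Qed.

Lemma integrable_mul_primitive (f g : TR -> R) : 0 <= L ->
  mu.-integrable `[0, L] (EFin \o f) -> mu.-integrable `[0, L] (EFin \o g) ->
  mu.-integrable `[0, L] (EFin \o (fun x : TR => f x * (\int[mu]_(s in `[0%R, x : R]) g s)%R)).
Proof.
move=> L0 fi gi; apply: integrable_mul_bounded fi (primitive_measurable L0 gi) _.
by move=> x /andP[_ xL]; exact: primitive_bound gi.
Qed.

(* Fubini over the triangle r <= s of [0, L]^2. *)
Lemma fubini_primitive (f k : TR -> R) : 0 <= L ->
  mu.-integrable `[0, L] (EFin \o f) -> mu.-integrable `[0, L] (EFin \o k) ->
  integralI L (fun s => f s * (\int[mu]_(r in `[0%R, s]) k r)%R)
  = integralI L f * integralI L k
    - integralI L (fun r => k r * (\int[mu]_(s in `[0%R, r]) f s)%R).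
Proof.
move=> L0 fi ki.
have mD : measurable (`[0%R, L]%classic : set TR) by exact: measurable_itv.
(* Extension by zero moves the integrals to the whole line: [F] and [K] cut out the square, the
   indicator of [A] the triangle. *)
pose F := f \_ `[0, L]; pose K := k \_ `[0, L].
have Fi : mu.-integrable setT (EFin \o F) by rewrite /F -restrict_EFin; apply/(integrable_mkcond _ mD).1.
have Ki : mu.-integrable setT (EFin \o K) by rewrite /K -restrict_EFin; apply/(integrable_mkcond _ mD).1.
have mF : measurable_fun setT F by apply/measurable_EFinP; exact: measurable_int Fi.
have mK : measurable_fun setT K by apply/measurable_EFinP; exact: measurable_int Ki.
pose A : set (TR * TR) := [set z | z.2 <= z.1].
have mA : measurable A.
  rewrite (_ : A = setT `&` (fun z : TR * TR => z.1 - z.2) @^-1` `[0, +oo[%classic).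
    apply: measurable_funB => //; exact: measurable_itv.
  by apply/seteqP; split => z /=; rewrite in_itv/= andbT subr_ge0; [|case].
pose P := fun z : TR * TR => (F z.1 * K z.2 * \1_A z)%:E.
have mP : measurable_fun setT P.
  apply/measurable_EFinP; apply: measurable_funM; last exact: measurable_indic.
  by apply: measurable_funM; apply: measurableT_comp.
have Pi : (mu \x mu)%E.-integrable setT P.
  apply/(@integrable12ltyP _ _ _ _ _ mu mu P mP).
  have Fni : mu.-integrable setT (EFin \o (fun x => `|F x|)) by exact: integrable_norm.
  have Kni : mu.-integrable setT (EFin \o (fun x => `|K x|)) by exact: integrable_norm.
  pose c := (\int[mu]_y `|K y|)%R.
  have cE : (\int[mu]_y `|K y|%:E)%E = c%:E by rewrite fineK//; exact: integrable_fin_num.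
  (* The indicator is at most 1, so the slice of [|P|] at [x] integrates to at most [c * |F x|]. *)
  apply: (@le_lt_trans _ _ (\int[mu]_x (c%:E * `|F x|%:E))%E); last first.
    rewrite integralZl// -ge0_fin_numE; last first.
      by rewrite mule_ge0 ?integral_ge0// -cE integral_ge0.
    by rewrite fin_numM//; exact: integrable_fin_num.
  apply: ge0_le_integral => //.
  - by move=> x _; apply: integral_ge0.
  - apply: (@measurable_fun_fubini_tonelli_F _ _ _ _ _ mu (abse \o P)) => //=.
    by apply: measurableT_comp.
  - by apply/measurable_EFinP; apply: measurable_funM => //; apply: measurableT_comp.
  move=> x _; rewrite muleC -cE -integralZl//.
  apply: ge0_le_integral => //.
  - apply: measurableT_comp => //; exact: measurableT_comp mP (pair1_measurable x).
  - by apply/measurable_EFinP; apply: measurable_funM => //; apply: measurableT_comp.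
  move=> y _; rewrite /P abse_EFin -EFinM lee_fin !normrM ler_piMr ?mulr_ge0//.
  by rewrite indicE; case: (_ \in _); rewrite ?normr1 ?normr0.
have := Fubini Pi.
(* For [x] in [0, L] the slice of [P] lives on [0, x]; for other [x] it vanishes with [F x]. *)
rewrite [in X in X = _ -> _](_ : (fun x => _) = ((fun x => (f x * (\int[mu]_(r in `[0%R, x]) k r)%R)%:E) \_ `[0, L])); last first.
  apply/funext => x; rewrite patchE; case: ifPn => [|xD]; last first.
    rewrite integral0_eq// => y _; by rewrite /P /F /= patchE (negbTE xD) !mul0r.
  rewrite inE/= in_itv/= => /andP[x0 xL].
  have ki' := integrable_itv_sub xL ki.
  rewrite (_ : (fun y => P (x, y)) = (fun y => (f x)%:E * ((EFin \o k) \_ `[0%R, x]) y)%E).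
    rewrite integralZl//; last by apply/(integrable_mkcond _ _).1 => //; exact: measurable_itv.
    rewrite -integral_mkcond EFinM /Rintegral fineK//.
    exact: integrable_fin_num.
  apply/funext => y; rewrite /P /F /K /A !patchE/= mem_set/= ?in_itv/= ?x0//.
  rewrite indicE; have [yx|yx] := boolP (y \in `[0%R, x]%classic).
    move: yx; rewrite inE/= in_itv/= => /andP[y0 yx].
    by rewrite !mem_set//= ?in_itv/= ?y0 ?(le_trans yx)// mulr1 EFinM.
  (* A restriction takes the default value [point] off its domain, and in the extended reals this is
     0. *)
  have -> : (point : \bar R) = 0%E by [].
  rewrite mule0; have [yL|yL] := boolP (y \in `[0%R, L]%classic); last by rewrite mulr0 mul0r.
  rewrite memNset ?mulr0// => /= yx'.
  move/negP: yx; apply; rewrite inE/= in_itv/= yx' andbT.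
  by move: yL; rewrite inE/= in_itv/= => /andP[].
rewrite -integral_mkcond.
rewrite [in X in _ = X -> _](_ : (fun y => _) = ((fun y => (k y * (\int[mu]_(r in `[y, L]) f r)%R)%:E) \_ `[0, L])); last first.
  apply/funext => y; rewrite patchE; case: ifPn => [|yD]; last first.
    by rewrite integral0_eq// => x _; rewrite /P /K /= patchE (negbTE yD) mulr0 mul0r.
  rewrite inE/= in_itv/= => /andP[y0 yL].
  have fi' : mu.-integrable `[y, L] (EFin \o f).
    by apply: integrableS fi => //; apply: subset_itvr; rewrite bnd_simp.
  rewrite (_ : (fun x => P (x, y)) = (fun x => (k y)%:E * ((EFin \o f) \_ `[y, L]) x)%E).
    rewrite integralZl//; last by apply/(integrable_mkcond _ _).1 => //; exact: measurable_itv.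
    rewrite -integral_mkcond EFinM /Rintegral fineK//.
    exact: integrable_fin_num.
  have yD : y \in `[0%R, L]%classic by rewrite inE/= in_itv/= y0.
  apply/funext => x; rewrite /P /F /K /A !patchE/= yD.
  rewrite indicE; have [yx|yx] := boolP (x \in `[y, L]%classic).
    move: yx; rewrite inE/= in_itv/= => /andP[yx xL].
    by rewrite !mem_set//= ?in_itv/= ?(le_trans y0) ?xL// mulr1 EFinM muleC.
  have -> : (point : \bar R) = 0%E by [].
  rewrite mule0; have [xL|xL] := boolP (x \in `[0%R, L]%classic); last by rewrite !mul0r.
  rewrite memNset ?mulr0// => /= yx'.
  move/negP: yx; apply; rewrite inE/= in_itv/= yx'/=.
  by move: xL; rewrite inE/= in_itv/= => /andP[].
rewrite -integral_mkcond.
move=> /(congr1 fine) FK; apply: (etrans FK).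
(* The slices in the other order live on [y, L]; their integral is the total one minus the integral
   over [0, y]. *)
transitivity (integralI L (fun y => k y * (integralI L f - (\int[mu]_(s in `[0%R, y]) f s)%R))).
  apply: eq_Rintegral => y; rewrite inE/= in_itv/= => /andP[y0 yL].
  rewrite Rintegral_itvB// ?bnd_simp//.
  rewrite Rintegral_itv_obnd_cbnd//.
  by apply: integrableS fi => //; apply: subset_itvr; rewrite bnd_simp.
under [LHS]eq_Rintegral do rewrite mulrBr.
rewrite /integralI RintegralB//.
- by rewrite mulrC -RintegralZr.
- by apply: eq_integrable (integrableZr _ _ ki) => // x _ /=; rewrite EFinM.
- exact: integrable_mul_primitive.
Qed.

Lemma measurable_L2I u (D : set TR) : measurable_fun D (L2_fun u : TR -> R).
Proof. by apply: measurable_funS (L2_mfun (mu := nu) u). Qed.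
Hint Resolve measurable_L2I : core.

Lemma integrable_cstI (c : R) : mu.-integrable `[0, L] (EFin \o (cst c : TR -> R)).
Proof.
apply: measurable_bounded_integrable => //; first exact: mu_itv0.
by exists `|c|; split; [exact: num_real|move=> M cM x _ /=; exact: ltW].
Qed.

Lemma measurable_itvI (y : R) : measurable (`[0, y]%classic : set TR).
Proof. exact: measurable_itv. Qed.
Hint Resolve measurable_itvI : core.

(** On an interval of finite measure [1 + u^2] is integrable, and it dominates [|u|]. *)
Lemma L2_integrableI u : mu.-integrable `[0, L] (EFin \o L2_fun u).
Proof.
have h := integrableD (measurable_itvI _) (integrable_cstI 1) (L2_mul_integrableI u u).
apply: le_integrable h => //; first by apply/measurable_EFinP.
move=> x _; rewrite /= lee_fin -expr2.
rewrite [leRHS]ger0_norm ?addr_ge0 ?sqr_ge0//.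
rewrite -(real_normK (num_real (L2_fun u x))); have := normr_ge0 (L2_fun u x).
by set t := `|_|; nra.
Qed.

Lemma L2I_ext u v : {ae nu, forall x : TR, 0 <= x <= L -> L2_fun u x = L2_fun v x} -> u = v.
Proof.
move=> h; apply: L2_ext; apply: (filterS2 _ _ h (ae_interval (P := fun x => 0 <= x <= L) (fun x h => h))).
by move=> x + /= xD; apply.
Qed.

Lemma hdot_classI u (f : TR -> R) : f \_ `[0, L] \in Lfun nu 2%:E -> measurable_fun `[0, L] f ->
  hdot u (classI L f) = integralI L (fun x => L2_fun u x * f x).
Proof.
move=> fP mf; rewrite hdotE; apply: integralI_ae.
- by apply: measurable_funM; exact: measurable_L2I.
- by apply: measurable_funM => //; exact: measurable_L2I.
- by apply: filterS (classIE' fP) => x /= -> _.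
Qed.

Lemma integralI_cst (c : R) : 0 <= L -> integralI L (cst c) = c * L.
Proof.
move=> L0; have mI : mu `[0%R, L]%classic = L%:E.
  by rewrite lebesgue_measure_itv/= lte_fin -EFinD subr0; case: ltP => // h; congr EFin; apply/le_anti/andP.
by apply: (etrans (Rintegral_cst _ _ _)) => //; congr (_ * _); exact: (congr1 fine mI).
Qed.

Lemma classI_norm (f : TR -> R) (M : R) : 0 <= L -> measurable_fun `[0, L] f ->
  (forall x : R, 0 <= x <= L -> `|f x| <= M) -> `|classI L f| <= M * Num.sqrt L.
Proof.
move=> L0 mf fM; have fP := bounded_Lfun mf fM.
have M0 : 0 <= M by rewrite (le_trans _ (fM 0 _))// lexx.
rewrite -(@ler_pXn2r _ 2)// ?nnegrE ?mulr_ge0 ?sqrtr_ge0// exprMn (sqr_sqrtr L0) -hdotxx hdotE.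
rewrite (@integralI_ae _ (fun x => f x * f x)).
- have h : mu.-integrable `[0, L] (EFin \o (fun x : TR => f x * f x)).
    apply: measurable_bounded_integrable => //; first exact: mu_itv0.
      exact: measurable_funM.
    exists (M ^+ 2); split; [exact: num_real|move=> N NM x /=; rewrite in_itv/= => xD].
    by rewrite normrM -expr2 (le_trans _ (ltW NM))// lerXn2r ?nnegrE// fM.
  apply: (@le_trans _ _ (integralI L (cst (M ^+ 2)))).
    apply: le_Rintegral => //; first exact: integrable_cstI.
    move=> x /=; rewrite in_itv/= => xD; rewrite -expr2 -(real_normK (num_real _)).
    by rewrite lerXn2r ?nnegrE// fM.
  by rewrite integralI_cst.
- by apply: measurable_funM; exact: measurable_L2I.
- exact: measurable_funM.
- by apply: filterS (classIE' fP) => x /= -> _.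
Qed.

(** The Riesz representative of integration over [0, y]; through it, linearity and boundedness of
    primitives become properties of [hdot]. *)
Definition chi (y : R) : L2I L := classI L \1_(`[0, y]%classic : set TR).

Lemma hdot_chi u (y : R) : y <= L -> hdot u (chi y) = (\int[mu]_(s in `[0%R, y]) L2_fun u s)%R.
Proof.
move=> yL; rewrite hdot_classI; last 2 first.
- apply: (@bounded_Lfun _ 1).
    exact: measurable_indic.
  by move=> x _; rewrite indicE; case: (_ \in _); rewrite ?normr1 ?normr0.
- exact: measurable_indic.
rewrite /integralI Rintegral_mkcond [RHS]Rintegral_mkcond; apply: eq_Rintegral => x _.
rewrite !patchE indicE; case: (boolP (x \in `[0, y]%classic)) => xy; last by case: ifP => _ //; rewrite mulr0.
by rewrite mulr1 ifT//; move: xy; rewrite !inE/=; exact: itv_sub.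
Qed.

Lemma chi_norm (y : R) : 0 <= L -> `|chi y| <= Num.sqrt L.
Proof.
move=> L0; rewrite -[leRHS]mulr1 mulrC; apply: classI_norm => //.
by move=> x _; rewrite indicE; case: (_ \in _); rewrite ?normr1 ?normr0.
Qed.

(** * Primitives, H^2 and Green's formula *)

(** [prim2 a b g] is the solution of [u'' = g] with initial value [a] and initial slope [b], and
    [prim1 b g] is its derivative. *)
Definition prim1 (b : R) (g : R -> R) (x : R) : R := b + (\int[mu]_(s in `[0%R, x]) g s)%R.
Definition prim2 (a b : R) (g : R -> R) (x : R) : R :=
  a + (\int[mu]_(s in `[0%R, x]) prim1 b g s)%R.

Lemma Rintegral_itv0 (f : R -> R) : (\int[mu]_(s in `[0%R, 0%R]) f s)%R = 0.
Proof. by rewrite set_itv1 Rintegral_set1. Qed.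

Lemma prim1_0 b g : prim1 b g 0 = b. Proof. by rewrite /prim1 Rintegral_itv0 addr0. Qed.
Lemma prim2_0 a b g : prim2 a b g 0 = a. Proof. by rewrite /prim2 Rintegral_itv0 addr0. Qed.

Lemma primitive_hdot u x : x <= L -> (\int[mu]_(s in `[0%R, x]) L2_fun u s)%R = hdot u (chi x).
Proof. by move=> xL; rewrite hdot_chi. Qed.

Hypothesis L_ge0 : 0 <= L.

Lemma prim1_bound b u x : x <= L -> `|prim1 b (L2_fun u) x| <= `|b| + Num.sqrt L * `|u|.
Proof.
move=> xL; rewrite /prim1 primitive_hdot//.
rewrite (le_trans (ler_normD _ _))// lerD2l mulrC (le_trans (norm_hdot_le _ _))//.
by rewrite ler_wpM2l// chi_norm.
Qed.

Lemma prim1_measurable b u : measurable_fun `[0, L] (prim1 b (L2_fun u) : TR -> R).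
Proof. by apply: measurable_funD => //; apply: primitive_measurable => //; exact: L2_integrableI. Qed.

Lemma prim1_integrable b u : mu.-integrable `[0, L] (EFin \o (prim1 b (L2_fun u) : TR -> R)).
Proof.
apply: measurable_bounded_integrable => //; first exact: mu_itv0.
  exact: prim1_measurable.
exists (`|b| + Num.sqrt L * `|u|); split; first exact: num_real.
by move=> M MM x; rewrite /= in_itv/= => /andP[_ xL]; rewrite (le_trans (prim1_bound _ _ xL))// ltW.
Qed.

Lemma prim2_measurable a b u : measurable_fun `[0, L] (prim2 a b (L2_fun u) : TR -> R).
Proof. by apply: measurable_funD => //; apply: primitive_measurable => //; exact: prim1_integrable. Qed.

Lemma prim2_bound a b u x : x <= L ->
  `|prim2 a b (L2_fun u) x| <= `|a| + L * (`|b| + Num.sqrt L * `|u|).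
Proof.
move=> xL; rewrite /prim2.
rewrite (le_trans (ler_normD _ _))// lerD2l (le_trans (primitive_bound xL (prim1_integrable b u)))//.
apply: (@le_trans _ _ (integralI L (cst (`|b| + Num.sqrt L * `|u|)))).
  apply: le_Rintegral => //; last first.
  - by move=> y /=; rewrite in_itv/= => /andP[_ yL]; exact: prim1_bound.
  - exact: integrable_cstI.
  - by apply: integrable_norm => //; exact: prim1_integrable.
by rewrite integralI_cst// mulrC.
Qed.

Lemma L2I_lin_ae (c : R) u u' : {ae nu, forall x : TR, L2_fun (c *: u + u') x = c * L2_fun u x + L2_fun u' x}.
Proof. exact: L2_lin_ae. Qed.

Lemma L2I_lin_ext (c : R) (u v w : L2I L) (fu fv fw : TR -> R) :
  {ae nu, forall x : TR, L2_fun u x = fu x} -> {ae nu, forall x : TR, L2_fun v x = fv x} ->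
  {ae nu, forall x : TR, L2_fun w x = fw x} ->
  (forall x : R, 0 <= x <= L -> fw x = c * fu x + fv x) -> w = c *: u + v.
Proof.
move=> hu hv hw h; apply: L2I_ext; move: (L2I_lin_ae c u v).
set z := c *: u + v; move: z => z hz.
apply: (filterS2 _ _ (filterI hu hv) (filterI hw hz)) => x [e1 e2] [e3 e4] xI.
by rewrite e3 e4 e1 e2 h.
Qed.

Lemma prim1_lin (c b b' : R) u u' x : x <= L ->
  prim1 (c * b + b') (L2_fun (c *: u + u')) x = c * prim1 b (L2_fun u) x + prim1 b' (L2_fun u') x.
Proof.
by move=> xL; rewrite /prim1 !primitive_hdot// hdotDl hdotZl; ring.
Qed.

Lemma prim2_lin (c a b a' b' : R) u u' x : x <= L ->
  prim2 (c * a + a') (c * b + b') (L2_fun (c *: u + u')) x =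
  c * prim2 a b (L2_fun u) x + prim2 a' b' (L2_fun u') x.
Proof.
move=> xL; rewrite /prim2.
have -> : (\int[mu]_(s in `[0%R, x]) prim1 (c * b + b') (L2_fun (c *: u + u')) s)%R =
  c * (\int[mu]_(s in `[0%R, x]) prim1 b (L2_fun u) s)%R + (\int[mu]_(s in `[0%R, x]) prim1 b' (L2_fun u') s)%R.
  have i1 := integrable_itv_sub xL (prim1_integrable b u).
  have i2 := integrable_itv_sub xL (prim1_integrable b' u').
  rewrite -RintegralZl// -RintegralD//.
    apply: eq_Rintegral => s; rewrite inE/= in_itv/= => /andP[_ sx].
    by rewrite prim1_lin// (le_trans sx).
  by apply: eq_integrable (integrableZl _ c i1) => // s _ /=; rewrite EFinM.
ring.
Qed.

Definition H2_lift (a b : R) u : L2I L := classI L (prim2 a b (L2_fun u)).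

Lemma H2_lift_ae a b u : {ae nu, forall x : TR, L2_fun (H2_lift a b u) x = prim2 a b (L2_fun u) x}.
Proof.
apply: classIE'; apply: bounded_Lfun (prim2_measurable a b u) _.
by move=> x /andP[_]; exact: prim2_bound.
Qed.

Lemma H2_lift_lin (c a b a' b' : R) u u' :
  H2_lift (c * a + a') (c * b + b') (c *: u + u') = c *: H2_lift a b u + H2_lift a' b' u'.
Proof.
apply: (@L2I_lin_ext _ _ _ _ _ _ _ (H2_lift_ae a b u) (H2_lift_ae a' b' u') (H2_lift_ae _ _ _)).
by move=> x /andP[_ xL]; exact: prim2_lin.
Qed.

Lemma H2_lift_norm a b u :
  `|H2_lift a b u| <= (`|a| + L * (`|b| + Num.sqrt L * `|u|)) * Num.sqrt L.
Proof.
apply: classI_norm => //; first exact: prim2_measurable.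
by move=> x /andP[_]; exact: prim2_bound.
Qed.

(** Every initial value, initial slope and second derivative are realized; with the converse
    [H2_liftE], this identifies H^2 with [R^2 x L^2]. *)
Definition H2_of (a b : R) u : H2 (H2_lift a b u) :=
  {| h2 := prim2 a b (L2_fun u); h2' := prim1 b (L2_fun u); h2'' := u;
     h2_rep := H2_lift_ae a b u;
     h2_prim := fun x _ => congr1 (fun a => a + _) (esym (prim2_0 a b (L2_fun u)));
     h2'_prim := fun x _ => congr1 (fun a => a + _) (esym (prim1_0 b (L2_fun u))) |}.

Lemma H2_h2'E u (hu : H2 u) x : 0 <= x <= L -> h2' hu x = prim1 (h2' hu 0) (L2_fun (h2'' hu)) x.
Proof. exact: h2'_prim. Qed.

Lemma H2_h2E u (hu : H2 u) x : 0 <= x <= L -> h2 hu x = prim2 (h2 hu 0) (h2' hu 0) (L2_fun (h2'' hu)) x.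
Proof.
move=> xI; rewrite (h2_prim hu xI) /prim2; congr (_ + _).
apply: eq_Rintegral => s; rewrite inE/= in_itv/= => /andP[s0 sx].
by rewrite H2_h2'E// s0 (le_trans sx)//; case/andP: xI.
Qed.

Lemma H2_liftE u (hu : H2 u) : u = H2_lift (h2 hu 0) (h2' hu 0) (h2'' hu).
Proof.
apply: L2I_ext.
apply: (filterS2 _ _ (h2_rep hu) (H2_lift_ae (h2 hu 0) (h2' hu 0) (h2'' hu))) => x e1 e2 xI.
by rewrite e1 e2 -H2_h2E.
Qed.

(** A first integration by parts, valid for [g] merely in L^2: [v] is its initial value plus the
    primitive of [h2'], and [fubini_primitive] moves the primitive onto [g]. *)
Lemma hdot_H2 (g v : L2I L) (hv : H2 v) : hdot g v =
  h2 hv 0 * (\int[mu]_(s in `[0%R, L]) L2_fun g s)%R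
  + (\int[mu]_(s in `[0%R, L]) L2_fun g s)%R * (h2 hv L - h2 hv 0)
  - integralI L (fun r : TR => h2' hv r * (\int[mu]_(s in `[0%R, r : R]) L2_fun g s)%R).
Proof.
rewrite hdotE.
set b := h2' hv 0; set w := h2'' hv.
have E : integralI L (fun x : TR => L2_fun g x * L2_fun v x) =
   integralI L (fun x : TR => L2_fun g x * prim2 (h2 hv 0) b (L2_fun w) x).
  apply: integralI_ae.
  - by apply: measurable_funM; exact: measurable_L2I.
  - by apply: measurable_funM; [exact: measurable_L2I|exact: prim2_measurable].
  apply: filterS (h2_rep hv) => x e xI.
  by rewrite e H2_h2E.
rewrite E.
have E2 : integralI L (fun x : TR => L2_fun g x * prim2 (h2 hv 0) b (L2_fun w) x) =
   h2 hv 0 * integralI L (L2_fun g) + integralI L (fun x : TR => L2_fun g x * (\int[mu]_(s in `[0%R, x : R]) prim1 b (L2_fun w) s)%R).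
  rewrite /integralI -RintegralZl//; last exact: L2_integrableI.
  rewrite -RintegralD//.
  - by apply: eq_Rintegral => x _; rewrite /prim2; ring.
  - by apply: eq_integrable (integrableZl _ (h2 hv 0) (L2_integrableI g)) => // s _ /=; rewrite EFinM.
  - by apply: integrable_mul_primitive => //; [exact: L2_integrableI|exact: prim1_integrable].
rewrite E2 fubini_primitive//; last 2 first.
- exact: L2_integrableI.
- exact: prim1_integrable.
rewrite -addrA; congr (_ + _); congr (_ * _ - _).
- have LL : 0 <= L <= L by rewrite L_ge0 lexx.
  by rewrite (H2_h2E hv LL) /prim2 addrC addKr.
- apply: eq_Rintegral => x; rewrite inE/= in_itv/= => xI.
  by rewrite (H2_h2'E hv xI).
Qed.

Lemma H2_primitive u (hu : H2 u) x : 0 <= x <= L ->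
  (\int[mu]_(s in `[0%R, x]) L2_fun (h2'' hu) s)%R = h2' hu x - h2' hu 0.
Proof. by move=> xI; rewrite (H2_h2'E hu xI) /prim1 addrC addKr. Qed.

Lemma H2_h2'_integrable u (hu : H2 u) : mu.-integrable `[0, L] (EFin \o (h2' hu : TR -> R)).
Proof.
apply: eq_integrable (prim1_integrable (h2' hu 0) (h2'' hu)) => // x; rewrite inE/= in_itv/= => xI.
by rewrite -H2_h2'E.
Qed.

Lemma H2_primitive' u (hu : H2 u) : integralI L (h2' hu) = h2 hu L - h2 hu 0.
Proof.
have LL : 0 <= L <= L by rewrite L_ge0 lexx.
by rewrite (h2_prim hu LL) addrC addKr.
Qed.

Lemma hdot_H2'' u v (hu : H2 u) (hv : H2 v) : hdot (h2'' hu) v =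
  h2' hu L * h2 hv L - h2' hu 0 * h2 hv 0 - integralI L (fun r : TR => h2' hv r * h2' hu r).
Proof.
have LL : 0 <= L <= L by rewrite L_ge0 lexx.
rewrite (hdot_H2 _ hv) (H2_primitive hu LL).
have -> : integralI L (fun r : TR => h2' hv r * (\int[mu]_(s in `[0%R, r : R]) L2_fun (h2'' hu) s)%R) =
  integralI L (fun r : TR => h2' hv r * h2' hu r) - h2' hu 0 * integralI L (h2' hv).
  transitivity (integralI L (fun r : TR => h2' hv r * h2' hu r - h2' hv r * h2' hu 0)).
    by apply: eq_Rintegral => x; rewrite inE/= in_itv/= => xI; rewrite H2_primitive// mulrBr.
  rewrite /integralI RintegralB//.
  - by rewrite RintegralZr//; [rewrite (mulrC (h2' hu 0))|exact: H2_h2'_integrable].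
  - apply: (@integrable_mul_bounded _ _ (`|h2' hu 0| + Num.sqrt L * `|h2'' hu|)); first exact: H2_h2'_integrable.
      by apply/measurable_EFinP; exact: measurable_int (H2_h2'_integrable hu).
    by move=> x xI; rewrite (H2_h2'E hu xI) prim1_bound//; case/andP: xI.
  - by apply: eq_integrable (integrableZr _ (h2' hu 0) (H2_h2'_integrable hv)) => // s _ /=; rewrite EFinM.
rewrite H2_primitive'; ring.
Qed.

(** By [hdot_H2''] both inner products are boundary terms minus the integral of the product of the
    first derivatives, which is symmetric and cancels. *)
Lemma H2_green u v (hu : H2 u) (hv : H2 v) : hdot (h2'' hu) v - hdot u (h2'' hv) =
  h2' hu L * h2 hv L - h2' hu 0 * h2 hv 0 - h2 hu L * h2' hv L + h2 hu 0 * h2' hv 0.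
Proof.
rewrite (hdotC u) (hdot_H2'' hu hv) (hdot_H2'' hv hu).
have -> : integralI L (fun r : TR => h2' hu r * h2' hv r) = integralI L (fun r : TR => h2' hv r * h2' hu r).
  by apply: eq_Rintegral => x _; rewrite mulrC.
ring.
Qed.

(** Integration backwards from L. These are the test functions of [H2_weak]: their data at L are
    chosen at will, together with the second derivative. *)
Lemma H2_terminal (g : L2I L) (a b : R) : exists u, exists hu : H2 u,
  [/\ h2'' hu = g, h2 hu L = a & h2' hu L = b].
Proof.
pose b0 := b - (\int[mu]_(s in `[0%R, L]) L2_fun g s)%R.
pose a0 := a - (\int[mu]_(s in `[0%R, L]) prim1 b0 (L2_fun g) s)%R.
exists (H2_lift a0 b0 g), (H2_of a0 b0 g); split => //=.
- by rewrite /prim2 /a0 subrK.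
- by rewrite /prim1 /b0 subrK.
Qed.

(* Testing against functions with vanishing end data at L identifies e with the
   H^2 function having second derivative g and initial data (a, b). *)
Lemma H2_weak (g e : L2I L) (a b c d : R) :
  (forall u (hu : H2 u), hdot g u - hdot e (h2'' hu) =
     d * h2 hu L - b * h2 hu 0 - c * h2' hu L + a * h2' hu 0) ->
  exists he : H2 e, [/\ h2'' he = g, h2 he 0 = a, h2' he 0 = b, h2 he L = c & h2' he L = d].
Proof.
move=> weak; pose w := H2_lift a b g; pose hw := H2_of a b g.
(* Subtracting Green's formula for [w] removes the boundary terms at 0, since [w] has initial data
   [(a, b)]. *)
have key u (hu : H2 u) : hdot (w - e) (h2'' hu) =
    (d - h2' hw L) * h2 hu L - (c - h2 hw L) * h2' hu L.
  have w0 : h2 hw 0 = a by exact: prim2_0.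
  have w0' : h2' hw 0 = b by exact: prim1_0.
  have := H2_green hw hu; have := weak u hu; rewrite w0 w0' /=.
  by rewrite hdotBl; lra.
have {}ew : e = w.
  (* With zero data at L and second derivative [w - e], the identity says that [w - e] has norm
     0. *)
  have [u [hu [u2 uL uL']]] := H2_terminal (w - e) 0 0.
  have := key u hu; rewrite u2 uL uL' !mulr0 subrr => /hdotxx_eq0/eqP.
  by rewrite subr_eq0 => /eqP.
have dL : d = h2' hw L.
  have [u [hu [u2 uL uL']]] := H2_terminal 0 1 0.
  have := key u hu; rewrite u2 uL uL' ew subrr hdot0l.
  by lra.
have cL : c = h2 hw L.
  have [u [hu [u2 uL uL']]] := H2_terminal 0 0 1.
  have := key u hu; rewrite u2 uL uL' ew subrr hdot0l.
  by lra.
rewrite ew; exists hw; split => //.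
- exact: prim2_0.
- exact: prim1_0.
Qed.

(** * Multiplication by essentially bounded functions *)

Lemma interval_setT_gt0 : 0 < L -> (0 < nu setT)%E.
Proof.
move=> L0; rewrite /interval_measure /= /mrestr setTI.
by rewrite lebesgue_measure_itv/= lte_fin L0 -EFinD subr0 lte_fin.
Qed.

(** The working form of [LinftyI]: it speaks of [a] on [0, L] only, and exhibits the bound. *)
Definition multiplier (a : R -> R) : Prop :=
  measurable_fun (`[0, L]%classic : set TR) (a : TR -> R) /\
  exists2 M, 0 <= M & {ae nu, forall x : TR, 0 <= x <= L -> `|a x| <= M}.

Lemma LinftyI_multiplier (a : R -> R) : 0 < L -> LinftyI L a -> multiplier a.
Proof.
move=> L0 /andP[]; rewrite !inE /= => ma fa; split.
  by apply/(measurable_restrictT _ _).2 => //; exact: ma.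
(* The norm in L^infinity is an essential supremum only for a measure of positive total mass, whence
   [L0]. *)
move: fa; rewrite /finite_norm unlock /= interval_setT_gt0// => /ess_supr_bounded[M hM].
exists `|M|; first exact: normr_ge0.
apply: filterS hM => x /= h xI; rewrite (le_trans _ (ler_norm M))//.
by move: h; rewrite patchE mem_set//= in_itv.
Qed.

(** Stated in the extended reals, before square integrability of [f] is known: it then yields both
    that integrability and the norm estimate. *)
Lemma dominated_integral (f : TR -> R) (M : R) u : 0 <= M -> measurable_fun `[0, L] f ->
  {ae nu, forall x : TR, 0 <= x <= L -> `|f x| <= M * `|L2_fun u x|} ->
  (\int[nu]_x (((f \_ `[0%R, L]) x) ^+ 2)%:E <= (M ^+ 2 * hdot u u)%:E)%E.
Proof.
move=> M0 mf fM.
have mg : measurable_fun setT (f \_ `[0, L]) by apply/(measurable_restrictT _ _).1.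
have mu2 : measurable_fun setT (fun x : TR => (L2_fun u x ^+ 2)%:E).
  by apply/measurable_EFinP; apply: measurable_funX; exact: (L2_mfun (mu := nu)).
apply: (@le_trans _ _ (\int[nu]_x ((M ^+ 2)%:E * ((L2_fun u x) ^+ 2)%:E))%E).
  apply: ae_ge0_le_integral => //.
  - by move=> x _; rewrite lee_fin sqr_ge0.
  - by apply/measurable_EFinP; exact: measurable_funX.
  - by move=> x _; rewrite lee_fin mulr_ge0// sqr_ge0.
  - apply/measurable_EFinP; apply: measurable_funM => //; apply: measurable_funX.
    exact: (L2_mfun (mu := nu)).
  apply: filterS fM => x fM _; rewrite lee_fin patchE; case: ifPn => xD.
    rewrite -exprMn -(real_normK (num_real _)) -[leRHS](real_normK (num_real _)).
    rewrite lerXn2r ?nnegrE// normrM (ger0_norm M0); apply: fM.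
    by move: xD; rewrite inE/= in_itv.
  by rewrite expr0n/= mulr_ge0 ?sqr_ge0.
rewrite ge0_integralZl//.
- by rewrite -L2_dotE -EFinM.
- by move=> x _; rewrite lee_fin sqr_ge0.
- by rewrite lee_fin sqr_ge0.
Qed.

Lemma dominated_Lfun (f : TR -> R) (M : R) u : 0 <= M -> measurable_fun `[0, L] f ->
  {ae nu, forall x : TR, 0 <= x <= L -> `|f x| <= M * `|L2_fun u x|} ->
  f \_ `[0, L] \in Lfun nu 2%:E.
Proof.
move=> M0 mf fM; apply: Lfun2_of_sqr; first by apply/(measurable_restrictT _ _).1.
exact: le_lt_trans (dominated_integral M0 mf fM) (ltry _).
Qed.

Lemma dominated_norm (f : TR -> R) (M : R) u : 0 <= M -> measurable_fun `[0, L] f ->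
  {ae nu, forall x : TR, 0 <= x <= L -> `|f x| <= M * `|L2_fun u x|} ->
  `|classI L f| <= M * `|u|.
Proof.
move=> M0 mf fM.
rewrite -(@ler_pXn2r _ 2)// ?nnegrE ?mulr_ge0// exprMn -!hdotxx -lee_fin.
apply: le_trans (dominated_integral M0 mf fM); rewrite [leLHS]L2_dotE le_eqVlt; apply/orP; left; apply/eqP.
have fP := dominated_Lfun M0 mf fM.
apply: ae_eq_integral => //.
- by apply/measurable_EFinP; apply: measurable_funX; exact: (L2_mfun (mu := nu)).
- by apply/measurable_EFinP; apply: measurable_funX; apply/(measurable_restrictT _ _).1.
- by apply: filterS (classIE fP) => x -> _.
Qed.

Lemma multiplier_mul_measurable (a : R -> R) u : multiplier a ->
  measurable_fun `[0, L] ((fun x => a x * L2_fun u x) : TR -> R).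
Proof. by move=> [ma _]; apply: measurable_funM => //; exact: measurable_L2I. Qed.

Lemma mulI_Lfun (a : R -> R) u : multiplier a ->
  ((fun x => a x * L2_fun u x) : TR -> R) \_ `[0, L] \in Lfun nu 2%:E.
Proof.
move=> ha; have [_ [M M0 aM]] := ha.
apply: (dominated_Lfun M0 (multiplier_mul_measurable u ha) (u := u)).
by apply: filterS aM => x aM xI; rewrite normrM ler_wpM2r// aM.
Qed.

Lemma mulI_ae (a : R -> R) u : multiplier a ->
  {ae nu, forall x : TR, L2_fun (mulI a u) x = a x * L2_fun u x}.
Proof. by move=> ha; apply: classIE'; exact: mulI_Lfun. Qed.

Lemma mulI_lin (a : R -> R) (c : R) u v : multiplier a ->
  mulI a (c *: u + v) = c *: mulI a u + mulI a v.
Proof.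
move=> ha; apply: L2I_ext.
apply: (filterS2 _ _ (filterI (mulI_ae u ha) (mulI_ae v ha))
  (filterI (mulI_ae (c *: u + v) ha) (filterI (L2I_lin_ae c u v) (L2I_lin_ae c (mulI a u) (mulI a v))))).
move=> x [e1 e2] [e3 [e4 e5]] _; apply: (etrans e3); apply: (etrans _ (esym e5)).
by rewrite e4 e1 e2; ring.
Qed.

Lemma hdot_mulI (a : R -> R) u v : multiplier a ->
  hdot (mulI a u) v = integralI L (fun x : TR => a x * L2_fun u x * L2_fun v x).
Proof.
move=> ha; have [ma _] := ha; rewrite hdotE; apply: integralI_ae.
- by apply: measurable_funM; exact: measurable_L2I.
- apply: measurable_funM; last exact: measurable_L2I.
  by apply: measurable_funM => //; exact: measurable_L2I.
by apply: filterS (mulI_ae u ha) => x -> _.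
Qed.

Lemma mulI_sym (a : R -> R) u v : multiplier a -> hdot (mulI a u) v = hdot u (mulI a v).
Proof.
move=> ha; rewrite (hdotC u) !hdot_mulI//; apply: eq_Rintegral => x _; ring.
Qed.

Lemma mul_integrableI (a : R -> R) u v : multiplier a ->
  mu.-integrable `[0, L] (EFin \o (fun x : TR => a x * L2_fun u x * L2_fun v x)).
Proof.
move=> ha; have [ma _] := ha.
have h := L2_mul_integrableI (mulI a u) v.
have m1 : measurable_fun `[0, L] (fun x : TR => a x * L2_fun u x * L2_fun v x).
  apply: measurable_funM; last exact: measurable_L2I.
  by apply: measurable_funM => //; exact: measurable_L2I.
apply/integrableP; split; first exact/measurable_EFinP.
have /integrableP[mh] := h; congr (_ < _)%E; apply: ae_eq_integral => //.
- by apply: measurableT_comp.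
- by apply: measurableT_comp => //; apply/measurable_EFinP.
have [N [mN N0 hN]] := mulI_ae u ha.
exists (N `&` `[0, L]); split => //.
- by apply: measurableI.
move=> x /=; rewrite in_itv/= => h'; split.
  by apply: hN => /= h1; apply: h' => h2; rewrite h1.
by apply: contrapT => h1; apply: h'.
Qed.

Lemma mulI_bounded (a : R -> R) : multiplier a ->
  exists2 M, 0 <= M & forall u, `|mulI a u| <= M * `|u|.
Proof.
move=> ha; have [ma [M M0 aM]] := ha; exists M => // u.
apply: dominated_norm => //; first exact: multiplier_mul_measurable.
by apply: filterS aM => x aM xI; rewrite normrM ler_wpM2r// aM.
Qed.

Lemma multiplier_one : multiplier (cst 1).
Proof. by split=> //; exists 1 => //; apply: nearW => x _; rewrite normr1. Qed.

Lemma classI_one_ae : {ae nu, forall x : TR, L2_fun (classI L (cst 1)) x = 1}.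
Proof. by apply: classIE'; apply: (@bounded_Lfun _ 1) => // x _; rewrite normr1. Qed.

Lemma classI_ae (a : R -> R) : multiplier a ->
  {ae nu, forall x : TR, L2_fun (classI L a) x = a x}.
Proof.
(* A bounded function is dominated by a multiple of the constant 1, which is in L^2 of the
   interval. *)
move=> [ma [M M0 aM]]; apply: classIE'; apply: (dominated_Lfun M0 ma (u := classI L (cst 1))).
by apply: (filterS2 _ _ aM classI_one_ae) => x aM' -> /aM'; rewrite normr1 mulr1.
Qed.

Lemma hdot_classI_mul (a : R -> R) u : multiplier a ->
  hdot (classI L a) u = integralI L (fun x : TR => a x * L2_fun u x).
Proof.
move=> ha; rewrite hdotE; apply: integralI_ae.
- by apply: measurable_funM; exact: measurable_L2I.
- exact: multiplier_mul_measurable.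
by apply: filterS (classI_ae ha) => x -> _.
Qed.

Lemma integralI_hdot u : integralI L (L2_fun u) = hdot (classI L (cst 1)) u.
Proof.
rewrite hdot_classI_mul; last exact: multiplier_one.
by apply: eq_Rintegral => x _; rewrite mul1r.
Qed.

(** With [a = rho] and the effort [rho^-1 p_b], this identifies the coupling flow f_d with the
    integral of p_b. *)
Lemma integralI_mul_inv (a : R -> R) u : multiplier a -> multiplier (fun x => (a x)^-1) ->
  {ae nu, forall x : TR, 0 <= x <= L -> a x != 0} ->
  integralI L (fun x : TR => a x * L2_fun (mulI (fun x => (a x)^-1) u) x) = integralI L (L2_fun u).
Proof.
move=> ha hV a0; apply: integralI_ae.
- exact: multiplier_mul_measurable.
- exact: measurable_L2I.
apply: (filterS2 _ _ (mulI_ae u hV) a0) => x -> h xI.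
by rewrite mulrA divff ?mul1r// h.
Qed.

Lemma uniformly_positive_neq0 (a : R -> R) : uniformly_positive L a ->
  {ae nu, forall x : TR, 0 <= x <= L -> a x != 0}.
Proof.
move=> [c c0 [N [mN N0 hN]]]; exists N; split => // x /= h; apply: hN => /= h'.
by apply: h => xI; rewrite gt_eqF// (lt_le_trans c0)// h'// in_itv.
Qed.

End interval.

(** * Dirac structures and their interconnection *)

Section inner_products.
Context {R : realType}.

Lemma hdot_pair (U V : hilbertType R) (x y : U \oplus V) :
  hdot x y = hdot x.1 y.1 + hdot x.2 y.2.
Proof. by []. Qed.

Lemma hdot_real (x y : R^o) : hdot x y = (x : R) * (y : R) :> R.
Proof. by []. Qed.

Lemma hdot_euc n (x y : euc R n) : hdot x y = \sum_i x i 0 * y i 0.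
Proof. by []. Qed.

Lemma hdot_euc2 (x y : euc R 2) :
  hdot x y = x 0 0 * y 0 0 + x 1 0 * y 1 0.
Proof.
rewrite hdot_euc !big_ord_recl big_ord0 addr0.
by congr (_ * _ + _ * _); congr (_ _ _); apply: val_inj.
Qed.

Lemma hdot_adj m n (A : 'M[R]_(m, n)) (x : euc R n) (y : euc R m) :
  hdot (A *m x : euc R m) y = hdot x (A^T *m y : euc R n).
Proof.
rewrite !hdot_euc.
transitivity (\sum_i \sum_j A i j * x j 0 * y i 0).
  by apply: eq_bigr => i _; rewrite mxE mulr_suml.
rewrite exchange_big; apply: eq_bigr => j _; rewrite mxE mulr_sumr.
by apply: eq_bigr => i _; rewrite mxE; ring.
Qed.

Lemma euc_riesz n (f : euc R n -> R) :
  (forall (c : R) x y, f (c *: x + y) = c * f x + f y) ->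
  exists v : euc R n, forall x, f x = hdot v x.
Proof.
move=> flin.
have f0 : f 0 = 0 by have := flin 1 0 0; rewrite scaler0 addr0; lra.
have fD x y : f (x + y) = f x + f y by have := flin 1 x y; rewrite scale1r mul1r.
have fZ c x : f (c *: x) = c * f x by have := flin c x 0; rewrite !addr0 f0 addr0.
exists (\col_i f (delta_mx i 0 : 'cV[R]_n)) => x.
have -> : x = \sum_i x i 0 *: (delta_mx i 0 : 'cV[R]_n) :> 'cV[R]_n.
  rewrite [LHS](matrix_sum_delta (x : 'cV[R]_n)); apply: eq_bigr => i _.
  by rewrite big_ord1.
rewrite (big_morph f fD f0) hdot_euc; apply: eq_bigr => i _.
rewrite fZ mxE mulrC; congr (_ * _).
rewrite summxE (bigD1 i)//= big1 ?addr0; last first.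
  by move=> j ji; rewrite !mxE eq_sym (negbTE ji) andFb mulr0.
by rewrite !mxE !eqxx mulr1.
Qed.

End inner_products.

Section dirac.
Context {R : realType}.

Lemma power_pairing_linl (Z : hilbertType R) (c : R) (z z' w : Z \oplus Z) :
  power_pairing (c *: z + z') w = c * power_pairing z w + power_pairing z' w.
Proof.
rewrite /power_pairing /= !hdotDl hdotZl !hdotDr hdotZr; ring.
Qed.

Section dirac_facts.
Context {Z : hilbertType R} (D : set (Z \oplus Z)).
Hypothesis DD : dirac_structure D.

Lemma dirac_isotropic z w : D z -> D w -> power_pairing z w = 0.
Proof. by rewrite {1}DD => h Dw; apply: h. Qed.

Lemma dirac_coisotropic z : (forall m, D m -> power_pairing z m = 0) -> D z.
Proof. by move=> h; rewrite DD. Qed.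

Lemma dirac_lin (c : R) z w : D z -> D w -> D (c *: z + w).
Proof.
move=> Dz Dw; apply: dirac_coisotropic => m Dm.
by rewrite power_pairing_linl !dirac_isotropic// mulr0 addr0.
Qed.

Lemma dirac0 : D 0.
Proof.
by apply: dirac_coisotropic => m _; rewrite /power_pairing/= hdot0l hdot0r addr0.
Qed.

(** A bijection preserving the power pairing carries orthogonals to orthogonals. It is applied to
    the shear [U_f] and to the permutation [Pi]. *)
Lemma dirac_image (Z' : hilbertType R) (phi : Z \oplus Z -> Z' \oplus Z') (psi : Z' \oplus Z' -> Z \oplus Z) :
  cancel phi psi -> cancel psi phi ->
  (forall z w, power_pairing (phi z) (phi w) = power_pairing z w) ->
  dirac_structure (phi @` D).
Proof.
move=> pK qK pp; apply/seteqP; split => [_ [z Dz <-] _ [w Dw <-]|z h].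
  by rewrite pp dirac_isotropic.
exists (psi z) => //; apply: dirac_coisotropic => m Dm.
by rewrite -pp qK; apply: h; exists m.
Qed.
End dirac_facts.

Lemma diracP (Z : hilbertType R) (D : set (Z \oplus Z)) :
  (forall z w, D z -> D w -> power_pairing z w = 0) ->
  (forall z, (forall m, D m -> power_pairing z m = 0) -> D z) -> dirac_structure D.
Proof. by move=> h1 h2; apply/seteqP; split => [z Dz m Dm|z]; [exact: h1|exact: h2]. Qed.

Lemma subr_rearrange (V : zmodType) (a b c d : V) : a - b = c - d -> - a + c = - b + d.
Proof. by move=> h; rewrite -[c](subrK d) -h !addrA addNr add0r. Qed.

Lemma addr_rearrange (V : zmodType) (a b c d : V) : a + b = c + d -> - a + c = - (- b + d).
Proof. by move=> h; rewrite -[c](addrK d) -h opprD opprK !addrA addNr add0r. Qed.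

(* Pairing a member of the orthogonal with pairs (d1, d2) gives a functional
   [phi] that vanishes on the kernel of the coupling map, hence factors through it
   as [l]; the Riesz representatives of [l] are the missing coupling variables. *)
Lemma dirac_interconnection (X1 X2 : Type) (Z1 Z2 : hilbertType R) n
    (D1 : X1 -> set ((Z1 \oplus euc R n) \oplus (Z1 \oplus euc R n)))
    (D2 : X2 -> set ((Z2 \oplus euc R n) \oplus (Z2 \oplus euc R n))) (x : X1 * X2) :
  dirac_structure (D1 x.1) -> dirac_structure (D2 x.2) ->
  (forall a b : euc R n, exists d1 d2, [/\ D1 x.1 d1, D2 x.2 d2,
     d1.1.2 - d2.1.2 = a & d1.2.2 + d2.2.2 = b]) ->
  dirac_structure (interconnection D1 D2 x).
Proof.
move=> DD1 DD2 surj; apply: diracP.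
  move=> [[f1 f2] [e1 e2]] [[g1 g2] [h1 h2]] [fc [ec [z1 z2]]] [gc [hc [w1 w2]]].
  (* The coupling efforts enter the two structures with opposite signs, so the coupling terms cancel
     in the sum. *)
  have := dirac_isotropic DD1 z1 w1; have := dirac_isotropic DD2 z2 w2.
  by rewrite /power_pairing /= !hdot_pair /= !hdotNr; lra.
move=> [[f1 f2] [e1 e2]] orth.
pose phi (d1 : (Z1 \oplus euc R n) \oplus (Z1 \oplus euc R n))
  (d2 : (Z2 \oplus euc R n) \oplus (Z2 \oplus euc R n)) :=
  hdot f1 d1.2.1 + hdot d1.1.1 e1 + (hdot f2 d2.2.1 + hdot d2.1.1 e2).
have phi_lin c d1 d2 d1' d2' : phi (c *: d1 + d1') (c *: d2 + d2') = c * phi d1 d2 + phi d1' d2'.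
  rewrite /phi /= !hdotDl !hdotDr !hdotZl !hdotZr; ring.
have phi0 d1 d2 : D1 x.1 d1 -> D2 x.2 d2 -> d1.1.2 = d2.1.2 -> d1.2.2 = - d2.2.2 -> phi d1 d2 = 0.
  move: d1 d2 => [[g1 gc] [h1 hc]] [[g2 gc'] [h2 hc']] /= z1 z2 E1 E2; subst.
  have := orth ((g1, g2), (h1, h2)).
  rewrite /phi /power_pairing /= !hdot_pair /= => <-; last first.
    by exists gc', (- hc'); rewrite opprK.
  ring.
have [s1 hs1] := choice (fun y : euc R n * euc R n => surj y.1 y.2).
have [s2 hs2] := choice hs1.
pose l (y : euc R n * euc R n) := phi (s1 y) (s2 y).
have phi_l d1 d2 : D1 x.1 d1 -> D2 x.2 d2 -> phi d1 d2 = l (d1.1.2 - d2.1.2, d1.2.2 + d2.2.2).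
  move=> h1 h2; set y := (_, _); have [y1 y2 ya yb] := hs2 y.
  have : phi ((-1) *: s1 y + d1) ((-1) *: s2 y + d2) = 0.
    apply: phi0; [exact: dirac_lin|exact: dirac_lin| |].
      by rewrite /= !scaleN1r; exact: subr_rearrange.
    by rewrite /= !scaleN1r; exact: addr_rearrange.
  by rewrite phi_lin; rewrite /l; lra.
(* The chosen preimages [s1], [s2] need not be linear in [y]; linearity of [l] holds because [phi_l]
   allows any preimage. *)
have l_lin c y y' : l (c *: y.1 + y'.1, c *: y.2 + y'.2) = c * l y + l y'.
  have [y1 y2 ya yb] := hs2 y; have [y1' y2' ya' yb'] := hs2 y'.
  rewrite -phi_lin phi_l; [|exact: dirac_lin|exact: dirac_lin].
  congr (l (_, _)) => /=.
    by rewrite -ya -ya' scalerBr opprD addrACA.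
  by rewrite -yb -yb' scalerDr addrACA.
have [u hu] := @euc_riesz _ _ (fun a => l (a, 0)) (fun c a b => etrans (congr1 (fun z => l (_, z)) (esym (etrans (addr0 _) (scaler0 _ c)))) (l_lin c (a, 0) (b, 0))).
have [v hv] := @euc_riesz _ _ (fun a => l (0, a)) (fun c a b => etrans (congr1 (fun z => l (z, _)) (esym (etrans (addr0 _) (scaler0 _ c)))) (l_lin c (0, a) (0, b))).
have {l_lin}lE a b : l (a, b) = hdot u a + hdot v b.
  rewrite -hu -hv; have := l_lin 1 (a, 0) (0, b).
  by rewrite /= !scale1r addr0 add0r mul1r.
(* On pairs [(d1, 0)] the functional [phi] is [hdot u] of the coupling flow plus [hdot v] of the
   coupling effort. The power pairing crosses flows and efforts, hence flow [- v] and effort [- u];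
   pairs [(0, d2)] flip the sign of [u], as the interconnection demands. *)
exists (- v), (- u); split.
  apply: (dirac_coisotropic DD1) => -[[g gc] [h hc]] m.
  have := phi_l _ _ m (dirac0 DD2).
  rewrite lE /phi /power_pairing /= !hdot_pair /= !hdot0l !hdot0r !hdotNl !hdotNr.
  rewrite !subr0 !addr0 (hdotC gc); lra.
apply: (dirac_coisotropic DD2) => -[[g gc] [h hc]] m.
have := phi_l _ _ (dirac0 DD1) m.
rewrite lE /phi /power_pairing /= !hdot_pair /= !hdot0l !hdot0r opprK !hdotNl.
rewrite !sub0r !add0r hdotNr (hdotC gc); lra.
Qed.

End dirac.

(** * The frame (t, n) and the matrices built from it *)

Section frame.
Context {R : realType}.
Implicit Types zeta : euc R 4.

Lemma vec3_col (a b c : R) : vec 3 [:: a; b; c] =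
  col_mx (a%:M : 'M[R]_1) (col_mx (b%:M : 'M[R]_1) (c%:M : 'M[R]_1)) :> 'cV[R]_(1 + (1 + 1)).
Proof.
apply/matrixP => i j; rewrite (ord1 j) mxE.
case: (@splitP 1 2 i) => k ik.
  have -> : i = lshift 2 k by apply: val_inj.
  by rewrite col_mxEu (ord1 k) [RHS]mxE.
have -> : i = rshift 1 k by apply: val_inj.
rewrite col_mxEd; case: (@splitP 1 1 k) ik => l kl ik.
  have -> : k = lshift 1 l by apply: val_inj.
  by rewrite col_mxEu (ord1 l) [RHS]mxE.
have -> : k = rshift 1 l by apply: val_inj.
by rewrite col_mxEd (ord1 l) [RHS]mxE.
Qed.

Lemma Zmx_vec zeta (a b c : R) : Zmx zeta *m vec 3 [:: a; b; c] =
  col_mx (a *: (tvec zeta : euc R 2) + b *: (nvec zeta : euc R 2))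
         (a *: (tvec zeta : euc R 2) + c *: (nvec zeta : euc R 2)).
Proof.
have -> : Zmx zeta *m vec 3 [:: a; b; c] =
    (col_mx (row_mx (tvec zeta) (row_mx (nvec zeta) 0))
       (row_mx (tvec zeta) (row_mx 0 (nvec zeta))) : 'M[R]_(2 + 2, 1 + (1 + 1))) *m
    (col_mx a%:M (col_mx b%:M c%:M) : 'cV[R]_(1 + (1 + 1))) :> 'cV[R]_(2 + 2).
  by rewrite -vec3_col.
by rewrite mul_col_mx !mul_row_col !mul0mx !mul_mx_scalar addr0 add0r.
Qed.

Lemma tr_mul_hdot n (x y : 'cV[R]_n) : x^T *m y = (hdot (x : euc R n) (y : euc R n))%:M.
Proof.
apply/matrixP => i j; rewrite (ord1 i) (ord1 j) mxE [RHS]mxE eqxx mulr1n hdot_euc.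
by apply: eq_bigr => k _; rewrite mxE.
Qed.

Lemma Bext_col zeta (u v : euc R 2) : Bext zeta *m col_mx u v =
  vec 3 [:: hdot (tvec zeta : euc R 2) u + hdot (tvec zeta : euc R 2) v;
            hdot (nvec zeta : euc R 2) u; hdot (nvec zeta : euc R 2) v].
Proof.
rewrite vec3_col.
have -> : Bext zeta *m col_mx u v =
    (col_mx (row_mx (tvec zeta)^T (tvec zeta)^T)
       (col_mx (row_mx (nvec zeta)^T 0) (row_mx 0 (nvec zeta)^T)) : 'M[R]_(1 + (1 + 1), 2 + 2)) *m
    (col_mx (u : 'cV[R]_2) (v : 'cV[R]_2) : 'cV[R]_(2 + 2)) :> 'cV[R]_(1 + (1 + 1)) by [].
by rewrite !mul_col_mx !mul_row_col !mul0mx !tr_mul_hdot addr0 add0r raddfD.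
Qed.

Lemma Zmx_Bext zeta : Zmx zeta = (Bext zeta)^T.
Proof.
have -> : (Bext zeta)^T =
    (col_mx (row_mx (tvec zeta)^T (tvec zeta)^T)
       (col_mx (row_mx (nvec zeta)^T 0) (row_mx 0 (nvec zeta)^T)) : 'M[R]_(1 + (1 + 1), 2 + 2))^T
    :> 'M[R]_(2 + 2, 1 + (1 + 1)) by [].
have -> : Zmx zeta = (col_mx (row_mx (tvec zeta) (row_mx (nvec zeta) 0))
       (row_mx (tvec zeta) (row_mx 0 (nvec zeta))) : 'M[R]_(2 + 2, 1 + (1 + 1))) by [].
rewrite !tr_col_mx !tr_row_mx !trmxK !trmx0.
rewrite -(block_mxEh (nvec zeta) 0 0 (nvec zeta)).
exact: (block_mxEh (tvec zeta) (row_mx (nvec zeta) 0) (tvec zeta) (row_mx 0 (nvec zeta))).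
Qed.

Lemma hdot_J (x : euc R 2) : (hdot (J *m x : euc R 2) x = 0) * (hdot (J *m x : euc R 2) (J *m x : euc R 2) = hdot x x).
Proof.
by split; rewrite !hdot_euc2 /J /mx_rows !mxE !big_ord_recl !big_ord0 !mxE /= (_ : lift ord0 ord0 = 1); [ring|exact: val_inj|ring|exact: val_inj].
Qed.

Lemma len_gt0 zeta : U_pos zeta -> 0 < len zeta.
Proof. by move=> h; rewrite /len normr_gt0 subr_eq0 eq_sym; apply/eqP. Qed.

Lemma frame zeta : U_pos zeta ->
  [/\ hdot (tvec zeta : euc R 2) (tvec zeta : euc R 2) = 1,
      hdot (nvec zeta : euc R 2) (nvec zeta : euc R 2) = 1 &
      hdot (nvec zeta : euc R 2) (tvec zeta : euc R 2) = 0].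
Proof.
move=> /len_gt0 l0.
have tt : hdot (tvec zeta : euc R 2) (tvec zeta : euc R 2) = 1.
  rewrite /tvec hdotZl hdotZr hdotxx -/(len zeta) expr2 mulKf ?gt_eqF// mulVf// gt_eqF//.
by rewrite /nvec !hdot_J tt.
Qed.
End frame.

(** * The two subsystems *)

Section subsystems.
Context {R : realType} (L : R) (rho : R -> R).

Lemma hdot_euc4 (x y : euc R 4) :
  hdot x y = cd x * cd y + ct x * ct y + cn0 x * cn0 y + cnf x * cnf y.
Proof.
rewrite hdot_euc !big_ord_recl big_ord0 addr0 !addrA /cd /ct /cn0 /cnf.
by congr (_ * _ + _ * _ + _ * _ + _ * _); congr (_ _ _); apply: val_inj.
Qed.

Lemma vec2E (a b : R) : (vec 2 [:: a; b] 0 0 = a) * (vec 2 [:: a; b] 1 0 = b).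
Proof. by rewrite /vec !mxE. Qed.

Lemma vec2_eta (x : 'cV[R]_2) : x = vec 2 [:: x 0 0; x 1 0].
Proof.
apply/matrixP => -[[|[|//]] ?] j; rewrite (ord1 j) !mxE /=; congr (x _ _); exact: val_inj.
Qed.

(** The components (t, n0, nf) of a coupling variable, without d. By [hdot_lower] this is the
    adjoint of [col_mx 0]. *)
Definition lower (x : euc R 4) : euc R 3 := dsubmx (x : 'cV[R]_(1 + 3)).

Lemma lowerE (x : euc R 4) : lower x = vec 3 [:: ct x; cn0 x; cnf x].
Proof.
apply/matrixP => -[[|[|[|//]]] ?] j; rewrite (ord1 j) !mxE /=; congr (x _ _); exact: val_inj.
Qed.

Lemma hdot_lower (x : euc R 4) (y : euc R 3) :
  hdot x (col_mx 0 y : 'cV[R]_(1 + 3)) = hdot (lower x) y.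
Proof.
have e0 : (col_mx 0 y : 'cV[R]_(1 + 3)) (ord0 : 'I_4) 0 = 0.
  by rewrite mxE; case: splitP => [j _|//]; rewrite mxE.
rewrite !hdot_euc big_ord_recl e0 mulr0 add0r.
apply: eq_bigr => i _; rewrite !mxE; congr (x _ _ * _); first exact: val_inj.
case: splitP => [j|j]; first by move: (ltn_ord j) => /[swap] /= <-; rewrite /bump.
by rewrite /= /bump /= => /addnI ij; congr (y _ _); apply: val_inj.
Qed.

Lemma K_r_skew p : (K_r L rho p)^T = - K_r L rho p.
Proof.
apply/matrixP => -[[|[|[|[|//]]]] ?] [[|[|[|[|//]]]] ?]; rewrite !mxE /=; ring.
Qed.

Lemma K_f_skew (x : Zf_store L) : (K_f x)^T = - K_f x.
Proof.
apply/matrixP => -[[|[|[|[|//]]]] ?] [[|[|[|[|//]]]] ?]; rewrite !mxE /=; ring.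
Qed.

Lemma hdot_skew n (K : 'M[R]_n) (x y : euc R n) : K^T = - K ->
  hdot x (K *m y : euc R n) = - hdot y (K *m x : euc R n).
Proof. by move=> KT; rewrite hdotC hdot_adj KT mulNmx hdotNr. Qed.

Definition D_r_ebar (x : Zr_store R) (fp : R) (eq eext : euc R 4) : euc R 3 :=
  - ((Zmx x.1)^T *m eq + vec 3 [:: fp; 0; 0] + Bext x.1 *m eext).

(** Since f_t = e_p, the vector v_r is [lower fc], and the balance determines [ebar]. Hence [D_r] is
    a graph: e_q, e_ext, f_p and f_c are free and determine all other variables. *)
Lemma D_rP (x : Zr_store R) fq fp fext fc eq ep eext ec :
  D_r L rho x ((((fq, fp), fext), fc), (((eq, ep), eext), ec)) <->
  [/\ fq = Zmx x.1 *m lower fc, fext = (Bext x.1)^T *m lower fc, ct fc = ep &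
      ec = (col_mx 0 (D_r_ebar x fp eq eext) : 'cV[R]_(1 + 3)) + K_r L rho x.2 *m fc].
Proof.
rewrite /D_r /=; split => [[ebar [-> -> <- h0 ->]]|[-> -> <- ->]].
  have -> : ebar = D_r_ebar x fp eq eext.
    by apply/eqP; rewrite /D_r_ebar -subr_eq0 opprK addrC -h0.
  by split; rewrite -?lowerE.
exists (D_r_ebar x fp eq eext); split; rewrite -?lowerE//.
by rewrite /D_r_ebar subrr.
Qed.

Lemma hdot_vec3 (a : R) (y : euc R 4) : hdot (lower y) (vec 3 [:: a; 0; 0] : euc R 3) = a * ct y.
Proof. by rewrite lowerE hdot_euc !big_ord_recl big_ord0 !mxE /=; ring. Qed.

Lemma D_r_dirac (x : Zr_store R) : dirac_structure (D_r L rho x).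
Proof.
have ebarE w fp eq eext : hdot w (D_r_ebar x fp eq eext) =
   - (hdot (Zmx x.1 *m w : euc R 4) eq + hdot w (vec 3 [:: fp; 0; 0] : euc R 3)
     + hdot ((Bext x.1)^T *m w : euc R 4) eext).
  by rewrite /D_r_ebar hdotNr !hdotDr !hdot_adj trmxK.
apply: diracP.
  move=> [[[[fq fp] fext] fc] [[[eq ep] eext] ec]] [[[[gq gp] gext] gc] [[[hq hp] hext] hc]].
  move=> /D_rP[-> -> <- ->] /D_rP[-> -> <- ->].
  rewrite /power_pairing !hdot_pair /= !hdotDr !hdot_lower !ebarE !hdot_vec3 !hdot_real.
  rewrite (hdot_skew _ _ (K_r_skew x.2)).
  ring.
move=> [[[[fq fp] fext] fc] [[[eq ep] eext] ec]] orth.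
(* The four arguments are the free variables of the graph; testing with a single nonzero one yields
   one equation of [D_rP] each time. *)
have {}orth eq' eext' fp' fc' : _ := orth _ (proj2 (@D_rP x _ fp' _ fc' eq' _ eext' _) (And4 erefl erefl erefl erefl)).
move: orth; rewrite /power_pairing => orth.
have l0 : lower 0 = 0 by rewrite /lower linear0.
have ct0 : ct 0 = 0 :> R by rewrite /ct mxE.
have fqE : fq = Zmx x.1 *m lower fc.
  apply: (@hdot_inj _ (euc R 4)) => y; have := orth y 0 0 0.
  rewrite !hdot_pair /= !hdotDr !hdot_lower !ebarE hdot_vec3.
  rewrite ?hdot_real l0 ct0 !mulmx0 !hdot0l !hdot0r.
  rewrite ?(mulr0, mul0r, mulr1, mul1r, addr0, add0r); lra.
have fextE : fext = (Bext x.1)^T *m lower fc.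
  apply: (@hdot_inj _ (euc R 4)) => y; have := orth 0 y 0 0.
  rewrite !hdot_pair /= !hdotDr !hdot_lower !ebarE hdot_vec3.
  rewrite ?hdot_real l0 ct0 !mulmx0 !hdot0l !hdot0r.
  rewrite ?(mulr0, mul0r, mulr1, mul1r, addr0, add0r); lra.
have epE : ct fc = ep.
  have := orth 0 0 1 0.
  rewrite !hdot_pair /= !hdotDr !hdot_lower !ebarE hdot_vec3 !hdot_real.
  rewrite ?hdot_real l0 ct0 !mulmx0 !hdot0l !hdot0r.
  rewrite ?(mulr0, mul0r, mulr1, mul1r, addr0, add0r); lra.
apply/D_rP; split => //.
apply: (@hdot_inj _ (euc R 4)) => y; have := orth 0 0 0 y.
rewrite !hdot_pair /= !hdotDr !hdot_lower !ebarE hdot_vec3 !hdot_real.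
rewrite !hdot0r hdotDl ![in X in _ -> _ = X](hdotC _ y) hdot_lower ebarE hdot_vec3.
rewrite (hdot_skew _ _ (K_r_skew x.2)) (hdotC ec).
rewrite ?(mulr0, mul0r, addr0, add0r, oppr0); lra.
Qed.

Hypothesis L_gt0 : 0 < L.
Hypothesis rho_mult : multiplier L rho.
Let L_ge0 : 0 <= L. Proof. exact: ltW. Qed.

(** A witness with known zero data for the class 0, from [H2_weak]; it allows test elements in which
    e_kappa or e_p vanishes. *)
Lemma H2_zero : exists h : H2 (0 : L2I L),
  [/\ h2'' h = 0, h2 h 0 = 0, h2' h 0 = 0, h2 h L = 0 & h2' h L = 0].
Proof.
apply: (H2_weak L_ge0) => u hu; rewrite !hdot0l; ring.
Qed.

Lemma vec4E (a b c d : R) : (cd (vec 4 [:: a; b; c; d]) = a) * (ct (vec 4 [:: a; b; c; d]) = b) *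
  (cn0 (vec 4 [:: a; b; c; d]) = c) * (cnf (vec 4 [:: a; b; c; d]) = d).
Proof. by rewrite /cd /ct /cn0 /cnf /vec !mxE. Qed.

Lemma D_f0_dirac : dirac_structure (D_f0 L rho).
Proof.
have rhoE (u : L2I L) : integralI L (fun xi => rho xi * L2_fun u xi) = hdot (classI L rho) u.
  by rewrite hdot_classI_mul.
apply: diracP.
  move=> [[[[fk fp] fM] fc] [[[ek ep] eM] ec]] [[[[gk gp] gM] gc] [[[kk kp] kM] kc]].
  move=> [hk [hp [[-> -> cdE ctE] [[n0 n0e nf nfe] [-> ->]]]]].
  move=> [hk' [hp' [[-> -> cdE' ctE'] [[n0' n0e' nf' nfe'] [-> ->]]]]].
  rewrite /power_pairing !hdot_pair /= !hdot_euc4 !hdot_euc2 !vec2E.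
  rewrite cdE cdE' ctE ctE' n0 n0' n0e n0e' nf nf' nfe nfe' !rhoE.
  (* The boundary terms of the two Green formulas cancel against the force and moment ports, and the
     terms in [rho * e_d] against f_d. *)
  have := H2_green L_ge0 hp hk'; have := H2_green L_ge0 hp' hk.
  rewrite !hdotDl !hdotNl !hdotZl (hdotC ep) (hdotC kp).
  lra.
move=> [[[[fk fp] fM] fc] [[[ek ep] eM] ec]] orth.
have [h0 [z2 za zb zc zd]] := H2_zero.
(* Orthogonality to the general element of [D_f0], whose free data are e_kappa = [uk], e_p = [up],
   e_d = [d] and f_t = [t]. *)
have key (uk up : L2I L) (hk : H2 uk) (hp : H2 up) (d t : R) :
    hdot fk uk + hdot fp up + (fM 0 0 * h2 hk 0 - fM 1 0 * h2 hk L) +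
    (cd fc * d - cn0 fc * h2' hk 0 + cnf fc * h2' hk L) +
    (hdot (h2'' hp) ek - hdot (h2'' hk) ep - d * hdot (classI L rho) ep +
      (h2' hp 0 * eM 0 0 + h2' hp L * eM 1 0)) +
    (hdot (classI L rho) up * cd ec + t * ct ec + h2 hp 0 * cn0 ec + h2 hp L * cnf ec) = 0.
  have := orth ((((h2'' hp, - h2'' hk - d *: classI L rho), vec 2 [:: h2' hp 0; h2' hp L]),
      vec 4 [:: hdot (classI L rho) up; t; h2 hp 0; h2 hp L]),
    (((uk, up), vec 2 [:: h2 hk 0; - h2 hk L]), vec 4 [:: d; 0; - h2' hk 0; h2' hk L])).
  rewrite /power_pairing !hdot_pair /= !hdot_euc4 !hdot_euc2 !vec4E !vec2E hdotBl hdotNl hdotZl.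
  move=> h; rewrite -[RHS]h; first ring.
  by exists hk, hp; rewrite rhoE.
have cdE : cd fc = hdot (classI L rho) ep.
  have := key _ _ h0 h0 1 0; rewrite z2 za zb zc zd !hdot0l !hdot0r; lra.
have ctE : ct ec = 0.
  have := key _ _ h0 h0 0 1; rewrite z2 za zb zc zd !hdot0l !hdot0r; lra.
(* Varying e_kappa alone gives the weak form of [f_kappa = e_p'']; varying e_p alone gives that of
   the equation for f_p. *)
have [hp [hp2 hp0 hp0' hpL hpL']] : exists hp : H2 ep,
   [/\ h2'' hp = fk, h2 hp 0 = cn0 fc, h2' hp 0 = fM 0 0, h2 hp L = cnf fc & h2' hp L = fM 1 0].
  apply: (H2_weak L_ge0) => u hu; have := key _ _ hu h0 0 0.
  rewrite z2 za zb zc zd !hdot0l !hdot0r (hdotC ep); lra.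
have [hk [hk2 hk0 hk0' hkL hkL']] : exists hk : H2 ek,
   [/\ h2'' hk = - (fp + cd ec *: classI L rho), h2 hk 0 = eM 0 0, h2' hk 0 = - cn0 ec,
     h2 hk L = - eM 1 0 & h2' hk L = cnf ec].
  apply: (H2_weak L_ge0) => u hu; have := key _ _ h0 hu 0 0.
  rewrite z2 za zb zc zd !hdot0l !hdot0r hdotNl hdotDl hdotZl (hdotC ek); lra.
exists hk, hp; rewrite hk2 hp2 hp0 hp0' hpL hpL' hk0 hk0' hkL hkL' rhoE !opprK addrK.
by rewrite -!vec2_eta.
Qed.

(** [U_f] is a shear of efforts along flows, invertible by changing the sign of [K_f], and it
    preserves the power pairing because [K_f] is skew. *)
Lemma D_f_dirac (x : Zf_store L) : dirac_structure (D_f L rho x).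
Proof.
pose V (d : (Zf L \oplus Zc R) \oplus (Zf L \oplus Zc R)) : (Zf L \oplus Zc R) \oplus (Zf L \oplus Zc R) :=
  let: ((f, fc), (e, ec)) := d in ((f, fc), (e, ec - K_f x *m fc)).
apply: (dirac_image D_f0_dirac (psi := V)).
- by move=> [[f fc] [e ec]]; rewrite /U_f /V addrK.
- by move=> [[f fc] [e ec]]; rewrite /U_f /V subrK.
move=> [[f fc] [e ec]] [[g gc] [h hc]].
rewrite /U_f /power_pairing !hdot_pair /= !hdotDr (hdot_skew _ _ (K_f_skew x)); ring.
Qed.

Lemma D_fP (x : Zf_store L) f fc e ec :
  D_f L rho x ((f, fc), (e, ec)) <-> D_f0 L rho ((f, fc), (e, ec - K_f x *m fc)).
Proof.
split=> [[[[f' fc'] [e' ec']] d [<- <- <- <-]]|d]; first by rewrite addrK.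
by exists ((f, fc), (e, ec - K_f x *m fc)) => //=; rewrite subrK.
Qed.

Lemma Bext_Zmx zeta (a b c : R) : U_pos zeta ->
  Bext zeta *m (Zmx zeta *m vec 3 [:: a; b; c]) = vec 3 [:: a + a; b; c].
Proof.
move=> /frame[tt nn nt].
rewrite Zmx_vec Bext_col; move: (tvec zeta : euc R 2) (nvec zeta : euc R 2) tt nn nt => t n tt nn nt.
rewrite !hdotDr !hdotZr tt nn nt (hdotC t) nt.
by rewrite !mulr1 !mulr0 !addr0 !add0r.
Qed.

Lemma col_cd (x : euc R 4) : x - vec 4 [:: cd x; 0; 0; 0] = (col_mx 0 (lower x) : 'cV[R]_(1 + 3)).
Proof.
apply: (@hdot_inj _ (euc R 4)) => y; rewrite [RHS]hdotC hdot_lower hdotBl !hdot_euc4 !vec4E !lowerE.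
by rewrite hdot_euc !big_ord_recl big_ord0 !mxE /=; ring.
Qed.

(* The free effort e_d supplies the d-component of the target effort; the other
   three are reached by f_p and e_ext, because Bext *m Zmx = diag (2, 1, 1). *)
Lemma Gamma_surj (xr : Zr_store R) (xf : Zf_store L) : X_r xr ->
  set_surj (D_r L rho xr `*` D_f L rho xf) setT (Gamma L).
Proof.
move=> Xr [a b] _.
have [h0 [z2 za zb zc zd]] := H2_zero.
(* The flexible coupling flow is taken to be 0, which makes its gyroscopic term vanish; the rigid
   flow is then [a], and its gyroscopic effort is subtracted from the target. Below, [f_p = ct b']
   corrects the entry 2 of diag (2, 1, 1). *)
pose b' : euc R 4 := b - K_r L rho xr.2 *m a.
pose eext : euc R 4 := - (Zmx xr.1 *m lower b').
pose df : (Zf L \oplus Zc R) \oplus (Zf L \oplus Zc R) :=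
  ((((0, - (cd b' *: classI L rho)), 0), 0), (((0, 0), 0), vec 4 [:: cd b'; 0; 0; 0])).
pose dr : (Zr R \oplus Zc R) \oplus (Zr R \oplus Zc R) :=
  ((((Zmx xr.1 *m lower a, ct b'), (Bext xr.1)^T *m lower a), a),
   (((0, ct a), eext), b - vec 4 [:: cd b'; 0; 0; 0])).
exists (dr, df); last by rewrite /Gamma /= subr0 subrK.
split => /=.
  apply/D_rP; split => //.
  rewrite -[LHS](subrK (K_r L rho xr.2 *m a)); congr (_ + _).
  rewrite addrAC -/b' col_cd /D_r_ebar mulmx0 add0r /eext mulmxN lowerE Bext_Zmx//.
  have -> : - (vec 3 [:: ct b'; 0; 0] - vec 3 [:: ct b' + ct b'; cn0 b'; cnf b']) = vec 3 [:: ct b'; cn0 b'; cnf b']; last by [].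
  apply/matrixP => -[[|[|[|//]]] ?] j; rewrite (ord1 j) !mxE /=; ring.
apply/D_fP; exists h0, h0; rewrite mulmx0 subr0 z2 za zb zc zd !vec4E; split; [|split]; split.
all: rewrite ?oppr0 ?sub0r//.
- by rewrite -(hdot_classI_mul _ rho_mult) hdot0r /cd mxE.
- by rewrite /cn0 mxE.
- by rewrite /cnf mxE.
- by rewrite [LHS]vec2_eta !mxE.
- by rewrite [LHS]vec2_eta !mxE.
Qed.

Definition unPi (z : Zb_store L \oplus Z0 R \oplus Zb_ext R) : Zr R \oplus Zf L :=
  let: (((sr, sf), _), (pr, pf)) := z in ((sr, pr), (sf, pf)).

Lemma Pi_K : cancel (@Pi R L) unPi.
Proof. by move=> [[sr pr] [sf pf]]. Qed.

Lemma Z0_eq (x y : Z0 R) : x = y.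
Proof. by apply/matrixP => -[]. Qed.

Lemma unPi_K : cancel unPi (@Pi R L).
Proof. by move=> [[[sr sf] z] [pr pf]]; rewrite /Pi /= (Z0_eq 0 z). Qed.

Lemma hdot_Pi z w : hdot (@Pi R L z) (Pi w) = hdot z w.
Proof.
by case: z w => [[sr pr] [sf pf]] [[sr' pr'] [sf' pf']]; rewrite /Pi !hdot_pair /= hdot0l; ring.
Qed.

Lemma D_b_dirac (x : Zb_store L) : X_r x.1 -> dirac_structure (D_b L rho x).
Proof.
move=> Xr; rewrite /D_b.
pose psi (d : (Zb_store L \oplus Z0 R \oplus Zb_ext R) \oplus (Zb_store L \oplus Z0 R \oplus Zb_ext R)) :
  (Zr R \oplus Zf L) \oplus (Zr R \oplus Zf L) := (unPi d.1, unPi d.2).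
apply: (@dirac_image _ _ _ _ _ _ psi).
- apply: dirac_interconnection; [exact: D_r_dirac|exact: D_f_dirac|].
  move=> a b; have [[d1 d2] [h1 h2] /=] := Gamma_surj x.2 Xr (I : setT (a, b)).
  move: d1 d2 h1 h2 => [[f1 fc1] [e1 ec1]] [[f2 fc2] [e2 ec2]] /= h1 h2 [E1 E2].
  by exists ((f1, fc1), (e1, ec1)), ((f2, fc2), (e2, ec2)).
- by move=> [z w]; rewrite /psi /= !Pi_K.
- by move=> [z w]; rewrite /psi /= !unPi_K.
- by move=> [z w] [z' w']; rewrite /power_pairing /= !hdot_Pi.
Qed.

(** * Elimination of the coupling variables *)

Lemma vec3_inj (a b c a' b' c' : R) : vec 3 [:: a; b; c] = vec 3 [:: a'; b'; c'] ->
  [/\ a = a', b = b' & c = c'].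
Proof.
move=> /matrixP h; split.
- by have := h 0 0; rewrite !mxE.
- by have := h 1 0; rewrite !mxE.
- by have := h (@Ordinal 3 2 isT) 0; rewrite !mxE.
Qed.

Lemma vec4_eta (x : euc R 4) : x = vec 4 [:: cd x; ct x; cn0 x; cnf x].
Proof.
apply/matrixP => -[[|[|[|[|//]]]] ?] j; rewrite (ord1 j) [RHS]mxE /=; congr (x _ _); exact: val_inj.
Qed.

Lemma K_rE p (f : euc R 4) : K_r L rho p *m f =
  vec 4 [:: p / (mass L rho * L) * (cn0 f - cnf f); 0; - (p / (mass L rho * L) * cd f); p / (mass L rho * L) * cd f].
Proof.
rewrite {1}[f]vec4_eta; apply/matrixP => -[[|[|[|[|//]]]] ?] j;
  rewrite (ord1 j) mxE !big_ord_recl big_ord0 !mxE /=; ring.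
Qed.

Lemma K_fE (x : Zf_store L) (f : euc R 4) : K_f x *m f =
  vec 4 [:: 0; integralI L (L2_fun x.2) / L * (cnf f - cn0 f); integralI L (L2_fun x.2) / L * ct f;
    - (integralI L (L2_fun x.2) / L * ct f)].
Proof.
rewrite {1}[f]vec4_eta; apply/matrixP => -[[|[|[|[|//]]]] ?] j;
  rewrite (ord1 j) mxE !big_ord_recl big_ord0 !mxE /=; ring.
Qed.

Lemma col_vec4 (x : euc R 3) : (col_mx 0 x : 'cV[R]_(1 + 3)) = vec 4 [:: 0; x 0 0; x 1 0; x (@Ordinal 3 2 isT) 0].
Proof.
apply: (@hdot_inj _ (euc R 4)) => y; rewrite hdotC hdot_lower hdot_euc4 !vec4E lowerE.
rewrite hdot_euc !big_ord_recl big_ord0 !mxE /=.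
rewrite (_ : lift ord0 ord0 = 1); last exact: val_inj.
rewrite (_ : lift ord0 (lift ord0 ord0) = @Ordinal 3 2 isT); last exact: val_inj.
ring.
Qed.

Lemma couplingD (x y : euc R 4) : (cd (x + y) = cd x + cd y) * (ct (x + y) = ct x + ct y) *
  (cn0 (x + y) = cn0 x + cn0 y) * (cnf (x + y) = cnf x + cnf y).
Proof. by rewrite /cd /ct /cn0 /cnf !mxE. Qed.

Lemma couplingN (x : euc R 4) : (cd (- x) = - cd x) * (ct (- x) = - ct x) *
  (cn0 (- x) = - cn0 x) * (cnf (- x) = - cnf x).
Proof. by rewrite /cd /ct /cn0 /cnf !mxE. Qed.

(* The reaction efforts [ebar] of the rigid subsystem, once the coupling variables are eliminated. *)
Definition reaction (x : Zb_store L) (ep fd d0 dL w0 wL : R) : 'cV[R]_3 :=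
  let c := x.1.2 / (mass L rho * L) in let P := integralI L (L2_fun x.2.2) / L in
  vec 3 [:: - (P * (wL - w0)); d0 + c * fd - P * ep; - dL - c * fd + P * ep].

(** The coupling flows are read off the subsystems: f_d from the beam integral, f_t from e_p, the
    normal ones from the end values. Matching the d-components of the efforts gives e_d =
    [c * (h2 hw L - h2 hw 0)], which is purely the rigid gyroscopic term; matching the other three
    gives [reaction]. *)
Lemma D_bP (x : Zb_store L) fq fp fk fw z fext fM eq ep ek ew z' eext eM :
  D_b L rho x (((((fq, fp), (fk, fw)), z), (fext, fM)), ((((eq, ep), (ek, ew)), z'), (eext, eM))) <->
  exists (hk : H2 ek) (hw : H2 ew),
  let v : 'cV[R]_3 := vec 3 [:: ep; h2 hw 0; h2 hw L] in
  let c := x.1.2 / (mass L rho * L) in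
  [/\ fq = Zmx x.1.1 *m v, fext = (Bext x.1.1)^T *m v &
      0 = (Zmx x.1.1)^T *m eq + vec 3 [:: fp; 0; 0] + Bext x.1.1 *m eext +
          reaction x ep (integralI L (fun xi => rho xi * L2_fun ew xi)) (h2' hk 0) (h2' hk L) (h2 hw 0) (h2 hw L)] /\
  [/\ fk = h2'' hw, fw = - h2'' hk - (c * (h2 hw L - h2 hw 0)) *: classI L rho,
      fM = vec 2 [:: h2' hw 0; h2' hw L] & eM = vec 2 [:: h2 hk 0; - h2 hk L]].
Proof.
split.
  move=> [[[[[fq' fp'] fext'] [[fk' fw'] fM']] [[[eq' ep'] eext'] [[ek' ew'] eM']]] /= [fc [ec [dr /D_fP df]]]].
  rewrite /Pi => -[<- <- <- <- _ <- <- <- <- <- <- _ <- <-] {fq fp fk fw z fext fM eq ep ek ew z' eext eM}.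
  move: dr => [ebar [-> -> ctE h0 ecE]].
  move: df => [hk [hw [[-> -> cdE ctE'] [[n0E n0E' nfE nfE'] [-> ->]]]]].
  exists hk, hw => /=; rewrite -n0E -nfE -cdE.
  move: ctE' n0E' nfE'; rewrite !couplingD !couplingN ecE !couplingD col_vec4 K_rE K_fE !vec4E ctE => t1 t2 t3.
  split; split => //.
    rewrite {1}h0; congr (_ + _); apply/matrixP => -[[|[|[|//]]] i3] j; rewrite (ord1 j) [RHS]mxE /=.
    - rewrite (_ : Ordinal i3 = 0); [lra|exact: val_inj].
    - rewrite (_ : Ordinal i3 = 1); [lra|exact: val_inj].
    - rewrite (_ : Ordinal i3 = @Ordinal 3 2 isT); [lra|exact: val_inj].
  apply: (congr1 (fun z : R => - h2'' hk - z *: classI L rho)); ring.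
move=> [hk [hw /= [[-> -> h0] [-> -> -> ->]]]].
set ebar := reaction _ _ _ _ _ _ _ in h0.
pose fc : euc R 4 := vec 4 [:: integralI L (fun xi => rho xi * L2_fun ew xi); ep; h2 hw 0; h2 hw L].
pose ec : euc R 4 := (col_mx 0 ebar : 'cV[R]_(1 + 3)) + K_r L rho x.1.2 *m fc.
pose f : Zr R \oplus Zf L := (((Zmx x.1.1 *m vec 3 [:: ep; h2 hw 0; h2 hw L] : euc R 4, fp), (Bext x.1.1)^T *m vec 3 [:: ep; h2 hw 0; h2 hw L] : euc R 4),
  ((h2'' hw, - h2'' hk - (x.1.2 / (mass L rho * L) * (h2 hw L - h2 hw 0)) *: classI L rho), vec 2 [:: h2' hw 0; h2' hw L])).
pose e : Zr R \oplus Zf L := (((eq, ep), eext), ((ek, ew), vec 2 [:: h2 hk 0; - h2 hk L])).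
exists (f, e); last by rewrite /Pi /= (Z0_eq z 0) (Z0_eq z' 0).
exists fc, ec; split.
  by exists ebar; rewrite /fc !vec4E.
apply/D_fP; exists hk, hw; rewrite /ec !couplingD !couplingN !couplingD col_vec4 K_rE K_fE !vec4E.
split; [split => //|split; split => //].
- apply: (congr1 (fun z : R => - h2'' hk - z *: classI L rho)); ring.
- by rewrite /ebar /reaction !mxE /=; ring.
- by rewrite /ebar /reaction !mxE /=; ring.
- by rewrite /ebar /reaction !mxE /=; ring.
Qed.
End subsystems.

(** * Norm-continuous families of bounded operators *)

Section operator_families.
Context {R : realType}.

(** A predicate on bare functions, so that operators written as lambda terms can be combined freely;
    [blin_pack] bundles them afterwards. *)
Definition blin {V W : normedModType R} (A : V -> W) : Prop :=
  (forall (c : R) x y, A (c *: x + y) = c *: A x + A y) /\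
  exists2 M, 0 <= M & forall x, `|A x| <= M * `|x|.

(** Norm continuity as an inequality in [v] instead of the supremum in [opnorm], so that sums,
    products and pairs reduce to triangle inequalities; [blin_family_opnorm] converts. *)
Definition blin_family {X : topologicalType} {V W : normedModType R} (S : set X) (A : X -> V -> W) : Prop :=
  (forall y, blin (A y)) /\
  forall x, S x -> forall e, 0 < e ->
    \forall y \near within S (nbhs x), forall v, `|A y v - A x v| <= e * `|v|.

Lemma blinN {V W : normedModType R} (A : V -> W) : blin A -> blin (fun x => - A x).
Proof.
move=> [lin [M M0 AM]]; split; first by move=> c x y; rewrite lin scalerN opprD.
by exists M => // x; rewrite normrN.
Qed.

Lemma blinD {V W : normedModType R} (A B : V -> W) : blin A -> blin B -> blin (fun x => A x + B x).
Proof.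
move=> [lA [M M0 AM]] [lB [N N0 BN]]; split.
  by move=> c x y; rewrite lA lB scalerDr addrACA.
exists (M + N); first exact: addr_ge0.
by move=> x; rewrite mulrDl (le_trans (ler_normD _ _))// lerD.
Qed.

Lemma blin_comp {U V W : normedModType R} (A : U -> V) (B : V -> W) : blin A -> blin B -> blin (B \o A).
Proof.
move=> [lA [M M0 AM]] [lB [N N0 BN]]; split; first by move=> c x y /=; rewrite lA lB.
exists (N * M); first exact: mulr_ge0.
by move=> x /=; rewrite (le_trans (BN _))// -mulrA ler_wpM2l.
Qed.

Lemma blinZB {V W : normedModType R} (A : V -> W) (c : R) x y : blin A ->
  A (c *: (x - y)) = c *: (A x - A y).
Proof.
move=> [lin _]; have A0 : A 0 = 0.
  by have := lin (-1) 0 0; rewrite scaler0 addr0 scaleN1r addNr.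
have := lin c (x - y) 0; rewrite !addr0 A0 addr0 => ->; congr (_ *: _).
by have := lin (-1) y x; rewrite !scaleN1r addrC [RHS]addrC.
Qed.

Lemma blin_scale {V W : normedModType R} (A : V -> W) (r : R) : blin A -> blin (fun x => r *: A x).
Proof.
move=> [lA [M M0 AM]]; split.
  by move=> c x y; rewrite lA scalerDr !scalerA (mulrC r).
by exists (`|r| * M) => [|x]; rewrite ?mulr_ge0// normrZ -mulrA ler_wpM2l.
Qed.

Lemma blin_scalel {V W : normedModType R} (A : V -> R^o) (w : W) : blin A -> blin (fun x => (A x : R) *: w).
Proof.
move=> [lA [M M0 AM]]; split.
  by move=> c x y; rewrite lA scalerDl scalerA.
exists (M * `|w|); first by rewrite mulr_ge0.
by move=> x; rewrite normrZ mulrAC ler_wpM2r// AM.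
Qed.

Lemma hprod_norm {U V : hilbertType R} (z : U \oplus V) : `|z| ^+ 2 = `|z.1| ^+ 2 + `|z.2| ^+ 2.
Proof. by rewrite -!hdotxx. Qed.

Lemma hprod_norm1 {U V : hilbertType R} (z : U \oplus V) : `|z.1| <= `|z|.
Proof. by rewrite -(@ler_pXn2r _ 2)// ?nnegrE// hprod_norm lerDl sqr_ge0. Qed.

Lemma hprod_norm2 {U V : hilbertType R} (z : U \oplus V) : `|z.2| <= `|z|.
Proof. by rewrite -(@ler_pXn2r _ 2)// ?nnegrE// hprod_norm lerDr sqr_ge0. Qed.

Lemma hprod_norm_le {U V : hilbertType R} (z : U \oplus V) : `|z| <= `|z.1| + `|z.2|.
Proof.
rewrite -(@ler_pXn2r _ 2)// ?nnegrE ?addr_ge0// hprod_norm sqrrD.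
by rewrite addrAC lerDl mulrn_wge0// mulr_ge0.
Qed.

Lemma blin_fst {U V : hilbertType R} : blin (fst : U \oplus V -> U).
Proof. by split=> //; exists 1 => // x; rewrite mul1r hprod_norm1. Qed.

Lemma blin_snd {U V : hilbertType R} : blin (snd : U \oplus V -> V).
Proof. by split=> //; exists 1 => // x; rewrite mul1r hprod_norm2. Qed.

Lemma blin_pair {U : normedModType R} {V W : hilbertType R} (A : U -> V) (B : U -> W) :
  blin A -> blin B -> blin (fun x => (A x, B x) : V \oplus W).
Proof.
move=> [lA [M M0 AM]] [lB [N N0 BN]]; split.
  by move=> c x y; rewrite lA lB.
exists (M + N); first exact: addr_ge0.
move=> x; rewrite mulrDl (le_trans (hprod_norm_le _))//.
by apply: lerD; [exact: AM|exact: BN].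
Qed.

Lemma blin_hdot {V : hilbertType R} (v : V) : blin (fun x => hdot v x : R^o).
Proof.
split; first by move=> c x y; rewrite hdotDr hdotZr.
by exists `|v| => // x; exact: norm_hdot_le.
Qed.

Lemma blin_coord n i : blin (fun x : euc R n => x i 0 : R^o).
Proof.
have e (x : euc R n) : x i 0 = hdot (delta_mx i 0 : euc R n) x.
  rewrite hdot_euc (bigD1 i)//= big1 ?addr0 ?mxE ?eqxx ?mul1r// => j ji.
  by rewrite mxE (negbTE ji) mul0r.
have [l [M M0 AM]] := blin_hdot (delta_mx i 0 : euc R n).
split; first by move=> c x y; rewrite !mxE.
by exists M => // x; rewrite e.
Qed.

Lemma blin_euc n {W : normedModType R} (A : euc R n -> W) :
  (forall (c : R) x y, A (c *: x + y) = c *: A x + A y) -> blin A.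
Proof.
move=> lin; split => //.
have A0 : A 0 = 0 by have := lin (-1) 0 0; rewrite scaler0 addr0 scaleN1r addNr.
have AD x y : A (x + y) = A x + A y by have := lin 1 x y; rewrite !scale1r.
have AZ c x : A (c *: x) = c *: A x by have := lin c x 0; rewrite !addr0 A0 addr0.
pose d i : euc R n := delta_mx i 0.
have xE (x : euc R n) : x = \sum_i x i 0 *: d i.
  rewrite [LHS](matrix_sum_delta (x : 'cV[R]_n)); apply: eq_bigr => i _.
  by rewrite big_ord1.
have coord (x : euc R n) i : `|x i 0| <= `|x|.
  rewrite -(@ler_pXn2r _ 2)// ?nnegrE// -hdotxx hdot_euc (bigD1 i)//= real_normK ?num_real// -expr2.
  by rewrite lerDl sumr_ge0// => j _; rewrite -expr2 sqr_ge0.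
exists (\sum_i `|A (d i)|); first exact: sumr_ge0.
move=> x; rewrite {1}(xE x) (big_morph A AD A0) mulr_suml.
rewrite (le_trans (ler_norm_sum _ _ _))// ler_sum// => i _.
by rewrite AZ normrZ mulrC ler_wpM2l.
Qed.

Lemma blin_continuous {V W : normedModType R} (A : V -> W) : blin A -> continuous A.
Proof.
move=> [lin [M M0 AM]] x; apply/cvgrPdist_lt => e e0.
have M1 : 0 < M + 1 by rewrite ltr_wpDl.
near=> y.
have -> : A x - A y = A (x - y).
  by rewrite addrC -scaleN1r -lin scaleN1r addrC.
rewrite (le_lt_trans (AM _))//.
rewrite (@le_lt_trans _ _ ((M + 1) * `|x - y|))//; first by rewrite ler_wpM2r// lerDl.
rewrite mulrC -ltr_pdivlMr//; near: y.
by apply: cvgr_dist_lt; rewrite ?divr_gt0.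
Unshelve. all: by end_near. Qed.

Section families.
Context {X : topologicalType} (S : set X).

Lemma blin_family_const {V W : normedModType R} (A : V -> W) : blin A -> blin_family S (fun=> A).
Proof.
move=> bA; split=> // x _ e e0; apply: nearW => y v.
by rewrite subrr normr0 mulr_ge0// ltW.
Qed.

Lemma blin_familyD {V W : normedModType R} (A B : X -> V -> W) :
  blin_family S A -> blin_family S B -> blin_family S (fun y v => A y v + B y v).
Proof.
move=> [lA cA] [lB cB]; split; first by move=> y; exact: blinD.
move=> x Sx e e0; have e20 : 0 < e / 2 by rewrite divr_gt0.
apply: filterS2 (cA x Sx _ e20) (cB x Sx _ e20) => y hA hB v.
rewrite opprD addrACA (le_trans (ler_normD _ _))// (splitr e) mulrDl.
by apply: lerD; [exact: hA|exact: hB].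
Qed.

(** The tolerance for a product: [M] bounds the factor kept at the base point, and [N + 1] the other
    one after a variation of at most [d <= 1]. *)
Let small_factor (M N e : R) : 0 <= M -> 0 <= N -> 0 < e ->
  exists d, [/\ 0 < d, d <= 1 & d * M + (N + 1) * d <= e].
Proof.
move=> M0 N0 e0; have s0 : 0 < M + N + 1 by rewrite ltr_wpDl// addr_ge0.
exists (Num.min (e / (M + N + 1)) 1); split.
- by rewrite lt_min ltr01 andbT divr_gt0.
- by rewrite ge_min lexx orbT.
- by rewrite mulrC -mulrDl addrA -ler_pdivlMl// mulrC ge_min lexx.
Qed.

Let near_factor {W : normedModType R} (x y : W) (d : R) : d <= 1 -> `|x - y| < d -> `|y| <= `|x| + 1.
Proof.
move=> d1 xy; rewrite -[y](subrK x) (le_trans (ler_normD _ _))// addrC lerD2l distrC ltW//.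
exact: lt_le_trans xy d1.
Qed.

Lemma blin_family_scale {V W : normedModType R} (r : X -> R) (A : X -> V -> W) :
  (forall x, S x -> r y @[y --> within S (nbhs x)] --> r x) ->
  blin_family S A -> blin_family S (fun y v => r y *: A y v).
Proof.
move=> cr [lA cA]; split; first by move=> y; exact: blin_scale.
move=> x Sx e e0; have [linx [M M0 AM]] := lA x.
have [d [d0 d1 de]] := small_factor M0 (normr_ge0 (r x)) e0.
have /cvgrPdist_lt/(_ _ d0) := cr x Sx.
apply: filterS2 (cA x Sx _ d0) => y hA hr v.
have -> : r y *: A y v - r x *: A x v = (r y - r x) *: A x v + r y *: (A y v - A x v).
  by rewrite scalerBl scalerBr [RHS]addrC addrA subrK.
rewrite (le_trans (ler_normD _ _))// !normrZ (le_trans _ (ler_wpM2r (normr_ge0 v) de))//.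
rewrite mulrDl -!mulrA; apply: lerD; apply: ler_pM => //.
- by rewrite distrC ltW.
- exact: near_factor d1 hr.
Qed.

Lemma blin_family_scalel {V W : normedModType R} (A : X -> V -> R^o) (w : X -> W) :
  (forall x, S x -> w y @[y --> within S (nbhs x)] --> w x) ->
  blin_family S A -> blin_family S (fun y v => (A y v : R) *: w y).
Proof.
move=> cw [lA cA]; split; first by move=> y; exact: blin_scalel.
move=> x Sx e e0; have [linx [M M0 AM]] := lA x.
have [d [d0 d1 de]] := small_factor M0 (normr_ge0 (w x)) e0.
have /cvgrPdist_lt/(_ _ d0) := cw x Sx.
apply: filterS2 (cA x Sx _ d0) => y hA hw v.
have -> : (A y v : R) *: w y - (A x v : R) *: w x = (A x v : R) *: (w y - w x) + ((A y v : R) - A x v) *: w y.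
  by rewrite scalerBl scalerBr [RHS]addrC addrA subrK.
rewrite (le_trans (ler_normD _ _))// !normrZ (le_trans _ (ler_wpM2r (normr_ge0 v) de))//.
rewrite mulrDl -!mulrA mulrC [X in _ + X]mulrC; apply: lerD; apply: ler_pM => //.
- by rewrite distrC ltW.
- exact: near_factor d1 hw.
Qed.

Lemma blin_family_comp {U V W : normedModType R} (A : X -> U -> V) (B : V -> W) :
  blin B -> blin_family S A -> blin_family S (fun y v => B (A y v)).
Proof.
move=> bB [lA cA]; split; first by move=> y; exact: blin_comp.
move=> x Sx e e0; have [lB [M M0 BM]] := bB.
have M1 : 0 < M + 1 by rewrite ltr_wpDl.
apply: filterS (cA x Sx _ (divr_gt0 e0 M1)) => y h v.
have -> : B (A y v) - B (A x v) = B (A y v - A x v).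
  by rewrite addrC -scaleN1r -lB scaleN1r addrC.
rewrite (le_trans (BM _))// (@le_trans _ _ ((M + 1) * (e / (M + 1) * `|v|)))//.
  by apply: ler_pM => //; rewrite lerDl.
by rewrite mulrA mulrCA divff ?mulr1// gt_eqF.
Qed.

Lemma blin_family_pair {U : normedModType R} {V W : hilbertType R} (A : X -> U -> V) (B : X -> U -> W) :
  blin_family S A -> blin_family S B -> blin_family S (fun y x => (A y x, B y x) : V \oplus W).
Proof.
move=> [lA cA] [lB cB]; split; first by move=> y; exact: blin_pair.
move=> x Sx e e0; have e20 : 0 < e / 2 by rewrite divr_gt0.
apply: filterS2 (cA x Sx _ e20) (cB x Sx _ e20) => y hA hB v.
rewrite (le_trans (hprod_norm_le _))// (splitr e) mulrDl.
by apply: lerD; [exact: hA|exact: hB].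
Qed.

Lemma blin_family_opnorm {V W : normedModType R} (A : X -> V -> W) :
  blin_family S A -> opnorm_continuous_on S A.
Proof.
move=> [lA cA] x Sx; apply/cvgrPdist_le => e e0.
apply: filterS (cA x Sx e e0) => y h.
rewrite sub0r normrN.
(* [sup] needs a nonempty bounded set; the unit ball contains 0, which also gives nonnegativity
   below. *)
have hs : has_sup [set `|A y v - A x v| | v in [set v | `|v| <= 1]].
  split; first by exists `|A y 0 - A x 0|; exists 0 => //=; rewrite normr0.
  by exists e => _ [v /= v1 <-]; rewrite (le_trans (h v))// ler_piMr// ltW.
have ub : opnorm (fun v => A y v - A x v) <= e.
  apply: ge_sup; first by case: hs.
  by move=> _ [v /= v1 <-]; rewrite (le_trans (h v))// ler_piMr// ltW.
rewrite ger0_norm//.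
apply: (@le_trans _ _ `|A y 0 - A x 0|) => //.
by apply: ub_le_sup; [case: hs|exists 0 => //=; rewrite normr0].
Qed.

Lemma blin_pack {V W : normedModType R} (A : V -> W) : blin A ->
  exists l : {linear V -> W}, forall v, l v = A v.
Proof.
move=> [lin _].
pose l : {linear V -> W} := HB.pack A (GRing.isLinear.Build R V W *:%R A lin).
by exists l.
Qed.

End families.

(** A global parametrization serves at every point, with the whole space as neighbourhood. *)
Lemma modulated_dirac_structureP {X : topologicalType} {Z W : hilbertType R} (S : set X)
    (D : X -> set (Z \oplus Z)) (A : X -> W -> Z \oplus Z) :
  (forall x, S x -> dirac_structure (D x)) -> blin_family S A ->
  (forall x, S x -> set_bij setT (D x) (A x)) -> modulated_dirac_structure S D.
Proof.
move=> DD bA bij; split => //; exists W => x Sx.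
have [T hT] := choice (fun y => blin_pack (bA.1 y)).
have TE y : (T y : W -> Z \oplus Z) = A y by apply/funext => v; exact: hT.
exists setT, T; split.
- by split; [exact: openT|].
- by move=> y _; rewrite TE; apply: blin_continuous; exact: bA.1.
- by move=> y [_ Sy]; rewrite TE; exact: bij.
rewrite setTI; move: (blin_family_opnorm bA); rewrite /opnorm_continuous_on => h z Sz.
rewrite -/(opnorm _); under eq_fun do rewrite !TE; exact: h.
Qed.

End operator_families.

(** * A global parametrization of the interconnection *)

Section parametrization.
Context {R : realType} (L : R) (rho : R -> R).
Hypothesis L_gt0 : 0 < L.
Hypothesis rho_mult : multiplier L rho.
Let L_ge0 : 0 <= L. Proof. exact: ltW. Qed.

(* A function u in H^2 is encoded by (u'', (u 0, u' 0)). *)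
Let H2c : hilbertType R := L2I L \oplus euc R 2.

Definition H2_val (z : L2I L \oplus euc R 2) : L2I L := H2_lift (z.2 0 0) (z.2 1 0) z.1.
(** Value and slope at L of the function encoded by [z]. *)
Definition endv (z : L2I L \oplus euc R 2) : R^o := prim2 (z.2 0 0) (z.2 1 0) (L2_fun z.1) L.
Definition endd (z : L2I L \oplus euc R 2) : R^o := prim1 (z.2 1 0) (L2_fun z.1) L.

Let initv_le (z : H2c) i : `|z.2 i 0| <= `|z|.
Proof.
apply: le_trans (hprod_norm2 z).
rewrite -(@ler_pXn2r _ 2)// ?nnegrE// -hdotxx hdot_euc (bigD1 i)//= real_normK ?num_real// -expr2.
by rewrite lerDl sumr_ge0// => j _; rewrite -expr2 sqr_ge0.
Qed.

Let prim2_le (z : H2c) : `|z.2 0 0| + L * (`|z.2 1 0| + Num.sqrt L * `|z.1|) <= (1 + L * (1 + Num.sqrt L)) * `|z|.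
Proof.
have h0 := initv_le z 0; have h1 := initv_le z 1; have h2 := hprod_norm1 z.
rewrite mulrDl mul1r -mulrA; apply: lerD => //; rewrite ler_wpM2l// mulrDl mul1r.
by apply: lerD => //; rewrite ler_wpM2l// sqrtr_ge0.
Qed.

Let c_ge0 : 0 <= 1 + L * (1 + Num.sqrt L).
Proof. by rewrite addr_ge0// mulr_ge0// addr_ge0// sqrtr_ge0. Qed.

Lemma blin_H2_val : blin H2_val.
Proof.
split.
  by move=> c x y; rewrite /H2_val /= !mxE (H2_lift_lin L_ge0).
exists ((1 + L * (1 + Num.sqrt L)) * Num.sqrt L); first by rewrite mulr_ge0// sqrtr_ge0.
move=> z; rewrite (le_trans (H2_lift_norm L_ge0 _ _ _))// mulrAC ler_wpM2r ?sqrtr_ge0//.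
Qed.

Lemma blin_endv : blin endv.
Proof.
split.
  by move=> c x y; rewrite /endv /= !mxE (prim2_lin L_ge0).
exists (1 + L * (1 + Num.sqrt L)) => // z.
exact: le_trans (prim2_bound L_ge0 _ _ _ _) (prim2_le z).
Qed.

Lemma blin_endd : blin endd.
Proof.
split.
  by move=> c x y; rewrite /endd /= !mxE (prim1_lin _ _ _ _ _ (lexx L)).
exists (1 + Num.sqrt L); first by rewrite addr_ge0// sqrtr_ge0.
move=> z; rewrite (le_trans (prim1_bound L_ge0 _ _ (lexx L)))// mulrDl mul1r.
by apply: lerD; [exact: initv_le|rewrite ler_wpM2l ?sqrtr_ge0// hprod_norm1].
Qed.

(** For injectivity of the parametrization: [D_b] shows e_kappa'', e_kappa(0) and e_kappa(L) but not
    the slope at 0, which is recovered from e_kappa(L) because L is nonzero. *)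
Lemma endv_slope (g : L2I L) (a b : R) : prim2 a b (L2_fun g) L = prim2 a 0 (L2_fun g) L + b * L.
Proof.
have := prim2_lin L_ge0 b 0 1 a 0 0 g (lexx L).
rewrite mulr0 mulr1 !add0r addr0 scaler0 add0r => ->.
rewrite addrC; congr (_ + b * _).
rewrite /prim2 add0r (@eq_Rintegral _ _ _ _ _ (cst 1)).
  exact: (etrans (integralI_cst _ L_ge0) (mul1r _)).
move=> x; rewrite inE/= in_itv/= => /andP[_ xL].
by rewrite /prim1 primitive_hdot// hdot0l addr0.
Qed.

(** Block embeddings written as matrix products, so that stacking two families is a sum of bounded
    operators. *)
Definition emb1 (u : euc R 2) : euc R 4 := (col_mx 1%:M 0 : 'M[R]_(2 + 2, 2)) *m u.
Definition emb2 (u : euc R 2) : euc R 4 := (col_mx 0 1%:M : 'M[R]_(2 + 2, 2)) *m u.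

Lemma col_emb (u v : euc R 2) : (col_mx u v : 'cV[R]_(2 + 2)) = emb1 u + emb2 v :> euc R 4.
Proof.
have : (col_mx 1%:M 0 : 'M[R]_(2 + 2, 2)) *m (u : 'cV[R]_2) + (col_mx 0 1%:M : 'M[R]_(2 + 2, 2)) *m (v : 'cV[R]_2)
   = col_mx (u : 'cV[R]_2) (v : 'cV[R]_2).
  by rewrite !mul_col_mx !mul1mx !mul0mx add_col_mx addr0 add0r.
by move=> <-.
Qed.

Lemma blin_mulmx m n (A : 'M[R]_(m, n)) : blin (fun u : euc R n => A *m u : euc R m).
Proof. by apply: blin_euc => c x y; rewrite mulmxDr -scalemxAr. Qed.

Lemma blin_span : blin (fun z : euc R 4 => qf z - q0 z).
Proof.
by apply: blin_euc => c x y; apply/matrixP => i j; rewrite !mxE; ring.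
Qed.

Lemma open_U_pos : open (@U_pos R).
Proof.
rewrite (_ : U_pos = (fun z : euc R 4 => qf z - q0 z) @^-1` (~` [set 0])).
  apply: open_comp; first by move=> z _; exact: (blin_continuous blin_span).
  by apply: closed_openC; apply: accessible_closed_set1; apply: hausdorff_accessible; exact: norm_hausdorff.
apply/seteqP; split => z /=; rewrite /U_pos /=.
  by move=> h /eqP; rewrite subr_eq0 => /eqP h'; apply: h.
by move=> h h'; apply: h; rewrite h' subrr.
Qed.

Lemma tvec_cvg (z : euc R 4) : U_pos z -> (fun y => tvec y : euc R 2) y @[y --> z] --> (tvec z : euc R 2).
Proof.
move=> /len_gt0 l0; have c2 : (fun y : euc R 4 => qf y - q0 y) y @[y --> z] --> qf z - q0 z.
  exact: (blin_continuous blin_span).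
apply: (@cvgZ _ _ _ (nbhs z) _ (fun y => (len y)^-1)) => //.
apply: (@cvgV _ _ (nbhs z) _ len); first by rewrite gt_eqF.
exact: (cvg_norm c2).
Qed.

Lemma frame_decomp (z : euc R 4) (u : euc R 2) : U_pos z ->
  u = hdot (tvec z : euc R 2) u *: (tvec z : euc R 2) + hdot (nvec z : euc R 2) u *: (nvec z : euc R 2).
Proof.
move=> /frame[tt _ _]; rewrite /nvec; move: tt; set t : euc R 2 := tvec z; move: t => t.
rewrite !hdot_euc2 => tt.
have [n0 n1] : (J *m t) 0 0 = - t 1 0 /\ (J *m t) 1 0 = t 0 0.
  split; rewrite /J /mx_rows mxE !big_ord_recl big_ord0 !mxE /= (_ : lift ord0 ord0 = 1); [ring|exact: val_inj|ring|exact: val_inj].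
apply/matrixP => -[[|[|//]] i] j; rewrite (ord1 j) [RHS]mxE [X in _ = X + _]mxE [X in _ = _ + X]mxE.
  rewrite (_ : Ordinal i = 0); last exact: val_inj.
  rewrite n0 n1; transitivity ((t 0 0 * t 0 0 + t 1 0 * t 1 0) * u 0 0); [by rewrite tt mul1r|ring].
rewrite (_ : Ordinal i = 1); last exact: val_inj.
rewrite n0 n1; transitivity ((t 0 0 * t 0 0 + t 1 0 * t 1 0) * u 1 0); [by rewrite tt mul1r|ring].
Qed.

(* (e_q, e_p, tangential components of e_q + e_ext), then the data of e_kappa and
   of e_p in H^2; the normal components of e_q + e_ext are the reactions. *)
Definition Zpar : hilbertType R := (euc R 4 \oplus R^o \oplus euc R 2) \oplus
  ((L2I L \oplus euc R 2) \oplus (L2I L \oplus euc R 2)).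
Implicit Types (x : Zb_store L) (w : Zpar).

Let parq w : euc R 4 := w.1.1.1.
Let parp w : R^o := w.1.1.2.
Let para w (i : 'I_2) : R^o := w.1.2 i 0.
Let park w : L2I L \oplus euc R 2 := w.2.1.
Let parw w : L2I L \oplus euc R 2 := w.2.2.

Let b_q : blin parq. Proof. exact: blin_comp (blin_comp blin_fst blin_fst) blin_fst. Qed.
Let b_p : blin parp. Proof. exact: blin_comp (blin_comp blin_fst blin_fst) blin_snd. Qed.
Let b_a i : blin (para^~ i).
Proof. exact: blin_comp (blin_comp blin_fst blin_snd) (@blin_coord _ 2 i). Qed.
Let b_k : blin park. Proof. exact: blin_comp blin_snd blin_fst. Qed.
Let b_w : blin parw. Proof. exact: blin_comp blin_snd blin_snd. Qed.

Let dv w : R^o := endv (parw w) - (parw w).2 0 0.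
Let inert x : R := x.1.2 / (mass L rho * L).
Let momentum x : R := integralI L (L2_fun x.2.2) / L.
Let fd w : R^o := hdot (classI L rho) (H2_val (parw w)).
(** As [Zmx] is the transpose of [Bext], the balance in [D_bP] sees only [eq + eext]. Its last two
    rows, solved for the normal components of this sum, give [beta0] and [betaf]; its first row
    gives [par_fp]. *)
Let beta0 x w : R^o := - ((park w).2 1 0 + inert x * fd w - momentum x * parp w).
Let betaf x w : R^o := endd (park w) + inert x * fd w - momentum x * parp w.

Definition par_fq x w : euc R 4 :=
  col_mx (parp w *: (tvec x.1.1 : euc R 2) + (parw w).2 0 0 *: (nvec x.1.1 : euc R 2))
         (parp w *: (tvec x.1.1 : euc R 2) + endv (parw w) *: (nvec x.1.1 : euc R 2)).
Definition par_sigma x w : euc R 4 :=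
  col_mx (para w 0 *: (tvec x.1.1 : euc R 2) + beta0 x w *: (nvec x.1.1 : euc R 2))
         (para w 1 *: (tvec x.1.1 : euc R 2) + betaf x w *: (nvec x.1.1 : euc R 2)).
Definition par_fp x w : R^o := - (para w 0 + para w 1) + momentum x * dv w.
Definition par_fw x w : L2I L := - (park w).1 - (inert x * dv w) *: classI L rho.
Definition par_fM w : euc R 2 := vec 2 [:: (parw w).2 1 0; endd (parw w)].
Definition par_eM w : euc R 2 := vec 2 [:: (park w).2 0 0; - endv (park w)].

(** The flow f_ext repeats f_q, again because [Zmx] is the transpose of [Bext]: the outputs are the
    velocities of the two end points. *)
Definition par x w : (Zb_store L \oplus Z0 R \oplus Zb_ext R) \oplus (Zb_store L \oplus Z0 R \oplus Zb_ext R) :=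
  (((((par_fq x w, par_fp x w), ((parw w).1, par_fw x w)), 0), (par_fq x w, par_fM w)),
   ((((parq w, parp w), (H2_val (park w), H2_val (parw w))), 0), (par_sigma x w - parq w, par_eM w))).

Let t_cvg x : X_b L x -> (fun y : Zb_store L => tvec y.1.1 : euc R 2) y @[y --> within (X_b L) (nbhs x)] --> (tvec x.1.1 : euc R 2).
Proof.
move=> [Xr _]; apply: cvg_within_filter.
apply: (@cvg_comp _ _ _ (fun y : Zb_store L => y.1.1) (fun z : euc R 4 => tvec z : euc R 2)).
  exact: (blin_continuous (blin_comp blin_fst blin_fst)).
exact: tvec_cvg.
Qed.

Let n_cvg x : X_b L x -> (fun y : Zb_store L => nvec y.1.1 : euc R 2) y @[y --> within (X_b L) (nbhs x)] --> (nvec x.1.1 : euc R 2).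
Proof.
move=> Xx; apply: (@cvg_comp _ _ _ (fun y : Zb_store L => tvec y.1.1 : euc R 2) (fun t : euc R 2 => J *m t : euc R 2)); first exact: t_cvg.
exact: (blin_continuous (blin_mulmx J)).
Qed.

Let inert_cvg x : inert y @[y --> within (X_b L) (nbhs x)] --> inert x.
Proof.
apply: cvg_within_filter.
have b : blin (fun y : Zb_store L => (mass L rho * L)^-1 *: y.1.2 : R^o).
  exact: blin_scale (blin_comp blin_fst blin_snd).
rewrite (_ : inert = fun y : Zb_store L => (mass L rho * L)^-1 *: y.1.2 : R^o).
  exact: (blin_continuous b).
by apply/funext => y; rewrite /inert mulrC.
Qed.

Let momentum_cvg x : momentum y @[y --> within (X_b L) (nbhs x)] --> momentum x.
Proof.
apply: cvg_within_filter.
have b : blin (fun y : Zb_store L => L^-1 *: (hdot (classI L (cst 1)) y.2.2 : R^o) : R^o).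
  apply: blin_scale; exact: (blin_comp (blin_comp blin_snd blin_snd) (blin_hdot (classI L (cst 1)))).
rewrite (_ : momentum = fun y : Zb_store L => L^-1 *: (hdot (classI L (cst 1)) y.2.2 : R^o) : R^o).
  exact: (blin_continuous b).
by apply/funext => y; rewrite /momentum mulrC integralI_hdot.
Qed.

Local Notation fam A := (blin_family (X_b L) A).

Let fam_momentum (A : Zb_store L -> Zpar -> R^o) : fam A -> fam (fun x w => momentum x * A x w : R^o).
Proof. by move=> fA; apply: (blin_family_scale (r := momentum)) => // x _; exact: momentum_cvg. Qed.
Let fam_inert (A : Zb_store L -> Zpar -> R^o) : fam A -> fam (fun x w => inert x * A x w : R^o).
Proof. by move=> fA; apply: (blin_family_scale (r := inert)) => // x _; exact: inert_cvg. Qed.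
Let famN {V : normedModType R} (A : Zb_store L -> Zpar -> V) : fam A -> fam (fun x w => - A x w).
Proof.
move=> fA; rewrite (_ : (fun x w => _) = fun x w => (-1 : R) *: A x w).
  by apply: blin_family_scale => // x _; exact: cvg_cst.
by apply/funext => x; apply/funext => w; rewrite scaleN1r.
Qed.

Let fam_fd : fam (fun=> fd).
Proof. apply: blin_family_const; exact: (blin_comp (blin_comp b_w blin_H2_val) (blin_hdot (classI L rho))). Qed.
Let fam_init (z : Zpar -> L2I L \oplus euc R 2) i : blin z -> fam (fun=> (fun w => (z w).2 i 0 : R^o)).
Proof. by move=> bz; apply: blin_family_const; exact: (blin_comp (blin_comp bz blin_snd) (blin_coord _)). Qed.
Let fam_p : fam (fun=> parp). Proof. exact: blin_family_const. Qed.
Let fam_dv : fam (fun=> dv).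
Proof.
apply: (blin_familyD (A := fun=> (fun w => endv (parw w)))).
  by apply: blin_family_const; exact: (blin_comp b_w blin_endv).
by apply: famN; exact: fam_init.
Qed.
Let fam_beta0 : fam beta0.
Proof.
apply: famN; apply: (blin_familyD (B := fun x w => - (momentum x * parp w) : R^o)).
  by apply: blin_familyD; [exact: fam_init|exact: fam_inert].
by apply: famN; exact: fam_momentum.
Qed.
Let fam_betaf : fam betaf.
Proof.
apply: (blin_familyD (B := fun x w => - (momentum x * parp w) : R^o)).
  apply: blin_familyD; last exact: fam_inert.
  by apply: blin_family_const; exact: (blin_comp b_k blin_endd).
by apply: famN; exact: fam_momentum.
Qed.

Let fam_frame (A B : Zb_store L -> Zpar -> R^o) : fam A -> fam B ->
  fam (fun x w => A x w *: (tvec x.1.1 : euc R 2) + B x w *: (nvec x.1.1 : euc R 2)).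
Proof.
by move=> fA fB; apply: blin_familyD; apply: blin_family_scalel.
Qed.

Let fam_col (A B : Zb_store L -> Zpar -> euc R 2) : fam A -> fam B ->
  fam (fun x w => col_mx (A x w) (B x w) : euc R 4).
Proof.
move=> fA fB; rewrite (_ : (fun x w => _) = fun x w => emb1 (A x w) + emb2 (B x w)).
  by apply: blin_familyD; apply: blin_family_comp => //; exact: blin_mulmx.
by apply/funext => x; apply/funext => w; exact: col_emb.
Qed.

Lemma blin_vec2 (V : normedModType R) (f g : V -> R^o) : blin f -> blin g ->
  blin (fun v => vec 2 [:: f v; g v] : euc R 2).
Proof.
move=> bf bg.
rewrite (_ : (fun v => _) = fun v => (f v : R) *: (vec 2 [:: 1; 0] : euc R 2) + (g v : R) *: (vec 2 [:: 0; 1] : euc R 2)).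
  by apply: blinD; exact: blin_scalel.
apply/funext => v; apply/matrixP => -[[|[|//]] i] j; rewrite (ord1 j) !mxE /=; ring.
Qed.

Let binit (z : Zpar -> L2I L \oplus euc R 2) i : blin z -> blin (fun w => (z w).2 i 0 : R^o).
Proof. by move=> bz; exact: (blin_comp (blin_comp bz blin_snd) (blin_coord _)). Qed.

Lemma par_family : blin_family (X_b L) par.
Proof.
have f_fq : fam par_fq.
  apply: fam_col; apply: fam_frame => //; first exact: fam_init.
  by apply: blin_family_const; exact: (blin_comp b_w blin_endv).
have f_sigma : fam par_sigma.
  by apply: fam_col; apply: fam_frame => //; exact: blin_family_const.
have f_fp : fam par_fp.
  apply: blin_familyD; last exact: fam_momentum.
  by apply: famN; apply: blin_familyD; exact: blin_family_const.
have f_fw : fam par_fw.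
  apply: blin_familyD; first by apply: famN; apply: blin_family_const; exact: (blin_comp b_k blin_fst).
  apply: famN; apply: (blin_family_scalel (A := fun x w => inert x * dv w : R^o)); last exact: fam_inert.
  by move=> x _; exact: cvg_cst.
apply: blin_family_pair.
  apply: blin_family_pair; first apply: blin_family_pair.
  - apply: blin_family_pair; first exact: (blin_family_pair f_fq f_fp).
    exact: (blin_family_pair (blin_family_const _ (blin_comp b_w blin_fst)) f_fw).
  - by apply: blin_family_const; split => [c v w|]; [rewrite scaler0 addr0|exists 0 => // v; rewrite normr0 mul0r].
  - apply: (blin_family_pair f_fq); apply: blin_family_const; apply: blin_vec2; first exact: binit.
    exact: (blin_comp b_w blin_endd).
apply: blin_family_pair; first apply: blin_family_pair.
- apply: blin_family_const; apply: blin_pair; first exact: (blin_pair b_q b_p).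
  apply: blin_pair; first exact: (blin_comp b_k blin_H2_val).
  exact: (blin_comp b_w blin_H2_val).
- by apply: blin_family_const; split => [c v w|]; [rewrite scaler0 addr0|exists 0 => // v; rewrite normr0 mul0r].
- apply: blin_family_pair; first exact: (blin_familyD f_sigma (famN (blin_family_const _ b_q))).
  apply: blin_family_const; apply: blin_vec2; first exact: binit.
  by apply: blinN; exact: (blin_comp b_k blin_endv).
Qed.

Let par_flows x w : par_fq x w = Zmx x.1.1 *m vec 3 [:: parp w; (parw w).2 0 0; endv (parw w)].
Proof. by rewrite Zmx_vec. Qed.

Let par_balance x w : X_b L x ->
  Bext x.1.1 *m par_sigma x w = vec 3 [:: para w 0 + para w 1; beta0 x w; betaf x w].
Proof.
move=> [/frame[tt nn nt] _]; rewrite /par_sigma Bext_col.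
move: (tvec x.1.1 : euc R 2) (nvec x.1.1 : euc R 2) tt nn nt => t n tt nn nt.
rewrite !hdotDr !hdotZr tt nn nt (hdotC t) nt.
by rewrite !mulr1 !mulr0 !addr0 !add0r.
Qed.

Lemma vec3D (a b c a' b' c' : R) : vec 3 [:: a; b; c] + vec 3 [:: a'; b'; c'] = vec 3 [:: a + a'; b + b'; c + c'].
Proof. by apply/matrixP => -[[|[|[|//]]] i] j; rewrite (ord1 j) !mxE. Qed.

Lemma vec2_inj (a b a' b' : R) : vec 2 [:: a; b] = vec 2 [:: a'; b'] -> a = a' /\ b = b'.
Proof.
by move=> h; have := vec2E a b; rewrite h !vec2E => -[-> ->].
Qed.

Let fdE w : integralI L (fun xi => rho xi * L2_fun (H2_val (parw w)) xi) = fd w.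
Proof. by rewrite /fd hdot_classI_mul. Qed.

Lemma par_fun x w : X_b L x -> D_b L rho x (par x w).
Proof.
move=> Xx; apply/D_bP; exists (H2_of L_ge0 _ _ _), (H2_of L_ge0 _ _ _) => /=.
rewrite !prim1_0 !prim2_0; split; split => //.
  by rewrite -Zmx_Bext par_flows.
rewrite fdE -/(endv (parw w)) -/(endd (park w)).
move: (par_balance w Xx); rewrite Zmx_Bext trmxK => bal.
have -> : Bext x.1.1 *m (par_sigma x w - parq w) = Bext x.1.1 *m par_sigma x w - Bext x.1.1 *m parq w.
  by rewrite -mulmxBr.
rewrite bal /reaction -/(inert x) -/(momentum x).
set q := _ *m parq w; rewrite [q + _]addrC -[_ + q + _]addrA [q + _]addrC subrK !vec3D.
apply/matrixP => -[[|[|[|//]]] i] j; rewrite !mxE /= /par_fp /beta0 /betaf /dv; ring.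
Qed.

Lemma hdot_col (u v u' v' : euc R 2) :
  hdot (col_mx u v : euc R 4) (col_mx u' v' : euc R 4) = hdot u u' + hdot v v'.
Proof.
rewrite !hdot_euc (@big_split_ord _ _ _ 2 2 xpredT).
by apply: f_equal2; apply: eq_bigr => i _; congr (_ * _); (exact: col_mxEu || exact: col_mxEd).
Qed.

Let init_eta (z z' : H2c) : z.1 = z'.1 -> z.2 0 0 = z'.2 0 0 -> z.2 1 0 = z'.2 1 0 -> z = z'.
Proof.
case: z z' => [g v] [g' v'] /= -> e0 e1; congr (_, _).
by rewrite [v]vec2_eta [v']vec2_eta e0 e1.
Qed.

Let L_neq0 : L != 0. Proof. by rewrite gt_eqF. Qed.

Lemma para_sigma x w : X_b L x ->
  para w 0 = hdot (par_sigma x w) (col_mx (tvec x.1.1 : euc R 2) (0 : euc R 2) : euc R 4) /\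
  para w 1 = hdot (par_sigma x w) (col_mx (0 : euc R 2) (tvec x.1.1 : euc R 2) : euc R 4).
Proof.
move=> [/frame[tt nn nt] _]; rewrite /par_sigma !hdot_col.
move: (tvec x.1.1 : euc R 2) (nvec x.1.1 : euc R 2) tt nn nt => t n tt nn nt.
by rewrite !hdotDl !hdotZl tt nt !hdot0r !mulr0 !addr0 !add0r !mulr1.
Qed.

(** The efforts show e_q and e_p. The data of the beam velocity come from f_kappa, from f_q through
    diag (2, 1, 1), and from f_M; those of e_kappa from f_p of the beam, from e_M and [endv_slope];
    the tangential parameters from [eq + eext]. *)
Lemma par_inj x : X_b L x -> injective (par x).
Proof.
move=> Xx w w' E.
have Eq : parq w = parq w' := congr1 (fun d => d.2.1.1.1.1) E.
have Ep : parp w = parp w' := congr1 (fun d => d.2.1.1.1.2) E.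
have Efq : par_fq x w = par_fq x w' := congr1 (fun d => d.1.1.1.1.1) E.
have Egw : (parw w).1 = (parw w').1 := congr1 (fun d => d.1.1.1.2.1) E.
have Efw : par_fw x w = par_fw x w' := congr1 (fun d => d.1.1.1.2.2) E.
have EM : par_fM w = par_fM w' := congr1 (fun d => d.1.2.2) E.
have Eext : par_sigma x w - parq w = par_sigma x w' - parq w' := congr1 (fun d => d.2.2.1) E.
have EeM : par_eM w = par_eM w' := congr1 (fun d => d.2.2.2) E.
have Es : par_sigma x w = par_sigma x w' by rewrite -[LHS](subrK (parq w)) Eext -Eq subrK.
have Ew : parw w = parw w'.
  apply: (init_eta Egw); last by have [] := vec2_inj EM.
  have := congr1 (fun z => Bext x.1.1 *m z) Efq.
  have Ux : U_pos x.1.1 by case: Xx.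
  rewrite (par_flows x w) (par_flows x w') !(Bext_Zmx _ _ _ Ux) => h.
  by have [_ e _] := vec3_inj h; exact: e.
have Ek : park w = park w'.
  have [e0 /oppr_inj eL] := vec2_inj EeM.
  have eg : (park w).1 = (park w').1.
    move: Efw; rewrite /par_fw (_ : dv w = dv w'); last by rewrite /dv Ew.
    by move=> /addIr/oppr_inj.
  apply: (init_eta eg e0); move: eL; rewrite /endv e0 eg [in LHS]endv_slope [in RHS]endv_slope.
  by move=> /addrI /(mulIf L_neq0).
have [ta0 ta1] := para_sigma w Xx; have [ta0' ta1'] := para_sigma w' Xx.
have Ea : w.1.2 = w'.1.2.
  rewrite [LHS]vec2_eta [RHS]vec2_eta.
  by rewrite -[w.1.2 0 0]/(para w 0) -[w.1.2 1 0]/(para w 1) ta0 ta1 Es -ta0' -ta1'.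
move: Eq Ep Ea Ek Ew; rewrite /parq /parp /park /parw.
by case: w w' {E Efq Egw Efw EM Eext EeM Es ta0 ta1 ta0' ta1'} => [[[q p] a] [k v]] [[[q' p'] a'] [k' v']] /= -> -> -> -> ->.
Qed.

Lemma par_surj x : X_b L x -> set_surj setT (D_b L rho x) (par x).
Proof.
move=> Xx [[[[[fq fp] [fk fw]] z] [fext fM]] [[[[eq ep] [ek ew]] z'] [eext eM]]].
move=> /D_bP[hk [hw /= [[-> -> h0] [-> -> -> ->]]]].
have Ux : U_pos x.1.1 by case: Xx.
pose s : euc R 4 := eq + eext.
pose t : euc R 2 := tvec x.1.1.
pose w : Zpar := (((eq, ep), vec 2 [:: hdot t (q0 s); hdot t (qf s)]),
  ((h2'' hk, vec 2 [:: h2 hk 0; h2' hk 0]), (h2'' hw, vec 2 [:: h2 hw 0; h2' hw 0]))).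
have LL : 0 <= L <= L by rewrite L_ge0 lexx.
have vk : endv (park w) = h2 hk L by rewrite /endv /= !vec2E -H2_h2E.
have vw : endv (parw w) = h2 hw L by rewrite /endv /= !vec2E -H2_h2E.
have dk : endd (park w) = h2' hk L by rewrite /endd /= !vec2E -H2_h2'E.
have dw : endd (parw w) = h2' hw L by rewrite /endd /= !vec2E -H2_h2'E.
have lk : H2_val (park w) = ek by rewrite /H2_val /= !vec2E -H2_liftE.
have lw : H2_val (parw w) = ew by rewrite /H2_val /= !vec2E -H2_liftE.
have fdw : fd w = integralI L (fun xi => rho xi * L2_fun ew xi) by rewrite -fdE lw.
have fqE : par_fq x w = Zmx x.1.1 *m vec 3 [:: ep; h2 hw 0; h2 hw L].
  by rewrite par_flows vw /= vec2E.
have a0 : para w 0 = hdot t (q0 s) by rewrite /para /= vec2E.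
have a1 : para w 1 = hdot t (qf s) by rewrite /para /= vec2E.
have sE : s = col_mx (q0 s) (qf s) by rewrite /q0 /qf vsubmxK.
have : Bext x.1.1 *m s + vec 3 [:: fp; 0; 0] + reaction rho x ep (fd w) (h2' hk 0) (h2' hk L) (h2 hw 0) (h2 hw L) = 0.
  rewrite fdw [RHS]h0 Zmx_Bext trmxK; congr (_ + _).
  by rewrite [RHS]addrAC -mulmxDr.
rewrite sE Bext_col /reaction -/(inert x) -/(momentum x) !vec3D -/t.
rewrite (_ : 0 = vec 3 [:: 0; 0; 0]); last by apply/matrixP => -[[|[|[|//]]] i] j; rewrite !mxE.
move=> /vec3_inj[e1 e2 e3].
have b0 : beta0 x w = hdot (nvec x.1.1 : euc R 2) (q0 s).
  by move: e2; rewrite /beta0 -[(park w).2 1 0]/((vec 2 [:: h2 hk 0; h2' hk 0]) 1 0) vec2E -[parp w]/ep; lra.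
have bf : betaf x w = hdot (nvec x.1.1 : euc R 2) (qf s).
  by move: e3; rewrite /betaf dk -[parp w]/ep; lra.
(* The tangential components agree by the choice of [w], the normal ones by the balance, and the
   frame is a basis. *)
have es : par_sigma x w = s.
  by rewrite /par_sigma a0 a1 b0 bf -!(frame_decomp _ Ux) -sE.
have dvE : dv w = h2 hw L - h2 hw 0 by rewrite /dv vw -[(parw w).2 0 0]/((vec 2 [:: h2 hw 0; h2' hw 0]) 0 0) vec2E.
have efp : par_fp x w = fp.
  by rewrite /par_fp a0 a1 dvE; lra.
have eeM : par_eM w = vec 2 [:: h2 hk 0; - h2 hk L].
  by rewrite /par_eM vk -[(park w).2 0 0]/((vec 2 [:: h2 hk 0; h2' hk 0]) 0 0) vec2E.
have efM : par_fM w = vec 2 [:: h2' hw 0; h2' hw L].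
  by rewrite /par_fM dw -[(parw w).2 1 0]/((vec 2 [:: h2 hw 0; h2' hw 0]) 1 0) vec2E.
exists w => //.
rewrite /par fqE efp efM lk lw es eeM -Zmx_Bext /par_fw dvE (Z0_eq z 0) (Z0_eq z' 0) -[parq w]/eq.
by rewrite -[s - eq]/(eq + eext - eq) [eq + eext]addrC addrK.
Qed.

Lemma D_b_modulated : modulated_dirac_structure (X_b L) (D_b L rho).
Proof.
apply: (modulated_dirac_structureP (A := par)).
- by move=> x [Xr _]; exact: D_b_dirac.
- exact: par_family.
- move=> x Xx; split; [by move=> w _; exact: par_fun|exact: in2W (par_inj Xx)|exact: par_surj].
Qed.
End parametrization.

(** * Graphs of bounded symmetric operators *)

Section smooth_maps.
Context {R : realType}.

Lemma blin_diff {V W : normedModType R} (f : V -> W) x : blin f ->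
  differentiable f x /\ ('d f x = f :> (V -> W)).
Proof.
move=> bf; have [l lE] := blin_pack bf.
have cl : continuous l.
  by rewrite (_ : (l : V -> W) = f); [exact: blin_continuous|apply/funext => v; exact: lE].
rewrite (_ : f = l); last by apply/funext => v; rewrite lE.
by split; [exact: linear_differentiable|exact: diff_lin].
Qed.

Lemma blin_C1 {V W : normedModType R} (U : set V) (f : V -> W) : blin f -> C1_on U f.
Proof.
move=> bf; split; first by move=> x _; have [] := blin_diff x bf.
rewrite (_ : (fun x => _) = fun=> f); last by apply/funext => x; have [] := blin_diff x bf.
by apply: blin_family_opnorm; exact: blin_family_const.
Qed.

Lemma open_fst {U V : hilbertType R} (A : set U) : open A -> open [set z : U \oplus V | A z.1].
Proof.
move=> oA; rewrite (_ : [set z | A z.1] = (fst : U \oplus V -> U) @^-1` A)//.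
by apply: open_comp => // z _; exact: (blin_continuous blin_fst).
Qed.

Lemma closed_snd0 {U V : hilbertType R} : closed [set z : U \oplus V | z.2 = 0].
Proof.
rewrite (_ : [set z | z.2 = 0] = (snd : U \oplus V -> V) @^-1` [set 0])//.
apply: closed_comp; first by move=> z _; exact: (blin_continuous blin_snd).
by apply: accessible_closed_set1; apply: hausdorff_accessible; exact: norm_hausdorff.
Qed.

(** Translates between increments at 0, as in [is_derive], and quotients as [s] tends to [t], as in
    [time_derivative]. *)
Lemma cvg_is_derive {W : normedModType R} (g : R -> W) (t : R) (v : W) :
  is_derive t (1 : R) g v <-> (s - t)^-1 *: (g s - g t) @[s --> t^'] --> v.
Proof.
have e : (fun h : R => h^-1 *: ((g \o shift t) (h *: 1) - g t)) = (fun h => h^-1 *: (g (h + t) - g t)).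
  by apply/funext => h; rewrite /= [h *: 1]mulr1.
have sh (P : set W) : (\forall s \near t^', P ((s - t)^-1 *: (g s - g t))) <->
    (\forall h \near (0 : R)^', P (h^-1 *: (g (h + t) - g t))).
  split; rewrite /dnbhs !near_withinE.
    move/nbhs0P; apply: filterS => h hP h0.
    by move: hP; rewrite addrAC subrr add0r [t + h]addrC; apply; rewrite -subr_eq0 addrK.
  move=> hP; apply: (nbhs0P [set s : R | s != t -> P ((s - t)^-1 *: (g s - g t))] t).2; apply: filterS hP => h hP /= h0.
  rewrite addrAC subrr add0r [t + h]addrC; apply: hP.
  by move: h0; rewrite -subr_eq0 addrAC subrr add0r.
split=> [[dg <-]|c].
  by move=> A /dg; rewrite e => /sh.
have c' : (fun h : R => h^-1 *: (g (h + t) - g t)) @ (0 : R)^' --> v.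
  by move=> A /c/sh.
split; first by apply/cvg_ex; exists v; rewrite e.
by rewrite /derive e; apply: cvg_lim => //; exact: norm_hausdorff.
Qed.

End smooth_maps.

Section graph.
Context {R : realType} {Z : hilbertType R} (X : set Z) (G : Z -> Z).
Hypothesis openX : open X.
Hypothesis bG : blin G.
Hypothesis symG : forall x y, hdot (G x) y = hdot x (G y).

Definition graph_on : set (Z \oplus Z) := [set z | X z.1 /\ z.2 = G z.1].

(* The shear [phi] straightens the graph. *)
Lemma graph_submanifold : C1_submanifold graph_on.
Proof.
move=> z [Xz zE].
pose U : set (Z \oplus Z) := [set z | X z.1].
pose phi (z : Z \oplus Z) : Z \oplus Z := (z.1, z.2 - G z.1).
pose psi (z : Z \oplus Z) : Z \oplus Z := (z.1, z.2 + G z.1).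
have oU : open U by exact: open_fst.
have bG1 : blin (fun z : Z \oplus Z => G z.1) by exact: (blin_comp blin_fst bG).
have bphi : blin phi by apply: blin_pair; [exact: blin_fst|apply: blinD; [exact: blin_snd|exact: blinN]].
have bpsi : blin psi by apply: blin_pair; [exact: blin_fst|apply: blinD; [exact: blin_snd|exact: bG1]].
exists U, U, phi, psi, [set z | z.2 = 0]; split => //.
- split; last by split; exact: blin_C1.
  split=> //.
    apply/seteqP; split => [_ [w Uw <-] //|w Uw].
    by exists (psi w) => //; rewrite /phi /psi /= addrK; case: w Uw.
  by move=> [a b] _; rewrite /phi /psi /= subrK.
- split => //; first exact: closed_snd0.
  by move=> a x y /= -> ->; rewrite scaler0 addr0.
apply/seteqP; split.
  by move=> _ [w [Uw [_ wE]] <-]; split => //=; rewrite wE subrr.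
move=> [a b] [Ua /= ->]; exists (a, G a); rewrite /phi /= ?subrr//.
Qed.

(** The bounded operator [l] vanishes on difference quotients of curves in the graph, hence on their
    limits. Conversely the line [z + s *: v] stays in the graph for small [s], since [X] is open. *)
Lemma graph_tangent z : graph_on z -> tangent_space graph_on z = [set v | v.2 = G v.1].
Proof.
move=> [Xz zE]; apply/seteqP; split => v.
  move=> [g [g0 gM /cvg_is_derive gd]] /=.
  pose l (w : Z \oplus Z) : Z := w.2 - G w.1.
  have bl : blin l.
    by apply: blinD; [exact: blin_snd|apply: blinN; exact: (blin_comp blin_fst bG)].
  have cl : (l \o (fun h : R => (h - 0)^-1 *: (g h - g 0))) x @[x --> (0:R)^'] --> l v.
    by apply: continuous_cvg gd; exact: (blin_continuous bl).
  have c0 : (l \o (fun h : R => (h - 0)^-1 *: (g h - g 0))) x @[x --> (0:R)^'] --> (0 : Z).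
    apply: cvg_near_cst; near=> h.
    have gh : graph_on (g h) by near: h; apply: nbhs_dnbhs; exact: gM.
    by rewrite /= (blinZB _ _ _ bl) g0 /l; case: gh => _ ->; rewrite zE !subrr scaler0.
  by apply/eqP; rewrite -subr_eq0; apply/eqP; exact: (cvg_unique (@norm_hausdorff _ _) cl c0).
move=> /= vE; exists (fun s : R => z + s *: v); split.
- by rewrite scale0r addr0.
- have c : (fun s : R => z + s *: v) @ (0 : R) --> z.
    rewrite -[X in _ --> X]addr0 -(scale0r v); apply: cvgD; first exact: cvg_cst.
    by apply: cvgZl; exact: cvg_id.
  have oU : open_nbhs z [set z : Z \oplus Z | X z.1] by split => //; exact: open_fst.
  apply: (filterS (F := nbhs (0 : R)) _ (c _ (open_nbhs_nbhs oU))) => s Xs; split => //=.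
  have [lin _] := bG.
  by rewrite zE vE [z.1 + _]addrC lin addrC.
- apply/cvg_is_derive; apply: cvg_near_cst; near=> h.
  have h0 : h != 0 by near: h; exact: nbhs_dnbhs_neq.
  by rewrite scale0r addr0 subr0 addrAC subrr add0r scalerA mulVf// scale1r.
Unshelve. all: by end_near. Qed.

(** The tangent space is the graph of [G], isotropic by symmetry of [G]; testing [v] against all
    [(w, G w)] forces [v.2 = G v.1]. *)
Lemma lagrangian_graph : lagrangian_submanifold graph_on.
Proof.
split=> [|z zM v]; first exact: graph_submanifold.
rewrite graph_tangent//=; split=> [vE w wE|h].
  by rewrite vE wE -symG (hdotC w.1) subrr.
apply: hdot_inj => w.
have /eqP := h (w, G w) erefl; rewrite /= subr_eq0 -symG => /eqP.
by rewrite [RHS]hdotC => ->.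
Qed.

End graph.

(** * Quadratic energies and their gradients *)

Section quadratic.
Context {R : realType} {Z : hilbertType R} (G : Z -> Z).
Hypothesis bG : blin G.
Hypothesis symG : forall x y, hdot (G x) y = hdot x (G y).

Definition energy (x : Z) : R := 2^-1 * hdot (G x) x.

Lemma energyD x h : energy (h + x) = energy x + hdot (G x) h + 2^-1 * hdot (G h) h.
Proof.
have GD : G (h + x) = G h + G x by have [lin _] := bG; have := lin 1 h x; rewrite !scale1r.
rewrite /energy GD !hdotDl !hdotDr (symG h x) (hdotC h (G x)); lra.
Qed.

Lemma energy_diff x : differentiable energy x /\ forall h, 'd energy x h = hdot (G x) h.
Proof.
have bl : blin (fun h => hdot (G x) h : R^o) by exact: blin_hdot.
have [l lE] := blin_pack bl.
have cl : continuous l.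
  by rewrite (_ : (l : Z -> R^o) = fun h => hdot (G x) h); [exact: blin_continuous|apply/funext].
have eo : (energy : Z -> R^o) \o shift x = cst (energy x) + l +o_ (0 : Z) id.
  have [_ [M M0 GM]] := bG; have M1 : 0 < M + 1 by rewrite ltr_wpDl.
  apply/eqaddoP => e e0; near=> h.
  rewrite /= !fctE lE energyD /= -/(energy x).
  have -> : energy x + hdot (G x) h + 2^-1 * hdot (G h) h - (energy x + hdot (G x) h) = 2^-1 * hdot (G h) h :> R by lra.
  (* The remainder is at most [M * |h|^2], so this radius makes it at most [e * |h|]. *)
  have hs : `|h| <= e / (M + 1).
    rewrite -[`|h|]normrN -[- h]sub0r ltW//; near: h.
    by apply: cvgr_dist_lt; [exact: cvg_id|rewrite divr_gt0].
  rewrite normrM ger0_norm// (@le_trans _ _ (1 * `|hdot (G h) h|)) ?ler_wpM2r ?invf_le1 ?ler1n// mul1r.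
  rewrite (le_trans (norm_hdot_le _ _))// ler_wpM2r//.
  rewrite (le_trans (GM _))// (le_trans (ler_wpM2l M0 hs))// mulrCA ger_pMr// ler_pdivrMr// mul1r lerDl//.
have dE := diff_unique cl eo.
split; last by move=> h; rewrite dE lE.
by apply/diff_locallyP; rewrite dE.
Unshelve. all: by end_near. Qed.

Lemma energy_storage (X : set Z) : storage_function X (graph_on X G) energy.
Proof.
move=> x e; have [dx dE] := energy_diff x; split=> [[/= Xx ->]|[Xx _ ed]]; split=> //=.
by apply: hdot_inj => h; rewrite -ed dE.
Qed.

End quadratic.

(** * The storage relation of the beam *)

Section beam_storage.
Context {R : realType} (L : R) (rho EI : R -> R).
Hypothesis rhoV_mult : multiplier L (fun xi => (rho xi)^-1).
Hypothesis EI_mult : multiplier L EI.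

(** The gradient of [H_b]; the entry 0 reflects that the energy does not depend on the position. *)
Definition beam_effort (x : Zb_store L) : Zb_store L :=
  ((0, x.1.2 / mass L rho), (mulI EI x.2.1, mulI (fun xi => (rho xi)^-1) x.2.2)).

Lemma blin_mulI a : multiplier L a -> blin (mulI a : L2I L -> L2I L).
Proof. by move=> ha; split; [move=> c x y; exact: mulI_lin|exact: mulI_bounded]. Qed.

Lemma beam_effort_blin : blin beam_effort.
Proof.
have b1 : blin (fst : Zb_store L -> Zr_store R) by exact: blin_fst.
have b2 : blin (snd : Zb_store L -> Zf_store L) by exact: blin_snd.
have b12 : blin (fun x : Zb_store L => x.1.2) by exact: (blin_comp b1 blin_snd).
have b21 : blin (fun x : Zb_store L => x.2.1) by exact: (blin_comp b2 blin_fst).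
have b22 : blin (fun x : Zb_store L => x.2.2) by exact: (blin_comp b2 blin_snd).
rewrite /beam_effort; apply: (blin_pair (V := Zr_store R) (W := Zf_store L)).
  apply: (blin_pair (V := euc R 4) (W := R^o)).
    by split=> [c x y|]; [rewrite scaler0 addr0|exists 0 => // x; rewrite normr0 mul0r].
  rewrite (_ : (fun x => _) = fun x : Zb_store L => (mass L rho)^-1 *: x.1.2); first exact: blin_scale.
  by apply/funext => x; rewrite mulrC.
apply: (blin_pair (V := L2I L) (W := L2I L)).
- exact: (blin_comp b21 (blin_mulI EI_mult)).
- exact: (blin_comp b22 (blin_mulI rhoV_mult)).
Qed.

Lemma beam_effort_sym x y : hdot (beam_effort x) y = hdot x (beam_effort y).
Proof.
rewrite !hdot_pair /= hdot0l hdot0r (mulI_sym _ _ EI_mult) (mulI_sym _ _ rhoV_mult) !hdot_real.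
by congr (_ + _ + _); rewrite mulrAC mulrA.
Qed.

Lemma L_b_graph : L_b L rho EI = graph_on (X_b L) beam_effort.
Proof.
apply/seteqP; split => -[[[zeta p] [k w]] [[e1 e2] [e3 e4]]].
  by move=> [[U [-> ->]] [-> ->]]; split.
by move=> [[/= U _] [-> -> -> ->]].
Qed.

Lemma X_b_open : open (X_b L).
Proof.
rewrite (_ : X_b L = [set x | [set y : Zr_store R | U_pos y.1] x.1]); last first.
  by apply/seteqP; split => x; [case|split].
by apply: open_fst; apply: open_fst; exact: open_U_pos.
Qed.

Lemma H_b_energy x : H_b L rho EI x = energy beam_effort x.
Proof.
case: x => [[zeta p] [k w]]; rewrite /energy !hdot_pair /= hdot0l hdot_real !hdot_mulI// add0r.
rewrite mulrDr; congr (_ + _).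
  have h (a b : R) : a ^+ 2 / (2 * b) = 2^-1 * (a / b * a) by rewrite invfM; ring.
  exact: h.
congr (_ * _); rewrite addrC.
transitivity (integralI L (fun xi : measurableTypeR R => (rho xi)^-1 * L2_fun w xi * L2_fun w xi + EI xi * L2_fun k xi * L2_fun k xi)).
  by apply: eq_Rintegral => x _; rewrite !expr2 !mulrA.
apply: RintegralD; [exact: measurable_itv|exact: mul_integrableI|exact: mul_integrableI].
Qed.

Lemma beam_storage : storage_function (X_b L) (L_b L rho EI) (H_b L rho EI).
Proof.
rewrite L_b_graph (_ : H_b L rho EI = energy beam_effort); last by apply/funext => x; exact: H_b_energy.
by apply: energy_storage; [exact: beam_effort_blin|exact: beam_effort_sym].
Qed.

Lemma beam_lagrangian : lagrangian_submanifold (L_b L rho EI).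
Proof.
by rewrite L_b_graph; apply: lagrangian_graph; [exact: X_b_open|exact: beam_effort_blin|exact: beam_effort_sym].
Qed.

End beam_storage.

(** * Trajectories *)

Section time_derivatives.
Context {R : realType}.
Implicit Types (I : set R) (t : R).

(** Polarization reduces joint continuity of the inner product to continuity of the norm. *)
Lemma cvg_hdot {T : Type} {F : set_system T} {FF : Filter F} {V : hilbertType R} (f g : T -> V) a b :
  f @ F --> a -> g @ F --> b -> (fun x => hdot (f x) (g x) : R) @ F --> (hdot a b : R).
Proof.
move=> fa gb.
have pol (x y : V) : hdot x y = 2^-1 * (`|x + y| ^+ 2 - `|x| ^+ 2 - `|y| ^+ 2).
  by rewrite -!hdotxx hdotDl !hdotDr (hdotC y x); lra.
have sq (h : T -> V) c : h @ F --> c -> (fun x => `|h x| ^+ 2 : R) @ F --> `|c| ^+ 2.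
  by move=> hc; rewrite expr2; apply: cvgM; exact: cvg_norm.
rewrite pol; under eq_fun do rewrite pol.
by apply: cvgMr; apply: cvgB; [apply: cvgB|]; apply: sq => //; exact: cvgD.
Qed.

Lemma time_derivative_comp {V W : normedModType R} (l : V -> W) I x t v : blin l ->
  time_derivative I x t v -> time_derivative I (l \o x) t (l v).
Proof.
move=> bl h.
rewrite /time_derivative; under eq_fun do rewrite /= -(blinZB _ _ _ bl).
have := continuous_cvg _ (blin_continuous bl (x := v)) h; exact.
Qed.

Lemma time_derivative_pair {U V : hilbertType R} I (x : R -> U) (y : R -> V) t u v :
  time_derivative I (fun s => (x s, y s) : U \oplus V) t (u, v) <->
  time_derivative I x t u /\ time_derivative I y t v.
Proof.
split=> [h|[hx hy]].
  by split; [exact: (time_derivative_comp blin_fst h)|exact: (time_derivative_comp blin_snd h)].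
apply/cvgrPdist_lt => e e0; have e20 : 0 < e / 2 by rewrite divr_gt0.
move/cvgrPdist_lt/(_ _ e20) : hx => hx; move/cvgrPdist_lt/(_ _ e20) : hy => hy.
apply: filterS2 hx hy => s hx hy.
rewrite (le_lt_trans (hprod_norm_le _))// (splitr e); exact: ltrD.
Qed.

Lemma time_derivative_continuous {V : normedModType R} I (x : R -> V) t v :
  time_derivative I x t v -> x s @[s --> within I (nbhs t)] --> x t.
Proof.
move=> /cvgrPdist_lt/(_ _ ltr01) h; apply/cvgrPdist_lt => e e0.
have n0 : 0 < `|v| + 1 by rewrite ltr_wpDl.
have hb : \forall s \near t, `|t - s| < e / (`|v| + 1).
  have /cvgrPdist_lt : id @ t --> t by exact: cvg_id.
  by apply; rewrite divr_gt0.
move: h; rewrite /dnbhs !near_withinE => h.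
apply: filterS2 h hb => s hs ts Is.
have [->|st] := eqVneq s t; first by rewrite subrr normr0.
have /ltW q := hs st Is; set d := _ *: _ in q.
have -> : x t - x s = (t - s) *: d.
  by rewrite /d scalerA -(opprB s t) mulNr divff ?subr_eq0// scaleN1r opprB.
rewrite normrZ.
have dn : `|d| <= `|v| + 1.
  rewrite -[d](subrK v) (le_trans (ler_normD _ _))// addrC lerD2l distrC//.
by rewrite (le_lt_trans (ler_wpM2l (normr_ge0 _) dn))// -ltr_pdivlMr.
Qed.

(** The product rule for the squared norm, with one factor at [s] and the other at [t]; continuity
    of [x] at [t] takes care of the factor at [s]. *)
Lemma time_derivative_hdot {V : hilbertType R} I (x : R -> V) t v : hdot v (x t) = 0 ->
  time_derivative I x t v -> time_derivative I (fun s => hdot (x s) (x s) : R) t 0.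
Proof.
move=> vx h; have c := time_derivative_continuous h.
have c' : x s @[s --> within I t^'] --> x t.
  by move=> A /c hA; apply: (filterS (F := nbhs t) _ hA) => s hs _; exact: hs.
have -> : (0 : R) = hdot v (x t) + hdot (x t) v by rewrite (hdotC (x t)) vx addr0.
rewrite /time_derivative.
under eq_fun => s.
  have -> : (s - t)^-1 *: (hdot (x s) (x s) - hdot (x t) (x t)) =
      hdot ((s - t)^-1 *: (x s - x t)) (x s) + hdot (x t) ((s - t)^-1 *: (x s - x t)) :> R.
    by rewrite hdotZr hdotZl hdotBl hdotBr -mulrDr; congr (_ * _); lra.
  over.
by apply: cvgD; apply: cvg_hdot => //; exact: cvg_cst.
Qed.

(** The mean value theorem on [s, t]: at interior points the derivative relative to [I] is the
    ordinary one, and at the end points it still provides continuity. *)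
Lemma time_derivative0_cst I (f : R -> R) : is_interval I ->
  (forall t, I t -> time_derivative I f t 0) -> forall s t, I s -> I t -> f s = f t.
Proof.
move=> itvI df.
suff h s t : I s -> I t -> s < t -> f s = f t.
  by move=> s t Is It; case: (ltgtP s t) => [|ts|->//]; [exact: h|symmetry; exact: h].
move=> Is It st.
have sub x : s <= x <= t -> I x by move=> ?; exact: (itvI s t).
have [x xst||c _ /eqP] := @MVT_segment _ f (fun=> 0) s t (ltW st).
- move: xst; rewrite in_itv /= => xst.
  have Ix : I x by apply: sub; move/andP: xst => [? ?]; rewrite !ltW.
  apply/cvg_is_derive => A /(df x Ix) hA.
  have near_st : \forall y \near x, s < y < t.
    by apply: near_in_itvoo; rewrite in_itv.
  have hA' : \forall y \near x, y != x -> I y -> A ((y - x)^-1 *: (f y - f x)) by exact: hA.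
  suff : \forall y \near x, y != x -> A ((y - x)^-1 *: (f y - f x)) by [].
  apply: filterS2 hA' near_st => y hy /andP[sy yt] yx.
  by apply: hy => //; apply: sub; rewrite !ltW.
- apply/subspace_continuousP => x /=; rewrite in_itv /= => xst.
  move=> A /(time_derivative_continuous (df x (sub x xst))) hA.
  by apply: (filterS (F := nbhs x) _ hA) => y hy; rewrite /= in_itv /= => /sub; exact: hy.
- by rewrite mul0r subr_eq0 => /eqP.
Qed.

End time_derivatives.

(** * The beam equations *)

Section trajectories.
Context {R : realType} (L : R) (rho EI : R -> R).
Hypothesis L_gt0 : 0 < L.
Hypothesis rho_mult : multiplier L rho.
Hypothesis rhoV_mult : multiplier L (fun xi => (rho xi)^-1).
Hypothesis rho_neq0 : {ae interval_measure L, forall x : measurableTypeR R, 0 <= x <= L -> rho x != 0}.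

Lemma span_Zmx_orth (zeta : euc R 4) (a b c : R) :
  let v : euc R 4 := Zmx zeta *m vec 3 [:: a; b; c] in
  hdot (qf v - q0 v : euc R 2) (qf zeta - q0 zeta : euc R 2) = 0.
Proof.
rewrite /= Zmx_vec /qf /q0 col_mxKd col_mxKu opprD addrACA subrr add0r -scalerBl.
rewrite -/(qf zeta) -/(q0 zeta).
(* When the end points coincide, [tvec] has a default value and [qf - q0] cannot be rescaled from
   it, but the second factor is 0. *)
have [d0|d0] := eqVneq (qf zeta - q0 zeta) (0 : euc R 2); first by rewrite d0 hdot0r.
have -> : qf zeta - q0 zeta = len zeta *: (tvec zeta : euc R 2).
  by rewrite /tvec scalerA divff ?scale1r// normr_eq0.
rewrite /nvec; move: (tvec zeta : euc R 2) => t.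
by rewrite hdotZl hdotZr hdot_J !mulr0.
Qed.

Lemma len_invariant (I : set R) (x : R -> Zb_store L) (fP eP : R -> Zb_ext R) :
  time_interval I ->
  ph_trajectory (X_b L) (D_b L rho) (L_b L rho EI) (R_b L) I x fP eP ->
  forall s t, I s -> I t -> len (x s).1.1 = len (x t).1.1.
Proof.
move=> [itvI _] traj s t Is It.
pose d r : euc R 2 := qf (x r).1.1 - q0 (x r).1.1.
have dd r : I r -> time_derivative I (fun r => hdot (d r) (d r) : R) r 0.
  move=> Ir; have [_ [xdot [eL [fR [eR [dx Dx _ _]]]]]] := traj r Ir.
  have dz : time_derivative I (fun r => (x r).1.1) r xdot.1.1.
    have := time_derivative_comp blin_fst dx; exact: time_derivative_comp blin_fst.
  apply: time_derivative_hdot (time_derivative_comp blin_span dz).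
  move: Dx; case: (fP r) (eP r) xdot eL {dx dz} => [fext fM] [eext eM] [[fq fp] [fk fw]] [[eq ep] [ek ew]].
  by move=> /D_bP[hk [hw /= [[-> _ _] _]]]; exact: span_Zmx_orth.
have := time_derivative0_cst itvI dd Is It.
by rewrite !hdotxx => /eqP; rewrite eqrXn2// => /eqP.
Qed.

(** In the normal rows the rigid term [p_t / (m L)] times f_d and the flexible term [P_b / L] times
    e_p are the same number and cancel, so the boundary conditions contain shear forces only. In the
    tangential row [omega * P_b] survives. *)
Lemma reaction_balance (x : Zb_store L) (F0 Ff : euc R 2) (fp d0 dL w0 wL : R) :
  0 = (Zmx x.1.1)^T *m 0 + vec 3 [:: fp; 0; 0] + Bext x.1.1 *m (- col_mx F0 Ff) +
      reaction rho x (x.1.2 / mass L rho)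
        (integralI L (fun xi => rho xi * L2_fun (mulI (fun xi => (rho xi)^-1) x.2.2) xi)) d0 dL w0 wL <->
  [/\ fp = (wL - w0) / L * integralI L (L2_fun x.2.2) + hdot (tvec x.1.1 : euc R 2) F0 + hdot (tvec x.1.1 : euc R 2) Ff,
      d0 = hdot (nvec x.1.1 : euc R 2) F0 & - dL = hdot (nvec x.1.1 : euc R 2) Ff].
Proof.
have c_fd (p m P : R) : p / (m * L) * P = P / L * (p / m) by rewrite invfM; ring.
have fpE (P a : R) : P / L * a = a / L * P by ring.
rewrite mulmx0 add0r mulmxN Bext_col /reaction /= (integralI_mul_inv _ rho_mult rhoV_mult rho_neq0) c_fd fpE.
rewrite (_ : - vec 3 [:: _; _; _] = vec 3
    [:: - (hdot (tvec x.1.1 : euc R 2) F0 + hdot (tvec x.1.1 : euc R 2) Ff);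
        - hdot (nvec x.1.1 : euc R 2) F0; - hdot (nvec x.1.1 : euc R 2) Ff]); last first.
  by apply/matrixP => -[[|[|[|//]]] i] j; rewrite (ord1 j) !mxE.
rewrite !vec3D (_ : 0 = vec 3 [:: 0; 0; 0] :> 'cV[R]_3); last first.
  by apply/matrixP => -[[|[|[|//]]] i] j; rewrite !mxE.
set P := integralI _ _; split=> [/vec3_inj[e1 e2 e3]|[-> -> e3]].
  by split; lra.
by congr (vec 3 [:: _; _; _]); lra.
Qed.

Lemma vec2N (a b : R) : - vec 2 [:: a; b] = vec 2 [:: - a; - b].
Proof. by apply/matrixP => -[[|[|//]] i] j; rewrite (ord1 j) !mxE. Qed.

Lemma D_b_beam (zeta : euc R 4) (p : R) (k w : L2I L) fq (fp : R) fk fw z z'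
    (F0 Ff v0 vf : euc R 2) (M0 Mf omega0 omegaf : R) :
  D_b L rho ((zeta, p), (k, w))
    (((((fq, fp), (fk, fw)), z), (col_mx v0 vf, vec 2 [:: omega0; omegaf])),
     ((((0, p / mass L rho), (mulI EI k, mulI (fun xi => (rho xi)^-1) w)), z'),
      (- col_mx F0 Ff, - vec 2 [:: M0; Mf]))) <->
  exists (hk : H2 (mulI EI k)) (hp : H2 (mulI (fun xi => (rho xi)^-1) w)),
  let tt : euc R 2 := tvec zeta in
  let nn : euc R 2 := nvec zeta in
  let omega := (h2 hp L - h2 hp 0) / L in
  [/\ fq = Zmx zeta *m vec 3 [:: p / mass L rho; h2 hp 0; h2 hp L],
      fp = omega * integralI L (L2_fun w) + hdot tt F0 + hdot tt Ff,
      fk = h2'' hp &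
      fw = - h2'' hk - (omega * (p / mass L rho)) *: classI L rho] /\
  [/\ h2' hk 0 = hdot nn F0, - h2' hk L = hdot nn Ff,
      - h2 hk 0 = M0 & h2 hk L = Mf] /\
  [/\ v0 = (p / mass L rho) *: tt + h2 hp 0 *: nn,
      vf = (p / mass L rho) *: tt + h2 hp L *: nn,
      omega0 = h2' hp 0 & omegaf = h2' hp L].
Proof.
have nE (a b c : R) : a / (b * L) * c = c / L * (a / b) by rewrite invfM; ring.
have bal := reaction_balance ((zeta, p), (k, w)).
split.
  move=> /D_bP[hk [hp /= [[-> extE /bal[-> d0E dLE]] [-> -> ME eE]]]].
  exists hk, hp => /=; split; first by split; rewrite // nE.
  have [vE0 vfE] : v0 = (p / mass L rho) *: (tvec zeta : euc R 2) + h2 hp 0 *: (nvec zeta : euc R 2) /\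
      vf = (p / mass L rho) *: (tvec zeta : euc R 2) + h2 hp L *: (nvec zeta : euc R 2).
    by apply: eq_col_mx; rewrite extE -Zmx_Bext Zmx_vec.
  have [om0 omf] := vec2_inj ME.
  move: eE; rewrite vec2N => /vec2_inj[m0E mfE].
  split; split => //.
    by rewrite -m0E opprK.
  by apply: oppr_inj; rewrite mfE.
move=> [hk [hp /= [[-> -> -> ->] [[d0E dLE <- <-] [-> -> -> ->]]]]].
apply/D_bP; exists hk, hp => /=; split.
  by split; [|rewrite -Zmx_Bext Zmx_vec|exact/bal].
by split; rewrite // ?vec2N ?opprK ?nE.
Qed.

Lemma trajectory_beam (I : set R) (zeta : R -> euc R 4) (pt : R -> R)
    (kappa pb : R -> L2I L) (F0 Ff v0 vf : R -> euc R 2) (M0 Mf omega0 omegaf : R -> R) :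
  (forall t, I t -> U_pos (zeta t)) ->
  ph_trajectory (X_b L) (D_b L rho) (L_b L rho EI) (R_b L) I
    (fun t => ((zeta t, pt t), (kappa t, pb t)))
    (fun t => (col_mx (v0 t) (vf t), vec 2 [:: omega0 t; omegaf t]))
    (fun t => (- col_mx (F0 t) (Ff t), - vec 2 [:: M0 t; Mf t])) <->
  moving_beam L rho EI I zeta pt kappa pb F0 Ff M0 Mf v0 vf omega0 omegaf.
Proof.
move=> Upos; split => h t It.
  have [_ [[[fq fp] [fk fw]] [eL [fR [eR [dx Dx Lx _]]]]]] := h t It.
  move: Lx dx Dx; rewrite L_b_graph => -[_ /= ->].
  move=> /time_derivative_pair[/time_derivative_pair[dq dp] /time_derivative_pair[dk dw]].
  move=> /D_b_beam[hk [hp /= [[fqE fpE fkE fwE] bdry]]].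
  by exists hk, hp => /=; split; first by rewrite -fqE -fpE -fkE -fwE.
have [hk [hp /= [[dq dp dk dw] bdry]]] := h t It.
split; first by split => //; exact: Upos.
have [xdot dx xdotE] : exists2 xdot : Zb_store L, time_derivative I (fun t => ((zeta t, pt t), (kappa t, pb t)) : Zb_store L) t xdot &
    xdot = ((Zmx (zeta t) *m vec 3 [:: pt t / mass L rho; h2 hp 0; h2 hp L],
      (h2 hp L - h2 hp 0) / L * integralI L (L2_fun (pb t)) +
        hdot (tvec (zeta t) : euc R 2) (F0 t) + hdot (tvec (zeta t) : euc R 2) (Ff t)),
     (h2'' hp, - h2'' hk - ((h2 hp L - h2 hp 0) / L * (pt t / mass L rho)) *: classI L rho)).
  eexists; last by reflexivity.
  by apply/time_derivative_pair; split; apply/time_derivative_pair; split; [exact: dq|exact: dp|exact: dk|exact: dw].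
exists xdot.
exists (beam_effort rho EI ((zeta t, pt t), (kappa t, pb t))), 0, 0; split.
- exact: dx.
- by rewrite xdotE; apply/D_b_beam; exists hk, hp.
- by split=> //; split=> //; exact: Upos.
- by [].
Qed.

End trajectories.

Theorem proposition12 (R : realType) (L : R) (rho EI : R -> R)
    (L_gt0 : 0 < L)
    (rho_pos : uniformly_positive L rho) (EI_pos : uniformly_positive L EI)
    (rho_bnd : LinftyI L rho)
    (rhoV_bnd : LinftyI L (fun xi => (rho xi)^-1))
    (EI_bnd : LinftyI L EI)
    (EIV_bnd : LinftyI L (fun xi => (EI xi)^-1)) :
  [/\ (forall (xr : Zr_store R) (xf : Zf_store L), X_r xr -> X_f L xf ->
         set_surj (D_r L rho xr `*` D_f L rho xf) setT (Gamma L)),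
      modulated_dirac_structure (X_b L) (D_b L rho),
      port_hamiltonian_system (X_b L) (D_b L rho) (L_b L rho EI) (R_b L),
      (forall (I : set R) (x : R -> Zb_store L) (fP eP : R -> Zb_ext R),
         time_interval I ->
         ph_trajectory (X_b L) (D_b L rho) (L_b L rho EI) (R_b L) I x fP eP ->
         (exists2 t, I t & len (x t).1.1 = L) ->
         forall t, I t -> len (x t).1.1 = L) &
      (forall (I : set R) (zeta : R -> euc R 4) (pt : R -> R)
         (kappa pb : R -> L2I L) (F0 Ff v0 vf : R -> euc R 2)
         (M0 Mf omega0 omegaf : R -> R),
         time_interval I -> (forall t, I t -> len (zeta t) = L) ->
         ph_trajectory (X_b L) (D_b L rho) (L_b L rho EI) (R_b L) I
           (fun t => ((zeta t, pt t), (kappa t, pb t)))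
           (fun t => (col_mx (v0 t) (vf t), vec 2 [:: omega0 t; omegaf t]))
           (fun t => (- col_mx (F0 t) (Ff t), - vec 2 [:: M0 t; Mf t]))
         <->
         moving_beam L rho EI I zeta pt kappa pb F0 Ff M0 Mf
           v0 vf omega0 omegaf)] /\
  storage_function (X_b L) (L_b L rho EI) (H_b L rho EI).
Proof.
have rho_mult := LinftyI_multiplier L_gt0 rho_bnd.
have rhoV_mult := LinftyI_multiplier L_gt0 rhoV_bnd.
have EI_mult := LinftyI_multiplier L_gt0 EI_bnd.
have rho_neq0 := uniformly_positive_neq0 rho_pos.
have modD : modulated_dirac_structure (X_b L) (D_b L rho) by exact: D_b_modulated.
split; last exact: beam_storage.
split.
- by move=> xr xf Xr _; exact: Gamma_surj.
- exact: modD.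
- split; [exact: X_b_open|exact: modD|exact: beam_lagrangian|].
  by move=> x _ f e [-> ->]; rewrite hdot0l.
- move=> I x fP eP itvI traj [s Is xs] t It.
  exact: (etrans (len_invariant itvI traj It Is) xs).
- move=> I zeta pt kappa pb F0 Ff v0 vf M0 Mf omega0 omegaf _ lenL.
  (* [ph_trajectory] requires [U_pos], which [moving_beam] does not record; it follows from the
     length being L > 0. *)
  apply: trajectory_beam => // t It /eqP; rewrite eq_sym -subr_eq0 -normr_eq0.
  by rewrite -/(len (zeta t)) lenL// gt_eqF.
Qed.
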